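(* For every vector superspace $V$ over a field $\mathbb F$ of characteristic $0$ with an $\mathbb F[\partial]$-module structure ($\partial$ even), there is a canonical injective morphism of graded operads $$\mathrm{gr}\,P^{\mathrm{ch}}(V)\hookrightarrow P^{\mathrm{cl}}(V),$$ mapping $\bar X\in\mathrm{gr}^rP^{\mathrm{ch}}(n)$, with representative $X\in F^rP^{\mathrm{ch}}(n)$, to the element of $\mathrm{gr}^rP^{\mathrm{cl}}(n)$ whose value on each graph $\Gamma\in\mathcal G(n)$ with $r$ edges is $X^\Gamma:=X(\,\cdot\,;p_\Gamma)$, where $p_\Gamma=\prod_{(i\to j)\in E(\Gamma)}(z_i-z_j)^{-1}$. This morphism is a bijection $\mathrm{gr}\,P^{\mathrm{ch}}(n)\to P^{\mathrm{cl}}(n)$ for $n=0,1,2$.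
   Context: $\langle\Phi\rangle$ denotes the image of $\Phi$; $z_{ij}=z_i-z_j$; $\mathcal O^{\star T}_n=\mathbb F[z_{ij}^{\pm1}]_{1\le i<j\le n}$ ($=\mathbb F$ for $n=0,1$); $\mathcal O^T_n=\mathbb F[z_{ij}]$; $\epsilon_v(\sigma)=\prod_{i<j,\sigma(i)>\sigma(j)}(-1)^{p(v_i)p(v_j)}$. For $m_1,\dots,m_n\ge0$: $M_i=m_1+\dots+m_i$, $\Lambda_i=\sum_{k=M_{i-1}+1}^{M_i}\lambda_k$, and $\pm=(-1)^{\sum_{i<j}p(g_j)(p(v_{M_{i-1}+1})+\dots+p(v_{M_i}))}$ is the Koszul sign in a composition $f(g_1\otimes\dots\otimes g_n)$. **Operad $P^{\mathrm{ch}}$.** $P^{\mathrm{ch}}(n)$ is the superspace of linear maps $X:V^{\otimes n}\otimes\mathcal O^{\star T}_n\to V[\lambda_1,\dots,\lambda_n]/\langle\partial+\lambda_1+\dots+\lambda_n\rangle$ with $X(\dots,(\partial+\lambda_i)v_i,\dots;f)=X(v_1,\dots,v_n;\partial f/\partial z_i)$, $X(v_1,\dots,v_n;z_{ij}f)=(\partial_{\lambda_j}-\partial_{\lambda_i})X(v_1,\dots,v_n;f)$. Action: $(X^\sigma)_{\lambda_1,\dots,\lambda_n}(v_1,\dots,v_n;f(z_1,\dots,z_n))=\epsilon_v(\sigma)X_{\lambda_{i_1},\dots,\lambda_{i_n}}(v_{i_1},\dots,v_{i_n};f(z_{i_1},\dots,z_{i_n}))$, $i_s=\sigma^{-1}(s)$.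 Composition: for $h=g\prod_if_i(z_{M_{i-1}+1},\dots,z_{M_i})$ with $f_i\in\mathcal O^{\star T}_{m_i}$, $g\in\mathcal O_{M_n}^{\star T}$ without poles at $z_k=z_l$ for $k\neq l$ in a common block, $(Y(X_1\otimes\dots\otimes X_n))(v_1,\dots,v_{M_n};h)=\pm Y^{w_1,\dots,w_n}_{\Lambda_1,\dots,\Lambda_n}\big(\bigotimes_i(X_i)_{\lambda_{M_{i-1}+1}-\partial_{z_{M_{i-1}+1}},\dots,\lambda_{M_i}-\partial_{z_{M_i}}}(v_{M_{i-1}+1},\dots,v_{M_i};f_i)_\to;g|_{z_k=w_i\,(M_{i-1}<k\le M_i)}\big)$, the derivatives $\partial_{z_k}$ being applied to $g$ before the substitution. The unit is the identity of $P^{\mathrm{ch}}(1)=\mathrm{End}_{\mathbb F[\partial]}V$. Filtration: $F^r\mathcal O^{\star T}_n=\sum\mathcal O^T_n[z_{i_1j_1}^{-1},\dots,z_{i_rj_r}^{-1}]$ (sums of functions with at most $r$ polar divisors each), $F^{r}=0$ for $r<0$; $F^rP^{\mathrm{ch}}(n)=\{X\mid X(V^{\otimes n}\otimes F^{r-1}\mathcal O^{\star T}_n)=0\}$ is a decreasing operad filtration, and $\mathrm{gr}^rP^{\mathrm{ch}}(n)=F^rP^{\mathrm{ch}}(n)/F^{r+1}P^{\mathrm{ch}}(n)$, $\mathrm{gr}P^{\mathrm{ch}}=\bigoplus_{r\ge0}\mathrm{gr}^r P^{\mathrm{ch}}$. **Operad $P^{\mathrm{cl}}$.** $\mathcal G(n)$: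 graphs with vertices $1,\dots,n$, a finite collection of oriented edges $E(\Gamma)$ (multiple edges allowed), no tadpoles; $\mathcal G_0(n)$: those without unoriented cycles (in particular without multiple edges). An oriented cycle is a set of edges $\{i_1\to i_2,\dots,i_s\to i_1\}\subset E(\Gamma)$; $\sigma(\Gamma)$ is $\Gamma$ with vertex $i$ relabeled $\sigma(i)$. $P^{\mathrm{cl}}(n)$ is the superspace of maps $f:\mathcal G(n)\times V^{\otimes n}\to V[\lambda_1,\dots,\lambda_n]/\langle\partial+\lambda_1+\dots+\lambda_n\rangle$, $(\Gamma,v)\mapsto f^\Gamma_{\lambda_1,\dots,\lambda_n}(v)$, linear in $v$, with: $f^\Gamma=0$ unless $\Gamma\in\mathcal G_0(n)$; $\sum_{e\in C}f^{\Gamma\setminus e}=0$ for every oriented cycle $C$ of $\Gamma$; and for the vertex set $I$ of every connected component of $\Gamma$, $\partial_{\lambda_i}f^\Gamma(v)$ is the same for all $i\in I$ and $f^\Gamma(\sum_{i\in I}\partial_iv)=-(\sum_{i\in I}\lambda_i)f^\Gamma(v)$ ($\partial_i$ = $\partial$ on the $i$-th factor). Action: $(f^\sigma)^\Gamma_{\lambda_1,\dots,\lambda_n}(v_1\otimes\dots\otimes v_n)=\epsilon_v(\sigma)f^{\sigma(\Gamma)}_{\lambda_{\sigma^{-1}(1)},\dots,\lambda_{\sigma^{-1}(n)}}(v_{\sigma^{-1}(1)}\otimes\dots\otimes v_{\sigma^{-1}(n)})$. Composition: for $\Gamma\in\mathcal G(M_n)$ let $\Delta_i(\Gamma)$ ($1\le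 i\le n$) be the full subgraph on $M_{i-1}+1,\dots,M_i$ (relabeled), and $\Delta_0(\Gamma)\in\mathcal G(n)$ be obtained by collapsing each such block (with its inner edges) to the vertex $i$. For $k$ in the $i$-th block let $\mathcal E(k)$ be the set of $j$ joined to $i$ by an unoriented path in $\Delta_0(\Gamma)$ without repeated edges whose edge at $i$ comes from an edge of $\Gamma$ with an endpoint at $k$; $X(k)=\sum_{j\in\mathcal E(k)}x_j$. Then $(f(g_1\otimes\dots\otimes g_n))^\Gamma=0$ if $\Delta_0(\Gamma)$ is not acyclic, and otherwise equals $\pm f^{\Delta_0(\Gamma)}_{\Lambda_1,\dots,\Lambda_n}\big(\bigotimes_i(g_i)^{\Delta_i(\Gamma)}_{\lambda_{M_{i-1}+1}+X(M_{i-1}+1),\dots,\lambda_{M_i}+X(M_i)}(v_{M_{i-1}+1}\otimes\dots\otimes v_{M_i})\big)$, where after expansion each $x_j$ is replaced by $\Lambda_j+\partial$, $\partial$ acting on the $j$-th tensor factor. Grading: $\mathrm{gr}^rP^{\mathrm{cl}}(n)$ consists of the $f$ with $f^\Gamma=0$ whenever $\Gamma$ does not have exactly $r$ edges. A morphism of graded operads is a collection of linear maps commuting with the symmetric group actions, compatible with compositions and units, and preserving degrees.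
   Formalization: In the symmetric group action on P^ch(n), f is evaluated with each z_k replaced by z_{σ(k)}, not literally by z_{σ^{-1}(k)}: the literal formula does not preserve P^ch(n) for 3-cycles σ, as it breaks the relation for X(v;z_{ij}f). *)

(* Defs.v *)
From HB Require Import structures.
From mathcomp Require Import all_boot all_order all_fingroup all_algebra.
From mathcomp Require Import boolp classical_sets functions fsbigop.
From mathcomp.multinomials Require Import mpoly.

Set Implicit Arguments.
Unset Strict Implicit.
Unset Printing Implicit Defensive.

Import GRing.Theory.
Local Open Scope ring_scope.
Local Open Scope classical_set_scope.
Local Open Scope quotient_scope.

Section LinearQuotient.
Variables (F : fieldType) (W : lmodType F) (S : submodClosed W).

Definition kernel_pred : {pred W} := fun x => x \in S.

Fact kernel_zmod_closed : zmod_closed kernel_pred.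
Proof.
split=> [|x y Sx Sy]; first exact: (rpred0 S).
by rewrite -[_ \in _]/(x - y \in S) rpredD // -scaleN1r rpredZ.
Qed.
HB.instance Definition _ := GRing.isZmodClosed.Build W kernel_pred kernel_zmod_closed.

Definition lquot := Quotient.quot kernel_pred.

HB.instance Definition _ := EqQuotient.on lquot.
HB.instance Definition _ := Choice.on lquot.
HB.instance Definition _ := GRing.Zmodule.on lquot.

Definition cls (x : W) : lquot := \pi_lquot x.
Definition rep (x : lquot) : W := generic_quotient.repr x.

Lemma repK : cancel rep cls. Proof. exact: reprK. Qed.

Lemma cls_eq x y : (cls x = cls y) <-> (x - y \in S).
Proof.
have <- : (x - y \in kernel_pred) = (x - y \in S) by [].
by rewrite Quotient.idealrBE; split=> [xy|/eqP //]; apply/eqP.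
Qed.

Lemma rep_cls x : rep (cls x) - x \in S.
Proof. by apply/cls_eq; rewrite repK. Qed.

Lemma clsD x y : cls (x + y) = cls x + cls y.
Proof. by rewrite /cls !piE. Qed.

Definition lquot_scale (c : F) (x : lquot) : lquot := cls (c *: rep x).

Lemma lquot_scaleE c x : lquot_scale c (cls x) = cls (c *: x).
Proof. by apply/cls_eq; rewrite -scalerBr rpredZ ?rep_cls. Qed.

Lemma lquot_scaleA a b x :
  lquot_scale a (lquot_scale b x) = lquot_scale (a * b) x.
Proof. by rewrite -[x]repK !lquot_scaleE scalerA. Qed.

Lemma lquot_scale1 : left_id 1 lquot_scale.
Proof. by move=> x; rewrite -[x]repK lquot_scaleE scale1r. Qed.

Lemma lquot_scaleDr : right_distributive lquot_scale +%R.
Proof.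
by move=> a x y; rewrite -[x]repK -[y]repK -clsD !lquot_scaleE scalerDr clsD.
Qed.

Lemma lquot_scaleDl x : {morph lquot_scale^~ x : a b / a + b}.
Proof. by move=> a b; rewrite -[x]repK !lquot_scaleE scalerDl clsD. Qed.

HB.instance Definition _ := GRing.Zmodule_isLmodule.Build F lquot
  lquot_scaleA lquot_scale1 lquot_scaleDr lquot_scaleDl.

Lemma cls_linear : linear cls.
Proof.
by move=> a x y; rewrite clsD; congr (_ + _); rewrite -lquot_scaleE.
Qed.
HB.instance Definition _ := GRing.isLinear.Build F W lquot *:%R cls cls_linear.

Lemma cls_op_linear (A : W -> W) : linear A -> (forall x, x \in S -> A x \in S) ->
  linear (fun q : lquot => cls (A (rep q))).
Proof.
move=> linA stabA a q r.
have AB x y : A (x - y) = A x - A y.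
  by rewrite addrC -scaleN1r linA scaleN1r addrC.
rewrite -cls_linear -linA; apply/cls_eq; rewrite -AB; apply: stabA.
by apply/cls_eq; rewrite cls_linear !repK.
Qed.

End LinearQuotient.
Arguments cls {F W S} x.

Section DirectSum.
Variables (F : fieldType) (A : nat -> lmodType F).

Definition dprod := forall r, A r.
HB.instance Definition _ := Choice.on dprod.

Definition dprod_zero : dprod := fun=> 0.
Definition dprod_add (x y : dprod) : dprod := fun r => x r + y r.
Definition dprod_opp (x : dprod) : dprod := fun r => - x r.
Definition dprod_scale (c : F) (x : dprod) : dprod := fun r => c *: x r.

Fact dprod_addA : associative dprod_add.
Proof. by move=> x y z; apply: functional_extensionality_dep=> r; apply: addrA. Qed.
Fact dprod_addC : commutative dprod_add.
Proof. by move=> x y; apply: functional_extensionality_dep=> r; apply: addrC. Qed.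
Fact dprod_add0 : left_id dprod_zero dprod_add.
Proof. by move=> x; apply: functional_extensionality_dep=> r; apply: add0r. Qed.
Fact dprod_addN : left_inverse dprod_zero dprod_opp dprod_add.
Proof. by move=> x; apply: functional_extensionality_dep=> r; apply: addNr. Qed.

HB.instance Definition _ := GRing.isZmodule.Build dprod
  dprod_addA dprod_addC dprod_add0 dprod_addN.

Fact dprod_scaleA a b (x : dprod) :
  dprod_scale a (dprod_scale b x) = dprod_scale (a * b) x.
Proof. by apply: functional_extensionality_dep=> r; apply: scalerA. Qed.
Fact dprod_scale1 : left_id 1 dprod_scale.
Proof. by move=> x; apply: functional_extensionality_dep=> r; apply: scale1r. Qed.
Fact dprod_scaleDr : right_distributive dprod_scale +%R.
Proof.
by move=> a x y; apply: functional_extensionality_dep=> r; apply: scalerDr.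
Qed.
Fact dprod_scaleDl x : {morph dprod_scale^~ x : a b / a + b}.
Proof. by move=> a b; apply: functional_extensionality_dep=> r; apply: scalerDl. Qed.

HB.instance Definition _ := GRing.Zmodule_isLmodule.Build F dprod
  dprod_scaleA dprod_scale1 dprod_scaleDr dprod_scaleDl.

Definition fin_supp : {pred dprod} :=
  fun x => `[< exists N, forall r, (N <= r)%N -> x r = 0 >].

Fact fin_supp_closed : submod_closed fin_supp.
Proof.
split; first by apply/asboolP; exists 0.
move=> c x y /asboolP[N Nx] /asboolP[N' Ny]; apply/asboolP; exists (maxn N N').
move=> r; rewrite geq_max => /andP[Nr N'r].
have -> : (c *: x + y) r = c *: x r + y r by [].
by rewrite Nx // Ny // scaler0 addr0.
Qed.
HB.instance Definition _ := GRing.isSubmodClosed.Build F dprod fin_supp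
  (GRing.submod_closed_semi fin_supp_closed).

Record dsum := DSum { ds_val :> dprod; _ : ds_val \in fin_supp }.
HB.instance Definition _ := [isSub for ds_val].
HB.instance Definition _ := [Choice of dsum by <:].
HB.instance Definition _ := [SubChoice_isSubLmodule of dsum by <:].

(* Used only on finitely supported families. *)
Definition mkdsum (x : dprod) : dsum := insubd 0 x.

Definition ds_in (r : nat) (a : A r) : dsum :=
  mkdsum (fun s => if r =P s is ReflectT e then ecast s (A s) e a else 0).

End DirectSum.

Section Functions.
Variables (F : fieldType) (n : nat).

Definition ratfun := {fraction {mpoly F[n]}}.
HB.instance Definition _ := GRing.Field.on ratfun.

Definition rpoly (p : {mpoly F[n]}) : ratfun := tofrac p.
Definition rconst (c : F) : ratfun := rpoly c%:MP.

Definition ratfun_scale (c : F) (x : ratfun) : ratfun := rconst c * x.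

Fact ratfun_scaleA a b x : ratfun_scale a (ratfun_scale b x) = ratfun_scale (a * b) x.
Proof. by rewrite /ratfun_scale /rconst /rpoly !rmorphM mulrA. Qed.
Fact ratfun_scale1 : left_id 1 ratfun_scale.
Proof. by move=> x; rewrite /ratfun_scale /rconst /rpoly !rmorph1 mul1r. Qed.
Fact ratfun_scaleDr : right_distributive ratfun_scale +%R.
Proof. by move=> a x y; rewrite /ratfun_scale mulrDr. Qed.
Fact ratfun_scaleDl x : {morph ratfun_scale^~ x : a b / a + b}.
Proof. by move=> a b; rewrite /ratfun_scale /rconst /rpoly !rmorphD mulrDl. Qed.
HB.instance Definition _ := GRing.Zmodule_isLmodule.Build F ratfun
  ratfun_scaleA ratfun_scale1 ratfun_scaleDr ratfun_scaleDl.

Definition rz (i j : 'I_n) : ratfun := rpoly 'X_i - rpoly 'X_j.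

Inductive gen_alg (G : set ratfun) : set ratfun :=
  | gen_in x of G x : gen_alg G x
  | gen_const c : gen_alg G (rconst c)
  | gen_add x y of gen_alg G x & gen_alg G y : gen_alg G (x + y)
  | gen_mul x y of gen_alg G x & gen_alg G y : gen_alg G (x * y).

Definition Ostar_gen : set ratfun :=
  [set x | exists i j : 'I_n, (i < j)%N /\ (x = rz i j \/ x = (rz i j)^-1)].

Definition Ostar_pred : {pred ratfun} := fun x => `[< gen_alg Ostar_gen x >].

Fact Ostar_submod_closed : submod_closed Ostar_pred.
Proof.
have c0 (c : F) x : x \in Ostar_pred -> c *: x \in Ostar_pred.
  by move=> /asboolP gx; apply/asboolP/gen_mul => //; apply: gen_const.
split.
  have -> : 0 = rconst 0 by rewrite /rconst /rpoly !rmorph0.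
  exact/asboolP/gen_const.
by move=> c x y /(c0 c)/asboolP gx /asboolP gy; apply/asboolP/gen_add.
Qed.

Fact Ostar_subring_closed : subring_closed Ostar_pred.
Proof.
have [Z0 Zl] := Ostar_submod_closed; split.
- have -> : 1 = rconst 1 by rewrite /rconst /rpoly !rmorph1.
  exact/asboolP/gen_const.
- by move=> x y Zx Zy; rewrite addrC -scaleN1r; apply: Zl.
- by move=> x y /asboolP gx /asboolP gy; apply/asboolP/gen_mul.
Qed.

HB.instance Definition _ := GRing.isSubringClosed.Build ratfun Ostar_pred
  Ostar_subring_closed.
HB.instance Definition _ := GRing.isSubmodClosed.Build F ratfun Ostar_pred
  (GRing.submod_closed_semi Ostar_submod_closed).

Record Ostar := MkOstar { Oval :> ratfun; _ : Oval \in Ostar_pred }.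
HB.instance Definition _ := [isSub for Oval].
HB.instance Definition _ := [Choice of Ostar by <:].
HB.instance Definition _ := [SubChoice_isSubComNzRing of Ostar by <:].
HB.instance Definition _ := [SubZmodule_isSubLmodule of Ostar by <:].

(* Used only on elements of F[z_ij^{+-1}]. *)
Definition mkO (x : ratfun) : Ostar := insubd 0 x.

Fact rz_mem i j : rz i j \in Ostar_pred.
Proof.
have H (a b : 'I_n) : (a < b)%N -> rz a b \in Ostar_pred.
  by move=> ab; apply/asboolP/gen_in; exists a, b; split=> //; left.
have [/H //|ji|/val_inj ->] := ltngtP i j; last by rewrite /rz subrr rpred0.
by rewrite /rz -opprB rpredN; apply: H.
Qed.

Fact rzV_mem i j : (rz i j)^-1 \in Ostar_pred.
Proof.
have H (a b : 'I_n) : (a < b)%N -> (rz a b)^-1 \in Ostar_pred.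
  by move=> ab; apply/asboolP/gen_in; exists a, b; split=> //; right.
have [/H //|ji|/val_inj ->] := ltngtP i j; last by rewrite /rz subrr invr0 rpred0.
by rewrite /rz -opprB invrN rpredN; apply: H.
Qed.

Definition Oz i j : Ostar := MkOstar (rz_mem i j).
Definition OzV i j : Ostar := MkOstar (rzV_mem i j).

Definition rderiv (k : 'I_n) (x : ratfun) : ratfun :=
  let a := \n_(generic_quotient.repr x) in
  let b := \d_(generic_quotient.repr x) in
  rpoly (a^`M(k) * b - a * b^`M(k)) / rpoly (b ^+ 2).

Definition Oderiv (k : 'I_n) (f : Ostar) : Ostar := mkO (rderiv k f).

Definition Ofil_gen (s : seq ('I_n * 'I_n)) : set ratfun :=
  [set x | exists i j : 'I_n,
     (i < j)%N /\ (x = rz i j \/ ((i, j) \in s /\ x = (rz i j)^-1))].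

Definition Ofil_piece (r : nat) : set ratfun :=
  [set x | exists2 s, (size s <= r)%N & gen_alg (Ofil_gen s) x].

(* F^r for r >= 0 *)
Definition Ofil (r : nat) : set ratfun :=
  [set x | exists2 xs : seq ratfun,
     (forall y, y \in xs -> Ofil_piece r y) & x = \sum_(y <- xs) y].

(* F^{r-1}, where F^{-1} = 0 *)
Definition Ofil_pred (r : nat) : set ratfun :=
  if r is s.+1 then Ofil s else [set 0].

End Functions.

Section Substitution.
Variable F : fieldType.

(* Here and in [lsubst], [qsubst] below, a map t : 'I_m -> 'I_n encodes the
   substitution z_k |-> z_(t k), and dually lambda_i |-> the sum of the
   lambda_k with t k = i.  Relabelings, identifications of variables within
   blocks, and embeddings of blocks are all of this form. *)
Definition psubst m n (t : 'I_m -> 'I_n) (p : {mpoly F[m]}) : {mpoly F[n]} :=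
  p \mPo [tuple 'X_(t k) | k < m].

(* The value is 0 if x has a pole on the image of the substitution. *)
Definition rsubst m n (t : 'I_m -> 'I_n) (x : ratfun F m) : ratfun F n :=
  xget 0 [set y | exists a b, [/\ x = rpoly a / rpoly b, psubst t b != 0 &
                                y = rpoly (psubst t a) / rpoly (psubst t b)]].

Definition Osubst m n (t : 'I_m -> 'I_n) (f : Ostar F m) : Ostar F n :=
  mkO (rsubst t f).

Definition no_pole m (k l : 'I_m) (x : ratfun F m) : Prop :=
  exists a b, x = rpoly a / rpoly b /\
    psubst (fun i => if i == k then l else i) b != 0.

End Substitution.

Definition no_tadpole n (g : {ffun 'I_n * 'I_n -> nat}) : bool :=
  [forall i, g (i, i) == 0%N].

(* A graph is given by the multiplicities of its edges i -> j. *)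
Record graph n := Graph { mult : {ffun 'I_n * 'I_n -> nat}; _ : no_tadpole mult }.

Fact mkgraph_subproof n (f : 'I_n -> 'I_n -> nat) :
  no_tadpole [ffun e : 'I_n * 'I_n => if e.1 == e.2 then 0%N else f e.1 e.2].
Proof. by apply/forallP=> i; rewrite ffunE /= eqxx. Qed.
Definition mkgraph n (f : 'I_n -> 'I_n -> nat) : graph n := Graph (mkgraph_subproof f).

Section Graphs.
Variable n : nat.
Implicit Types (G : graph n) (i j : 'I_n).

Definition nedges G : nat := \sum_e mult G e.

Definition remove_edge G (e : 'I_n * 'I_n) : graph n :=
  mkgraph (fun i j => (mult G (i, j) - ((i, j) == e))%N).

Definition relabel (s : 'S_n) G : graph n :=
  mkgraph (fun i j => mult G ((s^-1)%g i, (s^-1)%g j)).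

(* A step (e, b) runs along the edge e, forwards if b and backwards otherwise. *)
Definition step : Type := ('I_n * 'I_n) * bool.
Definition step_src (s : step) := if s.2 then s.1.1 else s.1.2.
Definition step_tgt (s : step) := if s.2 then s.1.2 else s.1.1.

Fixpoint walk i (s : seq step) j : bool :=
  if s is e :: s' then (step_src e == i) && walk (step_tgt e) s' j else i == j.

(* An unoriented path from i to j without repeated edges: each of the parallel
   edges can be used once. *)
Definition upath G i (s : seq step) j : bool :=
  walk i s j && [forall e, (count (fun a : step => a.1 == e) s <= mult G e)%N].

Definition acyclic G : Prop := forall i s, upath G i s i -> s = [::].

Definition connected G i j : Prop := exists s, upath G i s j.

Definition oriented_cycle G (c : seq ('I_n * 'I_n)) : bool :=
  [&& c != [::], path.cycle (fun e e' => e.2 == e'.1) c &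
      [forall e, (count_mem e c <= mult G e)%N]].

Definition pfun (F : fieldType) G : Ostar F n :=
  \prod_e OzV F e.1 e.2 ^+ mult G e.

End Graphs.

Section BlockGraphs.
Variables (n : nat) (m : 'I_n -> nat).
Let M := (\sum_i m i)%N.
Variable G : graph M.

Definition inner_graph (i : 'I_n) : graph (m i) :=
  mkgraph (fun a b => mult G (tagnat.Rank i a, tagnat.Rank i b)).

Definition collapse : graph n :=
  mkgraph (fun i j => \sum_(k : 'I_M | tagnat.sig1 k == i)
                      \sum_(l : 'I_M | tagnat.sig1 l == j) mult G (k, l))%N.

(* The step e of [collapse] comes from an edge of G whose endpoint in the block
   of the source of e is k. *)
Definition step_from (k : 'I_M) (e : step n) : Prop :=
  exists l : 'I_M, tagnat.sig1 l = step_tgt e /\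
    (0 < (if e.2 then mult G (k, l) else mult G (l, k)))%N.

Definition reached_from (k : 'I_M) (j : 'I_n) : Prop :=
  exists e s, upath collapse (tagnat.sig1 k) (e :: s) j /\ step_from k e.

End BlockGraphs.

(* [ss_par b] is the projection onto the part of parity b. *)
Record superspace (F : fieldType) := Superspace {
  ss_car :> lmodType F;
  ss_par : bool -> {linear ss_car -> ss_car};
  ss_par_idem : forall b c v, ss_par b (ss_par c v) = if b == c then ss_par c v else 0;
  ss_par_sum : forall v, ss_par false v + ss_par true v = v }.

(* m(A_1, ..., A_n) w for commuting operators A_i. *)
Definition opX n (W : Type) (A : 'I_n -> W -> W) (m : 'X_{1..n}) (w : W) : W :=
  foldr (fun i => iter (m i) (A i)) w (enum 'I_n).

Section LambdaPoly.
Variables (F : fieldType) (V : lmodType F) (n : nat).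

(* A polynomial is the function giving its coefficients. *)
Definition bounded_degree : {pred 'X_{1..n} -> V} :=
  fun p => `[< exists D, forall m, (D <= mdeg m)%N -> p m = 0 >].

Fact bounded_degree_closed : submod_closed bounded_degree.
Proof.
split; first by apply/asboolP; exists 0%N.
move=> c p q /asboolP[N Np] /asboolP[N' Nq]; apply/asboolP; exists (maxn N N').
move=> m; rewrite geq_max => /andP[Nm N'm].
have -> : (c *: p + q) m = c *: p m + q m by [].
by rewrite Np // Nq // scaler0 addr0.
Qed.
HB.instance Definition _ := GRing.isSubmodClosed.Build F ('X_{1..n} -> V)
  bounded_degree (GRing.submod_closed_semi bounded_degree_closed).

Record VL := MkVL { vcoef :> 'X_{1..n} -> V; _ : vcoef \in bounded_degree }.
HB.instance Definition _ := [isSub for vcoef].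
HB.instance Definition _ := [Choice of VL by <:].
HB.instance Definition _ := [SubChoice_isSubLmodule of VL by <:].

Lemma VLP (p q : VL) : (forall m, p m = q m) -> p = q.
Proof. by move=> pq; apply/val_inj/funext. Qed.

Fact vconst_subproof (v : V) :
  (fun m : 'X_{1..n} => if m == 0%MM then v else 0) \in bounded_degree.
Proof.
by apply/asboolP; exists 1%N => m; case: eqP => // ->; rewrite mdeg0.
Qed.
Definition vconst v : VL := MkVL (vconst_subproof v).

Fact lam_subproof (k : 'I_n) (p : VL) :
  (fun m : 'X_{1..n} => if (0 < m k)%N then p (m - U_(k))%MM else 0) \in bounded_degree.
Proof.
case: p => p /= /asboolP[D pD]; apply/asboolP; exists D.+1 => m Dm.
case: ifP => // mk; apply: pD; rewrite -ltnS (leq_trans Dm) //.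
by rewrite -{1}(@submK _ U_(k) m) ?lep1mP -?lt0n // mdegD mdeg1 addn1.
Qed.
(* On coefficients: multiplication by lambda_k. *)
Definition lam k p : VL := MkVL (lam_subproof k p).

Fact dlam_subproof (k : 'I_n) (p : VL) :
  (fun m : 'X_{1..n} => p (m + U_(k))%MM *+ (m k).+1) \in bounded_degree.
Proof.
case: p => p /= /asboolP[D pD]; apply/asboolP; exists D => m Dm.
by rewrite pD ?mul0rn // mdegD (leq_trans Dm) ?leq_addr.
Qed.
(* On coefficients: the partial derivative with respect to lambda_k. *)
Definition dlam k p : VL := MkVL (dlam_subproof k p).

Fact cmap_subproof (A : {linear V -> V}) (p : VL) :
  (fun m : 'X_{1..n} => A (p m)) \in bounded_degree.
Proof.
case: p => p /= /asboolP[D pD]; apply/asboolP; exists D => m Dm.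
by rewrite pD // linear0.
Qed.
Definition cmap A p : VL := MkVL (cmap_subproof A p).

Fact vcoefP c (p q : VL) m : (c *: p + q) m = c *: p m + q m.
Proof. by []. Qed.

Fact lam_linear k : linear (lam k).
Proof.
move=> c p q; apply: VLP => m; rewrite vcoefP /=.
by case: ifP => // _; rewrite scaler0 addr0.
Qed.
HB.instance Definition _ k := GRing.isLinear.Build F VL VL *:%R (lam k) (lam_linear k).

Fact dlam_linear k : linear (dlam k).
Proof.
move=> c p q; apply: VLP => m.
by rewrite vcoefP -[LHS]/((_ + _) *+ _) mulrnDl -scalerMnr.
Qed.
HB.instance Definition _ k := GRing.isLinear.Build F VL VL *:%R (dlam k) (dlam_linear k).

Fact cmap_linear A : linear (cmap A).
Proof.
move=> c p q; apply: VLP => m.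
by rewrite vcoefP -[LHS]/(A (_ *: _ + _)) linearP.
Qed.
HB.instance Definition _ A := GRing.isLinear.Build F VL VL *:%R (cmap A) (cmap_linear A).

Variable d : {linear V -> V}.

(* Multiplication by d + lambda_1 + ... + lambda_n. *)
Definition dlamsum (p : VL) : VL := cmap d p + \sum_k lam k p.

Fact dlamsum_linear : linear dlamsum.
Proof.
move=> c p q; rewrite /dlamsum linearP.
rewrite (eq_bigr (fun k => c *: lam k p + lam k q)) => [|k _]; last exact: linearP.
by rewrite big_split -scaler_sumr scalerDr addrACA.
Qed.
HB.instance Definition _ := GRing.isLinear.Build F VL VL *:%R dlamsum dlamsum_linear.

Definition dlam_pred : {pred VL} := fun p => `[< exists q, p = dlamsum q >].

Fact dlam_pred_closed : submod_closed dlam_pred.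
Proof.
split; first by apply/asboolP; exists 0; rewrite linear0.
move=> c p q /asboolP[p' ->] /asboolP[q' ->]; apply/asboolP.
by exists (c *: p' + q'); rewrite linearP.
Qed.
HB.instance Definition _ := GRing.isSubmodClosed.Build F VL
  dlam_pred (GRing.submod_closed_semi dlam_pred_closed).

Definition Q := lquot dlam_pred.
HB.instance Definition _ := GRing.Lmodule.on Q.

(* The operators below act on the quotient through representatives. *)
Definition qlam (k : 'I_n) (q : Q) : Q := cls (lam k (rep q)).

(* The difference of the derivatives with respect to lambda_i and lambda_j
   (neither of them acts on the quotient). *)
Definition qdiff (i j : 'I_n) (q : Q) : Q :=
  cls (dlam i (rep q) - dlam j (rep q)).

Lemma lamC k l p : lam k (lam l p) = lam l (lam k p).
Proof.
have [->//|kl] := eqVneq k l.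
apply: VLP => m /=; rewrite !mnmBE !mnm1E [l == k]eq_sym (negPf kl) !subn0.
case: (0 < m k)%N; case: (0 < m l)%N => //.
by congr (p _); apply/mnmP=> i; rewrite !mnmBE subnAC.
Qed.

Lemma dlam_lam k l p : dlam k (lam l p) = lam l (dlam k p) + p *+ (k == l).
Proof.
have [<-|kl] := eqVneq k l; apply: VLP => m.
  have -> : (lam k (dlam k p) + p *+ true) m = lam k (dlam k p) m + p m by [].
  rewrite /= mnmDE mnm1E eqxx addn1 /=.
  rewrite (_ : (m + U_(k) - U_(k) = m)%MM); last first.
    by apply/mnmP=> i; rewrite !mnmBE mnmDE addnK.
  have [m0|m0] := posnP (m k); first by rewrite m0 mulr1n add0r.
  rewrite submK ?lep1mP -?lt0n // mnmBE mnm1E eqxx subn1 prednK //.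
  by rewrite mulrSr.
have -> : (lam l (dlam k p) + p *+ false) m = lam l (dlam k p) m.
  by rewrite mulr0n addr0.
rewrite /= mnmDE mnm1E (negPf kl) addn0; case: ifP => [ml|]; last by rewrite mul0rn.
rewrite mnmBE mnm1E [l == k]eq_sym (negPf kl) subn0; congr (p _ *+ _).
apply/mnmP=> i; rewrite mnmBE !mnmDE mnmBE !mnm1E.
by have [<-|_] := eqVneq l i; [rewrite addnBAC | rewrite !subn0].
Qed.

Lemma cmap_lam A k p : cmap A (lam k p) = lam k (cmap A p).
Proof. by apply: VLP => m /=; case: ifP => //; rewrite linear0. Qed.

Lemma dlam_cmap A k p : dlam k (cmap A p) = cmap A (dlam k p).
Proof. by apply: VLP => m; rewrite /= linearMn. Qed.

Lemma qlam_linear k : linear (qlam k).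
Proof.
apply: cls_op_linear (@lam_linear k) _ => _ /asboolP[q ->].
apply/asboolP; exists (lam k q); rewrite /dlamsum linearD linear_sum cmap_lam.
by congr (_ + _); apply: eq_bigr => l _; rewrite lamC.
Qed.
HB.instance Definition _ k := GRing.isLinear.Build F Q Q *:%R (qlam k) (qlam_linear k).

Lemma dlam_dlamsum k q : dlam k (dlamsum q) = dlamsum (dlam k q) + q.
Proof.
rewrite /dlamsum linearD linear_sum /= dlam_cmap -addrA; congr (_ + _).
rewrite (eq_bigr (fun l => lam l (dlam k q) + q *+ (k == l))); last first.
  by move=> l _; rewrite dlam_lam.
rewrite big_split; congr (_ + _).
rewrite (bigD1 k) //= eqxx big1 ?addr0 // => l lk.
by rewrite eq_sym (negPf lk).
Qed.

Lemma qdiff_linear i j : linear (qdiff i j).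
Proof.
apply: (@cls_op_linear _ _ _ (fun p => dlam i p - dlam j p)) => [c p q|].
  by rewrite (dlam_linear i c p q) (dlam_linear j c p q) scalerBr opprD addrACA.
move=> _ /asboolP[q ->]; apply/asboolP; exists (dlam i q - dlam j q).
by rewrite linearB !dlam_dlamsum opprD addrACA subrr addr0.
Qed.
HB.instance Definition _ i j :=
  GRing.isLinear.Build F Q Q *:%R (qdiff i j) (qdiff_linear i j).

End LambdaPoly.

Section LambdaSubst.
Variables (F : fieldType) (V : lmodType F) (d : {linear V -> V}).

(* lambda_i |-> the sum of the lambda_k with t k = i *)
Definition lsubst m n (t : 'I_m -> 'I_n) (p : VL V n) : VL V m :=
  \sum_(mu \in [set: 'X_{1..n}])
    opX (fun i u => \sum_(k | t k == i) lam k u) mu (vconst m (p mu)).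

Definition qsubst m n (t : 'I_m -> 'I_n) (q : Q n d) : Q m d :=
  cls (lsubst t (rep q)).

Definition qconst n (v : V) : Q n d := cls (vconst n v).

Definition multilinear n (W : lmodType F) (X : ('I_n -> V) -> W) : Prop :=
  forall v i, linear (fun u => X [eta v with i |-> u]).

End LambdaSubst.

(* The data of a graded operad; the operad axioms play no role in the notion of
   morphism.  [op_comp x y] is the composition x (y_1 (x) ... (x) y_n). *)
Record graded_operad (F : fieldType) := GradedOperad {
  op_car : nat -> lmodType F;
  op_act : forall n, 'S_n -> op_car n -> op_car n;
  op_comp : forall n (m : 'I_n -> nat),
    op_car n -> (forall i, op_car (m i)) -> op_car (\sum_i m i)%N;
  op_unit : op_car 1;
  op_deg : nat -> forall n, set (op_car n) }.

Definition graded_operad_morphism (F : fieldType) (P P' : graded_operad F)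
    (phi : forall n, {linear op_car P n -> op_car P' n}) : Prop :=
  [/\ forall n (s : 'S_n) x, phi n (op_act s x) = op_act s (phi n x),
      forall n (m : 'I_n -> nat) x (y : forall i, op_car P (m i)),
        phi _ (op_comp x y) = op_comp (phi n x) (fun i => phi (m i) (y i)),
      phi 1 (op_unit P) = op_unit P' &
      forall r n x, op_deg r x -> op_deg r (phi n x)].

Section Operads.
Variables (F : fieldType) (V : superspace F) (d : {linear V -> V}).

Local Notation par := (ss_par V).
Local Notation O n := (Ostar F n).
Local Notation Q n := (Q n d).

Definition qpar n (b : bool) (q : Q n) : Q n := cls (cmap (par b) (rep q)).

(* Signs depending on the parities of vectors are extended multilinearly: one
   sums over all families p of parities, replacing v_i by its part of parity p_i,
   and similarly for the elements of the operads. *)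

Definition perm_sign n (s : 'S_n) (p : 'I_n -> bool) : F :=
  \prod_(i < n) \prod_(j < n | (i < j)%N && (s j < s i)%N) (-1) ^+ (p i && p j).

(* The sum of the parities in a block. *)
Definition block_par n (m : 'I_n -> nat) (p : 'I_(\sum_i m i) -> bool) (i : 'I_n) : bool :=
  \big[addb/false]_(a < m i) p (tagnat.Rank i a).

(* q is the family of parities of the g_j, and p that of the v_k. *)
Definition koszul_sign n (m : 'I_n -> nat) (q : 'I_n -> bool)
    (p : 'I_(\sum_i m i) -> bool) : F :=
  \prod_(i < n) \prod_(j < n | (i < j)%N) (-1) ^+ (q j && block_par p i).

Definition mblock n (m : 'I_n -> nat) (mu : 'X_{1..\sum_i m i}) (i : 'I_n) : 'X_{1..m i} :=
  [multinom mu (tagnat.Rank i a) | a < m i].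

Definition chfun n := ('I_n -> V) -> O n -> Q n.
HB.instance Definition _ n := GRing.Lmodule.on (chfun n).

Definition is_ch n (X : chfun n) : Prop :=
  [/\ forall f, multilinear (X^~ f),
      forall v, linear (X v),
      forall v i f, X [eta v with i |-> d (v i)] f + qlam i (X v f) = X v (Oderiv i f) &
      forall v i j f, X v (Oz F i j * f) = qdiff j i (X v f)].

Definition ch_pred n : {pred chfun n} := fun X => `[< is_ch X >].

Fact ch_pred_closed n : submod_closed (@ch_pred n).
Proof.
split.
  apply/asboolP; split.
  - by move=> f v i c x y /=; rewrite scaler0 addr0.
  - by move=> v c x y /=; rewrite scaler0 addr0.
  - by move=> v i f; rewrite linear0 addr0.
  - by move=> v i j f; rewrite linear0.
move=> c X Y /asboolP[X1 X2 X3 X4] /asboolP[Y1 Y2 Y3 Y4]; apply/asboolP.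
have E v f : (c *: X + Y) v f = c *: X v f + Y v f by [].
split.
- move=> f v i a x y; rewrite !E (X1 f v i a x y) (Y1 f v i a x y).
  by rewrite !scalerDr !scalerA [c * a]mulrC addrACA.
- move=> v a x y; rewrite !E (X2 v a x y) (Y2 v a x y).
  by rewrite !scalerDr !scalerA [c * a]mulrC addrACA.
- by move=> v i f; rewrite !E linearP addrACA -scalerDr X3 Y3.
- by move=> v i j f; rewrite !E linearP X4 Y4.
Qed.
HB.instance Definition _ n := GRing.isSubmodClosed.Build F
  (chfun n) (@ch_pred n) (GRing.submod_closed_semi (@ch_pred_closed n)).

Record Pch n := MkPch { ch_fun : chfun n; _ : ch_fun \in @ch_pred n }.
Definition ch_app n (X : Pch n) : ('I_n -> V) -> O n -> Q n := ch_fun X.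
Coercion ch_app : Pch >-> Funclass.
HB.instance Definition _ n := [isSub for @ch_fun n].
HB.instance Definition _ n := [Choice of Pch n by <:].
HB.instance Definition _ n := [SubChoice_isSubLmodule of Pch n by <:].

(* Used only on functions in P^ch(n). *)
Definition mkPch n (X : chfun n) : Pch n := insubd 0 X.

(* For X^s to satisfy the conditions of P^ch(n), the variable of f that goes with
   the argument v_k, which is at the position s(k) on the right, has to be
   z_(s k). *)
Definition ch_act n (s : 'S_n) (X : Pch n) : Pch n :=
  mkPch (fun v f => \sum_(p : {ffun 'I_n -> bool}) perm_sign s p *:
    qsubst s (X (fun k => par (p ((s^-1)%g k)) (v ((s^-1)%g k))) (Osubst s f))).

(* The unit and the composition are the unique elements with the properties below
   (and not the default value 0). *)
Definition ch_unit : Pch 1 :=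
  xget 0 [set X : Pch 1 | forall v, X v 1 = qconst d 1 (v ord0)].

Section ChComp.
Variables (n : nat) (m : 'I_n -> nat).
Local Notation M := (\sum_i m i)%N.
Variables (Y : Pch n) (X : forall i, Pch (m i)).

(* The right-hand side of the composition formula for h = g * prod_i f_i: for each
   product of monomials in the values of the X_i, lambda_k - d/dz_k acts through
   multiplication by lambda_k on the value of Y and through d/dz_k on g. *)
Definition ch_comp_val (v : 'I_M -> V) (g : O M) (f : forall i, O (m i)) : Q M :=
  \sum_(p : {ffun 'I_M -> bool}) \sum_(q : {ffun 'I_n -> bool}) koszul_sign q p *:
    let w i := rep (qpar (q i (+) block_par p i)
      (X i (fun a => par (p (tagnat.Rank i a)) (v (tagnat.Rank i a))) (f i))) in
    \sum_(mu \in [set: 'X_{1..M}])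
      opX (fun k (A : O M -> Q M) g' => qlam k (A g') - A (Oderiv k g')) mu
        (fun g' => qsubst (@tagnat.sig1 n m)
           (Y (fun i => w i (mblock mu i)) (Osubst (@tagnat.sig1 n m) g'))) g.

Definition no_inner_pole (g : O M) : Prop :=
  forall k l : 'I_M, k != l -> tagnat.sig1 k = tagnat.sig1 l -> no_pole k l (Oval g).

Definition ch_comp : Pch M :=
  xget 0 [set Z : Pch M | forall v g (f : forall i, O (m i)), no_inner_pole g ->
    Z v (g * \prod_i Osubst (@tagnat.Rank n m i) (f i)) = ch_comp_val v g f].

End ChComp.

Definition ch_fil (r : nat) n (X : Pch n) : Prop :=
  forall v (f : O n), Ofil_pred r (Oval f) -> X v f = 0.

Definition ch_fil_pred r n : {pred Pch n} := fun X => `[< ch_fil r X >].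

Fact ch_fil_closed r n : submod_closed (@ch_fil_pred r n).
Proof.
split; first exact/asboolP.
move=> c X Y /asboolP FX /asboolP FY; apply/asboolP=> v f rf.
have -> : (c *: X + Y) v f = c *: X v f + Y v f by [].
by rewrite FX // FY // scaler0 addr0.
Qed.
HB.instance Definition _ r n := GRing.isSubmodClosed.Build F (Pch n)
  (@ch_fil_pred r n) (GRing.submod_closed_semi (@ch_fil_closed r n)).

Record FPch r n := MkFPch { Fch_val :> Pch n; _ : Fch_val \in @ch_fil_pred r n }.
HB.instance Definition _ r n := [isSub for @Fch_val r n].
HB.instance Definition _ r n := [Choice of FPch r n by <:].
HB.instance Definition _ r n := [SubChoice_isSubLmodule of FPch r n by <:].

Definition Fch_next r n : {pred FPch r n} :=
  fun X => Fch_val X \in @ch_fil_pred r.+1 n.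

Fact Fch_next_closed r n : submod_closed (@Fch_next r n).
Proof.
split=> [|c X Y FX FY]; rewrite unfold_in.
  exact: (rpred0 (@ch_fil_pred r.+1 n)).
by rewrite /= rpredD // rpredZ.
Qed.
HB.instance Definition _ r n := GRing.isSubmodClosed.Build F (FPch r n)
  (@Fch_next r n) (GRing.submod_closed_semi (@Fch_next_closed r n)).

Definition gr r n := lquot (@Fch_next r n).
HB.instance Definition _ r n := GRing.Lmodule.on (gr r n).

(* The class in gr^r P^ch(n) of an element of F^r P^ch(n). *)
Definition gr_cls r n (X : Pch n) : gr r n := cls (insubd (0 : FPch r n) X).
Definition gr_rep r n (x : gr r n) : Pch n := Fch_val (rep x).

Definition grPch n := dsum (fun r => gr r n : lmodType F).
HB.instance Definition _ n := GRing.Lmodule.on (grPch n).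

Definition gr_in n r (x : gr r n) : grPch n := ds_in (A := fun r => gr r n) x.

Definition gr_act n (s : 'S_n) (x : grPch n) : grPch n :=
  mkdsum (fun r => gr_cls r (ch_act s (gr_rep (ds_val x r)))).

(* The component of degree t is the sum over all degrees s and r_1, ..., r_n with
   s + r_1 + ... + r_n = t. *)
Definition gr_comp n (m : 'I_n -> nat) (y : grPch n) (x : forall i, grPch (m i)) :
    grPch (\sum_i m i) :=
  mkdsum (fun t => \sum_(s < t.+1)
    \sum_(r : {ffun 'I_n -> 'I_t.+1} | (s + \sum_i r i == t)%N)
      gr_cls t (ch_comp (gr_rep (ds_val y s)) (fun i => gr_rep (ds_val (x i) (r i))))).

Definition gr_unit : grPch 1 := gr_in (gr_cls 0 ch_unit).

Definition gr_deg (r : nat) n : set (grPch n) :=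
  [set x | forall s, s != r -> ds_val x s = 0].

Definition gr_Pch : graded_operad F :=
  GradedOperad (op_car := fun n => grPch n) gr_act gr_comp gr_unit gr_deg.

Definition clfun n := graph n -> ('I_n -> V) -> Q n.
HB.instance Definition _ n := GRing.Lmodule.on (clfun n).

Definition is_cl n (f : clfun n) : Prop :=
  [/\ forall G, multilinear (f G),
      forall G v, ~ acyclic G -> f G v = 0,
      forall G c v, oriented_cycle G c -> \sum_(e <- c) f (remove_edge G e) v = 0,
      forall G i j v, connected G i j -> qdiff i j (f G v) = 0 &
      forall G i0 v, \sum_(i | `[< connected G i0 i >]) f G [eta v with i |-> d (v i)] =
        - \sum_(i | `[< connected G i0 i >]) qlam i (f G v)].

Definition cl_pred n : {pred clfun n} := fun f => `[< is_cl f >].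

Fact cl_pred_closed n : submod_closed (@cl_pred n).
Proof.
split.
  apply/asboolP; split.
  - by move=> G v i c x y /=; rewrite scaler0 addr0.
  - by [].
  - by move=> G c v _; rewrite big1.
  - by move=> G i j v _; rewrite linear0.
  - by move=> G i0 v; rewrite !big1 ?oppr0 // => i _; rewrite linear0.
move=> c f g /asboolP[f1 f2 f3 f4 f5] /asboolP[g1 g2 g3 g4 g5]; apply/asboolP.
have E G v : (c *: f + g) G v = c *: f G v + g G v by [].
split.
- move=> G v i a x y; rewrite !E (f1 G v i a x y) (g1 G v i a x y).
  by rewrite !scalerDr !scalerA [c * a]mulrC addrACA.
- by move=> G v nG; rewrite E f2 // g2 // scaler0 addr0.
- move=> G C v oC; rewrite (eq_bigr _ (fun e _ => E (remove_edge G e) v)).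
  by rewrite big_split /= -scaler_sumr f3 // g3 // scaler0 addr0.
- by move=> G i j v ij; rewrite E linearP /= f4 // g4 // scaler0 addr0.
- move=> G i0 v; rewrite (eq_bigr _ (fun i _ => E G [eta v with i |-> d (v i)])).
  rewrite big_split /= -scaler_sumr f5 g5.
  rewrite [in RHS](eq_bigr (fun i => c *: qlam i (f G v) + qlam i (g G v))).
    by rewrite big_split /= -scaler_sumr opprD scalerN.
  by move=> i _; rewrite E linearP.
Qed.
HB.instance Definition _ n := GRing.isSubmodClosed.Build F
  (clfun n) (@cl_pred n) (GRing.submod_closed_semi (@cl_pred_closed n)).

Record Pcl n := MkPcl { cl_fun : clfun n; _ : cl_fun \in @cl_pred n }.
Definition cl_app n (f : Pcl n) : graph n -> ('I_n -> V) -> Q n := cl_fun f.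
Coercion cl_app : Pcl >-> Funclass.
HB.instance Definition _ n := [isSub for @cl_fun n].
HB.instance Definition _ n := [Choice of Pcl n by <:].
HB.instance Definition _ n := [SubChoice_isSubLmodule of Pcl n by <:].

(* Used only on functions in P^cl(n). *)
Definition mkPcl n (f : clfun n) : Pcl n := insubd 0 f.

Definition cl_act n (s : 'S_n) (f : Pcl n) : Pcl n :=
  mkPcl (fun G v => \sum_(p : {ffun 'I_n -> bool}) perm_sign s p *:
    qsubst s (f (relabel s G) (fun k => par (p ((s^-1)%g k)) (v ((s^-1)%g k))))).

Definition cl_unit : Pcl 1 :=
  xget 0 [set f : Pcl 1 | forall G v, f G v = qconst d 1 (v ord0)].

Section ClComp.
Variables (n : nat) (m : 'I_n -> nat).
Local Notation M := (\sum_i m i)%N.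
Variables (f : Pcl n) (g : forall i, Pcl (m i)).

(* The operator x_j = Lambda_j + d_j on functions of w_1, ..., w_n. *)
Definition cl_x (j : 'I_n) (A : ('I_n -> V) -> Q M) : ('I_n -> V) -> Q M :=
  fun w => \sum_(k : 'I_M | tagnat.sig1 k == j) qlam k (A w) + A [eta w with j |-> d (w j)].

(* The operator lambda_k + X(k). *)
Definition cl_lam (G : graph M) (k : 'I_M) (A : ('I_n -> V) -> Q M) :
    ('I_n -> V) -> Q M :=
  fun w => qlam k (A w) + \sum_(j | `[< reached_from G k j >]) cl_x j A w.

Definition cl_comp_val (G : graph M) (v : 'I_M -> V) : Q M :=
  if `[< acyclic (collapse G) >] then
    \sum_(p : {ffun 'I_M -> bool}) \sum_(q : {ffun 'I_n -> bool}) koszul_sign q p *: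
      let w i := rep (qpar (q i (+) block_par p i) (g i (inner_graph G i)
        (fun a => par (p (tagnat.Rank i a)) (v (tagnat.Rank i a))))) in
      \sum_(mu \in [set: 'X_{1..M}])
        opX (cl_lam G) mu (fun u => qsubst (@tagnat.sig1 n m) (f (collapse G) u))
          (fun i => w i (mblock mu i))
  else 0.

Definition cl_comp : Pcl M := mkPcl cl_comp_val.

End ClComp.

Definition cl_deg (r : nat) n : set (Pcl n) :=
  [set f | forall G v, nedges G != r -> f G v = 0].

Definition Pcl_operad : graded_operad F :=
  GradedOperad (op_car := fun n => Pcl n) cl_act cl_comp cl_unit cl_deg.

End Operads.

(* Main.v *)
(* The values X(.; p_Gamma) only see the class of X in gr^r, and they satisfy the axioms of
   P^cl: a monomial with poles along a graph with a cycle lies in a smaller step of the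
   filtration by partial fractions, z_ij p_Gamma = p_(Gamma \ e) for an edge e = (i -> j),
   and the sum of the derivatives over a connected component kills p_Gamma.

   Injectivity: if X kills the functions p_Gamma with r edges, it kills, by induction on the
   order of the poles, every function with poles along r divisors.  If the divisors form a
   graph with a cycle this is the partial fraction argument; if they form a forest, the sum
   of the derivatives over one side of an edge raises the order of the pole at this edge only,
   and in characteristic 0 this produces all higher poles from the simple ones.

   Compositions: p_Gamma is the product of the functions of the graphs inside the blocks and
   of a function g of the edges between blocks.  If the collapsed graph is acyclic, the
   derivative of g in z_k followed by the identification of the variables of each block is
   minus the sum, over the blocks reached from k, of the derivatives of the function of
   the collapsed graph.  This turns lambda_k - d/dz_k into lambda_k + X(k).

   Surjectivity for n = 2: a map A which is translation covariant, and such that (d/dlambda_2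
   - d/dlambda_1) A is a sesquilinear map, extends to an element X of P^ch(2) with
   X(.; z_12^-1) = A, its values on the other powers of z_12 being forced.  In degree 1 take for A
   the value at the graph 1 -> 2, and in degree 0 a primitive of the value at the empty
   graph. *)
Require Import Defs.
From HB Require Import structures.
From mathcomp Require Import all_boot all_order all_fingroup all_algebra.
From mathcomp Require Import boolp classical_sets functions fsbigop.
From mathcomp.multinomials Require Import mpoly.
From mathcomp Require Import ring zify.

Set Implicit Arguments.
Unset Strict Implicit.
Unset Printing Implicit Defensive.

Import GRing.Theory.
Local Open Scope ring_scope.

(** * Rational functions *)

(** The composition of P^ch is prescribed only on products h = g prod f_i, a function has many such
    presentations, and [ch_comp] is the default value 0 unless an element with the prescribed values
    exists. Proving this existence takes a large part of the work. Presentations differ by moving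
    differences z_ab of variables of one block between g and f_i. In g such a factor is killed by
    the identification of the variables unless some d/dz_k hits it; in the i-th slot it is the
    derivation d/dlambda_b - d/dlambda_a. Both sides vanish on constants and have the same
    commutators with lambda_k - d/dz_k, so they agree by induction on the monomials. On the
    classical side no analogous check is made: on elements of the image, the formulas for the action
    and the composition are shown to equal elements of the image, hence they lie in P^cl. The
    primitive needed in arity 2 exists because d/dlambda_2 - d/dlambda_1 is locally nilpotent on the
    quotient and takes the value 1 on lambda_2; Taylor's formula then divides by factorials. *)

Lemma quotient_rule_mul (K : fieldType) (a b p q a' b' p' q' : K) :
  b != 0 -> q != 0 ->
  ((a' * p + a * p') * (b * q) - a * p * (b' * q + b * q')) / (b * q) ^+ 2 =
  (a' * b - a * b') / b ^+ 2 * (p / q) + a / b * ((p' * q - p * q') / q ^+ 2).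
Proof. by move=> b0 q0; field; rewrite b0 q0. Qed.

Lemma quotient_rule_add (K : fieldType) (a b p q a' b' p' q' : K) :
  b != 0 -> q != 0 ->
  ((a' * q + a * q' + (p' * b + p * b')) * (b * q) -
    (a * q + p * b) * (b' * q + b * q')) / (b * q) ^+ 2 =
  (a' * b - a * b') / b ^+ 2 + (p' * q - p * q') / q ^+ 2.
Proof. by move=> b0 q0; field; rewrite b0 q0. Qed.

(** The commutator of two derivations is a derivation: [klx] stands for the k-th derivative of the
    l-th derivative of x, [lkx] for the opposite order. *)
Lemma commutator_Leibniz (K : comRingType) (x y kx ky lx ly klx lkx kly lky : K) :
  klx * y + lx * ky + (kx * ly + x * kly) - (lkx * y + kx * ly + (lx * ky + x * lky)) =
  (klx - lkx) * y + x * (kly - lky).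
Proof. by ring. Qed.

Section RationalFunctions.
Variables (F : fieldType) (n : nat).
Implicit Types (p q a b : {mpoly F[n]}) (x y : ratfun F n) (i j k l : 'I_n).

Lemma rpolyD p q : rpoly (p + q) = rpoly p + rpoly q. Proof. exact: rmorphD. Qed.
Lemma rpolyB p q : rpoly (p - q) = rpoly p - rpoly q. Proof. exact: rmorphB. Qed.
Lemma rpolyN p : rpoly (- p) = - rpoly p. Proof. exact: rmorphN. Qed.
Lemma rpolyM p q : rpoly (p * q) = rpoly p * rpoly q. Proof. exact: rmorphM. Qed.
Lemma rpolyX p m : rpoly (p ^+ m) = rpoly p ^+ m. Proof. exact: rmorphXn. Qed.
Lemma rpoly0 : rpoly (0 : {mpoly F[n]}) = 0. Proof. exact: rmorph0. Qed.
Lemma rpoly1 : rpoly (1 : {mpoly F[n]}) = 1. Proof. exact: rmorph1. Qed.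
Lemma rpoly_eq0 p : (rpoly p == 0) = (p == 0). Proof. exact: tofrac_eq0. Qed.
Lemma rpoly_inj : injective (@rpoly F n).
Proof. by move=> p q pq; apply/eqP; rewrite -subr_eq0 -rpoly_eq0 rpolyB pq subrr. Qed.

Lemma rpoly_frac x : exists p q, q != 0 /\ x = rpoly p / rpoly q.
Proof.
elim/quotP: x => x _; exists \n_x, \d_x; split; first exact: denom_ratioP.
have dx0 := denom_ratioP x.
apply: (mulIf (x := rpoly \d_x)); first by rewrite rpoly_eq0.
rewrite divfK ?rpoly_eq0 // /rpoly; unlock FracField.tofrac.
rewrite -[LHS]FracField.pi_mul; apply/eqmodP.
rewrite /= FracField.equivfE /FracField.mulf !numden_Ratio ?oner_neq0 ?mulf_neq0 ?mulr1 //.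
  by rewrite mulrC.
all: exact: oner_neq0.
Qed.

Lemma frac_eq a b p q : b != 0 -> q != 0 ->
  rpoly a / rpoly b = rpoly p / rpoly q -> a * q = p * b.
Proof.
move=> b0 q0 /eqP; rewrite eqr_div ?rpoly_eq0 // -!rpolyM => /eqP /rpoly_inj //.
Qed.

Lemma rderivE k a b : b != 0 ->
  rderiv k (rpoly a / rpoly b) = rpoly (a^`M(k) * b - a * b^`M(k)) / rpoly (b ^+ 2).
Proof.
move=> b0; rewrite /rderiv; set x := rpoly a / rpoly b.
set r := generic_quotient.repr x.
have d0 : \d_r != 0 by exact: denom_ratioP.
have Ex : rpoly \n_r / rpoly \d_r = x.
  apply: (mulIf (x := rpoly \d_r)); first by rewrite rpoly_eq0.
  rewrite divfK ?rpoly_eq0 // -[x in RHS]reprK -/r /rpoly; unlock FracField.tofrac.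
  rewrite -[RHS]FracField.pi_mul; apply/eqmodP.
  rewrite /= FracField.equivfE /FracField.mulf !numden_Ratio ?oner_neq0 ?mulf_neq0 ?mulr1 //.
  1: by rewrite mul1r.
  1,2: exact: oner_neq0.
have E := frac_eq d0 b0 Ex.
apply/eqP; rewrite eqr_div ?rpoly_eq0 ?expf_neq0 // -!rpolyM; apply/eqP; congr rpoly.
set c := \n_r in E *; set e := \d_r in E *.
(* The difference of the two numerators is a combination of the equality [E] of cross products and
   of its derivative. *)
have E' := congr1 (mderiv k) E; rewrite /= !mderivM in E'.
apply/eqP; rewrite -subr_eq0.
suff -> : (c^`M(k) * e - c * e^`M(k)) * b ^+ 2 - (a^`M(k) * b - a * b^`M(k)) * e ^+ 2
  = (c^`M(k) * b + c * b^`M(k) - (a^`M(k) * e + a * e^`M(k))) * (e * b)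
    - (c * b - a * e) * (e^`M(k) * b + b^`M(k) * e).
  by rewrite E' E !subrr !mul0r subrr.
move: (c^`M(k)) (e^`M(k)) (a^`M(k)) (b^`M(k)) => c' e' a' b'.
by rewrite !expr2; ring.
Qed.

Lemma rderiv_poly k p : rderiv k (rpoly p) = rpoly p^`M(k).
Proof.
have := @rderivE k p 1 (oner_neq0 _).
by rewrite rpoly1 divr1 expr1n rpoly1 divr1 mulr1 -[1]/(1%:MP) mderivC mulr0 subr0.
Qed.

Lemma rderivM k x y : rderiv k (x * y) = rderiv k x * y + x * rderiv k y.
Proof.
have [a [b [b0 ->]]] := rpoly_frac x; have [p [q [q0 ->]]] := rpoly_frac y.
rewrite mulf_div -!rpolyM !rderivE ?mulf_neq0 // !mderivM.
rewrite !(rpolyB, rpolyM, rpolyD, rpolyX).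
by apply: quotient_rule_mul; rewrite rpoly_eq0.
Qed.

Lemma rderivD k x y : rderiv k (x + y) = rderiv k x + rderiv k y.
Proof.
have [a [b [b0 ->]]] := rpoly_frac x; have [p [q [q0 ->]]] := rpoly_frac y.
rewrite addf_div ?rpoly_eq0 // -!rpolyM -rpolyD !rderivE ?mulf_neq0 //.
rewrite !(mderivM, mderivD) !(rpolyB, rpolyM, rpolyD, rpolyX).
by apply: quotient_rule_add; rewrite rpoly_eq0.
Qed.

Lemma rderiv_const k (c : F) : rderiv k (rconst n c) = 0.
Proof. by rewrite /rconst rderiv_poly mderivC rpoly0. Qed.

Lemma rderivZ k c x : rderiv k (c *: x) = c *: rderiv k x.
Proof. by rewrite -[c *: x]/(_ * _) rderivM rderiv_const mul0r add0r. Qed.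

Lemma rderiv0 k : rderiv k (0 : ratfun F n) = 0.
Proof. by have := rderivZ k 0 0; rewrite !scale0r. Qed.

Lemma rderiv1 k : rderiv k (1 : ratfun F n) = 0.
Proof. by rewrite -rpoly1; exact: (rderiv_const k 1). Qed.

Lemma rderivN k x : rderiv k (- x) = - rderiv k x.
Proof. by rewrite -scaleN1r rderivZ scaleN1r. Qed.

Lemma rderivB k x y : rderiv k (x - y) = rderiv k x - rderiv k y.
Proof. by rewrite rderivD rderivN. Qed.

Lemma rderivV k x : rderiv k x^-1 = - rderiv k x / x ^+ 2.
Proof.
have [->|x0] := eqVneq x 0; first by rewrite invr0 !rderiv0 oppr0 mul0r.
have := rderivM k x x^-1; rewrite divff // rderiv1 => /eqP.
rewrite eq_sym addrC addr_eq0 => /eqP E.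
by apply: (mulfI x0); rewrite E mulrCA expr2 invfM (mulVKf x0) // mulNr.
Qed.

Lemma rderiv_rz k i j : rderiv k (rz F i j) = ((k == i)%:R - (k == j)%:R).
Proof.
rewrite /rz rderivB !rderiv_poly !mderivX !mnm1E.
have H (u : 'I_n) : rpoly ((u == k)%:R *: 'X_[U_(u) - U_(k)] : {mpoly F[n]}) = (k == u)%:R.
  rewrite eq_sym; have [->|_] := eqVneq; last by rewrite scale0r rpoly0.
  by rewrite scale1r -{1}[U_(u)%MM]add0m addmK mpolyX0 rpoly1.
by rewrite !H.
Qed.

(** Apply D to (p / q) q = p. In [rderivC] D is the commutator of two partial derivatives. *)
Lemma derivation_frac (D : ratfun F n -> ratfun F n) :
  (forall x y, D (x * y) = D x * y + x * D y) -> (forall p, D (rpoly p) = 0) ->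
  forall x, D x = 0.
Proof.
move=> DM Dp x; have [p [q [q0 ->]]] := rpoly_frac x.
have := DM (rpoly p / rpoly q) (rpoly q).
rewrite divfK ?rpoly_eq0 // !Dp mulr0 addr0 => /esym/eqP.
by rewrite mulf_eq0 rpoly_eq0 (negPf q0) orbF => /eqP.
Qed.

Lemma rderivC k l x : rderiv k (rderiv l x) = rderiv l (rderiv k x).
Proof.
apply/eqP; rewrite -subr_eq0; apply/eqP; move: x.
apply: derivation_frac => [x y|p]; last by rewrite !rderiv_poly mderiv_comm subrr.
by rewrite !(rderivM, rderivD) commutator_Leibniz.
Qed.

Lemma rz_neq0 i j : i != j -> rz F i j != 0.
Proof.
move=> ij; apply/eqP=> z0; have := rderiv_rz i i j.
by rewrite z0 rderiv0 eqxx (negPf ij) subr0 => /esym/eqP; rewrite oner_eq0.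
Qed.
Lemma rz_opp i j : rz F j i = - rz F i j. Proof. by rewrite /rz opprB. Qed.
Lemma rzii i : rz F i i = 0. Proof. by rewrite /rz subrr. Qed.
Lemma rz_add i j k : rz F i j + rz F j k = rz F i k.
Proof. by rewrite /rz addrA subrK. Qed.

End RationalFunctions.

(** * Substitutions of variables in rational functions *)

Section Substitution.
Variables (F : fieldType) (m n : nat) (t : 'I_m -> 'I_n).
Implicit Types (p q a b : {mpoly F[m]}) (x y : ratfun F m).

Lemma psubstX i : psubst t ('X_i : {mpoly F[m]}) = 'X_(t i).
Proof. by rewrite /psubst comp_mpolyXU -tnth_nth tnth_mktuple. Qed.
Lemma psubstC c : psubst t (c%:MP : {mpoly F[m]}) = c%:MP.
Proof. by rewrite /psubst comp_mpolyC. Qed.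
Lemma psubstD p q : psubst t (p + q) = psubst t p + psubst t q.
Proof. by rewrite /psubst comp_mpolyD. Qed.
Lemma psubstB p q : psubst t (p - q) = psubst t p - psubst t q.
Proof. by rewrite /psubst comp_mpolyB. Qed.
Lemma psubstM p q : psubst t (p * q) = psubst t p * psubst t q.
Proof. by rewrite /psubst rmorphM. Qed.
Lemma psubst0 : psubst t (0 : {mpoly F[m]}) = 0.
Proof. by rewrite /psubst comp_mpoly0. Qed.
Lemma psubst1 : psubst t (1 : {mpoly F[m]}) = 1.
Proof. exact: (psubstC 1). Qed.

(** The local ring at the generic point of the subspace where z_k = z_l whenever t k = t l. Outside
    it [rsubst] takes its default value 0; on it [rsubst] is a ring morphism. *)
Definition regular x := exists a b, psubst t b != 0 /\ x = rpoly a / rpoly b.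

Lemma psubst_neq0 b : psubst t b != 0 -> b != 0.
Proof. by apply: contraNneq => ->; rewrite psubst0. Qed.

Lemma rsubstE a b : psubst t b != 0 ->
  rsubst t (rpoly a / rpoly b) = rpoly (psubst t a) / rpoly (psubst t b).
Proof.
move=> b0; rewrite /rsubst; case: xgetP => [y _ [a' [b' [E b'0 ->]]]|].
  have := frac_eq (psubst_neq0 b0) (psubst_neq0 b'0) E.
  move/(congr1 (psubst t)); rewrite !psubstM => E'.
  by apply/eqP; rewrite eqr_div ?rpoly_eq0 // -!rpolyM E'.
by move=> H; case: (H (rpoly (psubst t a) / rpoly (psubst t b))); exists a, b.
Qed.

Lemma rsubst_poly p : rsubst t (rpoly p) = rpoly (psubst t p).
Proof.
have := @rsubstE p 1; rewrite psubst1 !rpoly1 !divr1; apply; exact: oner_neq0.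
Qed.
Lemma regular_poly p : regular (rpoly p).
Proof. by exists p, 1; rewrite psubst1 rpoly1 divr1 oner_neq0. Qed.

Lemma regularM x y : regular x -> regular y -> regular (x * y).
Proof.
move=> [a [b [b0 ->]]] [p [q [q0 ->]]]; exists (a * p), (b * q).
by rewrite psubstM mulf_neq0 // mulf_div !rpolyM.
Qed.
Lemma rsubstM x y : regular x -> regular y -> rsubst t (x * y) = rsubst t x * rsubst t y.
Proof.
move=> [a [b [b0 ->]]] [p [q [q0 ->]]].
by rewrite mulf_div -!rpolyM !rsubstE ?psubstM ?mulf_neq0 // !rpolyM mulf_div.
Qed.
Lemma regularD x y : regular x -> regular y -> regular (x + y).
Proof.
move=> [a [b [b0 ->]]] [p [q [q0 ->]]]; exists (a * q + p * b), (b * q).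
rewrite psubstM mulf_neq0 // addf_div ?rpoly_eq0 ?psubst_neq0 //.
by rewrite rpolyD !rpolyM.
Qed.
Lemma rsubstD x y : regular x -> regular y -> rsubst t (x + y) = rsubst t x + rsubst t y.
Proof.
move=> [a [b [b0 ->]]] [p [q [q0 ->]]].
rewrite addf_div ?rpoly_eq0 ?psubst_neq0 // -!rpolyM -rpolyD.
rewrite !rsubstE ?psubstM ?mulf_neq0 // psubstD !psubstM rpolyD !rpolyM.
by rewrite addf_div ?rpoly_eq0.
Qed.

Lemma rsubst_const (c : F) : rsubst t (rconst m c) = rconst n c.
Proof. by rewrite /rconst rsubst_poly psubstC. Qed.
Lemma rsubst_rz i j : rsubst t (rz F i j) = rz F (t i) (t j).
Proof. by rewrite /rz -!rpolyB rsubst_poly psubstB !psubstX. Qed.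
Lemma regular_rz i j : regular (rz F i j).
Proof. by rewrite /rz -rpolyB; apply: regular_poly. Qed.
Lemma psubst_rz i j : t i != t j -> psubst t ('X_i - 'X_j : {mpoly F[m]}) != 0.
Proof. by move=> tij; rewrite psubstB !psubstX -rpoly_eq0 rpolyB rz_neq0. Qed.
Lemma regular_rzV i j : t i != t j -> regular (rz F i j)^-1.
Proof.
move=> tij; exists 1, ('X_i - 'X_j); rewrite psubst_rz //; split=> //.
by rewrite rpoly1 rpolyB div1r.
Qed.
Lemma rsubst_rzV i j : t i != t j -> rsubst t (rz F i j)^-1 = (rz F (t i) (t j))^-1.
Proof.
move=> tij; have := @rsubstE 1 _ (psubst_rz tij).
by rewrite psubst1 psubstB !psubstX !rpoly1 !rpolyB !div1r.
Qed.

End Substitution.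

Lemma mpoly_alg_ind (F : fieldType) n (S : {mpoly F[n]} -> Prop) :
  (forall c, S c%:MP) -> (forall i, S 'X_i) -> (forall p q, S p -> S q -> S (p + q)) ->
  (forall p q, S p -> S q -> S (p * q)) -> forall p, S p.
Proof.
move=> SC SX SD SM p; rewrite [p]mpolyE.
apply: (big_ind S); [exact: (SC 0)|exact: SD|move=> mu _].
rewrite -mul_mpolyC mpolyXE_id; apply: (SM _ _ (SC _)).
apply: (big_ind S); [exact: (SC 1)|exact: SM|move=> i _].
by elim: (mu i) => [|k IH]; [exact: (SC 1)|rewrite exprS; apply: SM].
Qed.

(** * Functions of the differences of the variables with prescribed poles *)

Section TranslationInvariantAlgebras.
Variables (F : fieldType) (n : nat).
Implicit Types (P : rel 'I_n) (x y : ratfun F n) (i j k l : 'I_n).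

(** All pole conditions of the proof are instances: [P] is i < j for O^{*T}, empty for O^T, the edge
    set of a graph, or the pairs of indices in different blocks. The generators give an induction
    principle for derivatives, substitutions and values of operations. *)
Inductive alg P : ratfun F n -> Prop :=
  | alg_const c : alg P (rconst n c)
  | alg_rz i j : alg P (rz F i j)
  | alg_rzV i j of P i j : alg P (rz F i j)^-1
  | algD x y of alg P x & alg P y : alg P (x + y)
  | algM x y of alg P x & alg P y : alg P (x * y).

Lemma alg0 P : alg P 0.
Proof. by rewrite -rpoly0; apply: (alg_const P 0). Qed.
Lemma alg1 P : alg P 1.
Proof. by rewrite -rpoly1; apply: (alg_const P 1). Qed.
Lemma algZ P c x : alg P x -> alg P (c *: x).
Proof. by move=> Px; apply: algM (alg_const _ _) Px. Qed.
Lemma algN P x : alg P x -> alg P (- x).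
Proof. by rewrite -scaleN1r; apply: algZ. Qed.
Lemma algB P x y : alg P x -> alg P y -> alg P (x - y).
Proof. by move=> Px Py; apply: algD Px (algN Py). Qed.
Lemma alg_prod P (I : Type) (r : seq I) (S : pred I) (f : I -> ratfun F n) :
  (forall e, S e -> alg P (f e)) -> alg P (\prod_(e <- r | S e) f e).
Proof. by move=> Pf; apply: big_ind => //; [exact: alg1|exact: algM]. Qed.
Lemma algX P x m : alg P x -> alg P (x ^+ m).
Proof. by move=> Px; elim: m => [|m IH]; [exact: alg1|rewrite exprS; apply: algM]. Qed.

(** As z_ji = - z_ij, a pole may be listed in either orientation. *)
Lemma alg_sub P P' x : (forall i j, P i j -> P' i j || P' j i) -> alg P x -> alg P' x.
Proof.
move=> PP'; elim=> [c|i j|i j /PP'/orP[ij|ij]|y z _ Py _ Pz|y z _ Py _ Pz].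
- exact: alg_const.
- exact: alg_rz.
- exact: alg_rzV.
- by rewrite rz_opp invrN; apply/algN/alg_rzV.
- exact: algD.
- exact: algM.
Qed.

Lemma Ostar_alg x : (x \in @Ostar_pred F n) <-> alg (fun i j => (i < j)%N) x.
Proof.
split=> [/asboolP|].
  elim=> [y [i [j [ij [->|->]]]]|c|y z _ Py _ Pz|y z _ Py _ Pz].
  - exact: alg_rz.
  - exact: alg_rzV.
  - exact: alg_const.
  - exact: algD.
  - exact: algM.
elim=> [c|i j|i j ij|y z _ Py _ Pz|y z _ Py _ Pz].
- exact/asboolP/gen_const.
- exact: rz_mem.
- exact: rzV_mem.
- exact: rpredD.
- exact: rpredM.
Qed.

Lemma alg_Ostar P x : irreflexive P -> alg P x -> x \in @Ostar_pred F n.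
Proof.
move=> Pirr Px; apply/Ostar_alg; apply: alg_sub Px => i j.
by case: ltngtP => // /val_inj ->; rewrite Pirr.
Qed.

Lemma alg_rderiv P k x : alg P x -> alg P (rderiv k x).
Proof.
have Pnat (b : bool) : alg P b%:R by case: b; [exact: alg1|exact: alg0].
have Pz i j : alg P (rderiv k (rz F i j)) by rewrite rderiv_rz; apply: algB.
elim=> [c|i j //|i j ij|y z Py P'y Pz' P'z|y z Py P'y Pz' P'z].
- by rewrite rderiv_const; apply: alg0.
- rewrite rderivV -exprVn; apply: algM (algN (Pz _ _)) (algX _ _); exact: alg_rzV.
- by rewrite rderivD; apply: algD.
- by rewrite rderivM; apply: algD; apply: algM.
Qed.

Definition denom P : ratfun F n := \prod_(e : 'I_n * 'I_n | P e.1 e.2) rz F e.1 e.2.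

Lemma denom_neq0 P : irreflexive P -> denom P != 0.
Proof.
move=> Pirr; apply/prodf_neq0 => -[i j] /= ij; apply: rz_neq0.
by apply: contraTneq ij => ->; rewrite Pirr.
Qed.

Lemma alg_denom P Q : alg Q (denom P).
Proof. by apply: alg_prod => e _; apply: alg_rz. Qed.
Lemma alg_denomV P : alg P (denom P)^-1.
Proof. by rewrite /denom -prodfV; apply: alg_prod => e; apply: alg_rzV. Qed.

Lemma alg_localize P x : irreflexive P -> alg P x ->
  exists N, alg (fun _ _ => false) (x * denom P ^+ N).
Proof.
move=> Pirr; have d0 := denom_neq0 Pirr; set P0 := fun _ _ => false.
have up y N N' : (N <= N')%N -> alg P0 (y * denom P ^+ N) -> alg P0 (y * denom P ^+ N').
  move=> /subnK <-; rewrite addnC exprD mulrA => Py.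
  exact: algM Py (algX _ (alg_denom _ _)).
elim=> [c|i j|i j ij|y z _ [N Py] _ [N' Pz]|y z _ [N Py] _ [N' Pz]].
- by exists 0%N; rewrite mulr1; apply: alg_const.
- by exists 0%N; rewrite mulr1; apply: alg_rz.
- exists 1%N; rewrite expr1 /denom (bigD1 (i, j)) //= mulrA mulVf.
    by rewrite mul1r; apply: alg_prod => e _; apply: alg_rz.
  by apply: rz_neq0; apply: contraTneq ij => ->; rewrite Pirr.
- exists (maxn N N'); rewrite mulrDl; apply: algD.
    by apply: up Py; rewrite leq_maxl.
  by apply: up Pz; rewrite leq_maxr.
- by exists (N + N')%N; rewrite exprD mulrACA; apply: algM.
Qed.

(** A projection of the polynomials onto the polynomials in the differences: its values are such
    polynomials ([translate_alg]), and it fixes them ([alg_translate]), whatever the base point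
    k. *)
Definition translate k (p : {mpoly F[n]}) : {mpoly F[n]} :=
  p \mPo [tuple 'X_i - 'X_k | i < n].

Lemma translateX k i : translate k 'X_i = 'X_i - 'X_k.
Proof. by rewrite /translate comp_mpolyXU -tnth_nth tnth_mktuple. Qed.

Lemma translateD k p q : translate k (p + q) = translate k p + translate k q.
Proof. exact: comp_mpolyD. Qed.
Lemma translateB k p q : translate k (p - q) = translate k p - translate k q.
Proof. exact: comp_mpolyB. Qed.
Lemma translateM k p q : translate k (p * q) = translate k p * translate k q.
Proof. exact: rmorphM. Qed.

Lemma translate_alg k p : alg (fun _ _ => false) (rpoly (translate k p)).
Proof.
elim/mpoly_alg_ind: p => [c|i|p q Pp Pq|p q Pp Pq].
- by rewrite /translate comp_mpolyC; apply: alg_const.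
- by rewrite translateX rpolyB; apply: alg_rz.
- by rewrite translateD rpolyD; apply: algD.
- by rewrite translateM rpolyM; apply: algM.
Qed.

Lemma alg_translate k x : alg (fun _ _ => false) x ->
  exists p, x = rpoly p /\ translate k p = p.
Proof.
elim=> [c|i j|//|y z _ [p [-> Ep]] _ [q [-> Eq]]|y z _ [p [-> Ep]] _ [q [-> Eq]]].
- by exists c%:MP; rewrite /translate comp_mpolyC.
- exists ('X_i - 'X_j); split; first by rewrite rpolyB.
  by rewrite translateB !translateX; ring.
- by exists (p + q); rewrite rpolyD; split=> //; rewrite translateD Ep Eq.
- by exists (p * q); rewrite rpolyM; split=> //; rewrite translateM Ep Eq.
Qed.

Lemma factor_diagonal k l (p : {mpoly F[n]}) :
  exists q, p - psubst (fun i => if i == k then l else i) p = q * ('X_k - 'X_l).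
Proof.
elim/mpoly_alg_ind: p => [c|i|p q [a Ea] [b Eb]|p q [a Ea] [b Eb]].
- by exists 0; rewrite psubstC subrr mul0r.
- rewrite psubstX; case: eqP => [->|_]; first by exists 1; rewrite mul1r.
  by exists 0; rewrite subrr mul0r.
- by exists (a + b); rewrite psubstD mulrDl -Ea -Eb opprD addrACA.
- move: Ea Eb; set p' := psubst _ p; set q' := psubst _ q => Ea Eb.
  exists (a * q + p' * b); rewrite psubstM mulrDl mulrAC -Ea -mulrA -Eb -/p' -/q'.
  by rewrite mulrBl mulrBr addrA subrK.
Qed.

(* The numerator of x z_kl vanishes at z_k = z_l and is invariant under translations, hence
   it is divisible by z_kl with a translation invariant quotient. *)
Lemma alg_no_pole_step P k l x : irreflexive P -> k != l -> no_pole k l x ->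
  alg P (x * rz F k l) -> alg P x.
Proof.
move=> Pirr /(rz_neq0 F) kl [c [e [Ex e0]]] Pxz; have ne0 := psubst_neq0 e0.
have [N] := alg_localize Pirr Pxz.
have [r Er] : exists r : {mpoly F[n]}, rpoly r = denom P ^+ N.
  exists ((\prod_(e | P e.1 e.2) ('X_e.1 - 'X_e.2)) ^+ N).
  rewrite rpolyX /rpoly rmorph_prod; congr (_ ^+ N); apply: eq_bigr => e' _.
  by rewrite rmorphB.
case/(alg_translate k)=> a [Exa ta].
have Ea : c * ('X_k - 'X_l) * r = a * e.
  apply: rpoly_inj; rewrite !rpolyM -Exa Ex Er rpolyB -/(rz F k l).
  by rewrite [in RHS](mulrAC (rpoly c)) [in RHS](mulrAC (rpoly c * _)) divfK ?rpoly_eq0.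
have [q Eq] := factor_diagonal k l a.
have a0 : psubst (fun i => if i == k then l else i) a = 0.
  have /(congr1 (psubst (fun i => if i == k then l else i)))/esym := Ea.
  rewrite !psubstM psubstB !psubstX eqxx.
  have -> : (if l == k then l else l) = l by case: ifP.
  by rewrite subrr mulr0 mul0r => /eqP; rewrite mulf_eq0 (negPf e0) orbF => /eqP.
move: Eq; rewrite a0 subr0 => /(congr1 (translate k)); rewrite ta translateM.
rewrite translateB !translateX subrr sub0r opprB => Eq.
have -> : x = rpoly (translate k q) * (denom P)^-1 ^+ N.
  have d0 := denom_neq0 Pirr.
  rewrite exprVn -Er; apply: (canRL (mulfK _)); first by rewrite Er expf_neq0.
  apply: (mulIf kl); rewrite {2}/rz -rpolyB -rpolyM -Eq.
  by rewrite -Exa Er mulrAC.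
apply: algM (algX _ (alg_denomV _)).
exact: alg_sub (translate_alg _ _).
Qed.

(** A power of z_kl clears the pole at z_k = z_l; its factors are then cancelled one at a time by
    [alg_no_pole_step], as x and its multiples have no pole there. *)
Lemma alg_no_pole P k l x : irreflexive P -> k != l -> alg P x -> no_pole k l x ->
  alg (fun i j => P i j && ((i, j) \notin [:: (k, l); (l, k)])) x.
Proof.
move=> Pirr kl Px; set P' := fun i j => P i j && _.
have z0 := rz_neq0 F kl.
have P'irr : irreflexive P' by move=> i; rewrite /P' Pirr.
have [u Pxu] : exists u, alg P' (x * rz F k l ^+ u).
  elim: Px => [c|i j|i j ij|y y' _ [u Py] _ [v Py']|y y' _ [u Py] _ [v Py']].
  - by exists 0%N; rewrite mulr1; apply: alg_const.
  - by exists 0%N; rewrite mulr1; apply: alg_rz.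
  - have [|P'ij] := boolP ((i, j) \in [:: (k, l); (l, k)]).
      rewrite !inE !xpair_eqE => /orP[]/andP[/eqP-> /eqP->]; exists 1%N.
        by rewrite expr1 mulVf //; apply: alg1.
      by rewrite expr1 rz_opp invrN mulNr mulVf //; apply/algN/alg1.
    by exists 0%N; rewrite mulr1; apply: alg_rzV; rewrite /P' ij.
  - exists (u + v)%N; rewrite mulrDl {1}exprD [in X in _ + X]addnC exprD !mulrA.
    by apply: algD; apply: algM => //; apply/algX/alg_rz.
  - by exists (u + v)%N; rewrite exprD mulrACA; apply: algM.
elim: u x {Px} Pxu => [|u IH] x; first by rewrite mulr1.
rewrite exprS mulrA => Px npx; apply: (alg_no_pole_step P'irr kl npx).
apply: (IH _ Px); case: npx => c [e [Ex e0]].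
exists (c * ('X_k - 'X_l)), e; split=> //.
by rewrite rpolyM rpolyB Ex mulrAC.
Qed.

End TranslationInvariantAlgebras.

Lemma sumr_pred1 (R : pzSemiRingType) (I : finType) (S : pred I) i :
  \sum_(k | S k) (k == i)%:R = (S i)%:R :> R.
Proof.
rewrite big_mkcond (bigD1 i) //= eqxx big1 ?addr0 => [|k /negPf ->]; last by rewrite if_same.
by case: (S i).
Qed.

Lemma scaler_rconst (F : fieldType) n (c : F) (x : ratfun F n) : c *: x = rconst n c * x.
Proof. by []. Qed.

(** * Regularity and chain rule for functions with prescribed poles *)

Section AlgebraSubstitution.
Variables (F : fieldType) (m n : nat) (t : 'I_m -> 'I_n).
Implicit Types (P : rel 'I_m) (x y : ratfun F m).

Lemma regular_const (c : F) : regular t (rconst m c).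
Proof. exact: regular_poly. Qed.

Lemma alg_regular P x : (forall i j, P i j -> t i != t j) -> alg P x -> regular t x.
Proof.
move=> tP; elim=> [c|i j|i j /tP|y z _ Py _ Pz|y z _ Py _ Pz].
- exact: regular_const.
- exact: regular_rz.
- exact: regular_rzV.
- exact: regularD.
- exact: regularM.
Qed.

Lemma alg_rsubst P (P' : rel 'I_n) x : irreflexive P' -> (forall i j, P i j -> P' (t i) (t j)) ->
  alg P x -> alg P' (rsubst t x).
Proof.
move=> P'irr tP; have tP' i j : P i j -> t i != t j.
  by move=> /tP; apply: contraTneq => ->; rewrite P'irr.
elim=> [c|i j|i j ij|y z Py P'y Pz P'z|y z Py P'y Pz P'z].
- by rewrite rsubst_const; apply: alg_const.
- by rewrite rsubst_rz; apply: alg_rz.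
- by rewrite rsubst_rzV ?tP' //; apply/alg_rzV/tP.
- by rewrite rsubstD; [apply: algD|exact: alg_regular Py|exact: alg_regular Pz].
- by rewrite rsubstM; [apply: algM|exact: alg_regular Py|exact: alg_regular Pz].
Qed.

(** The pole condition keeps x and its derivatives regular, so that [rsubst] is additive and
    multiplicative on every term of the chain rule. *)
Lemma rderiv_rsubst P l x : (forall i j, P i j -> t i != t j) -> alg P x ->
  rderiv l (rsubst t x) = \sum_(k | t k == l) rsubst t (rderiv k x).
Proof.
move=> tP.
have drz k i j : rderiv k (rz F i j) = rconst m ((k == i)%:R - (k == j)%:R).
  by rewrite rderiv_rz /rconst mpolyCB rpolyB; do 2 case: (k == _); rewrite ?rpoly1 ?rpoly0.
have srz i j : \sum_(k | t k == l) rsubst t (rderiv k (rz F i j)) = rderiv l (rz F (t i) (t j)).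
  rewrite rderiv_rz (eq_bigr (fun k => (k == i)%:R - (k == j)%:R)) => [|k _].
    by rewrite sumrB !sumr_pred1 ![_ == l]eq_sym.
  rewrite drz rsubst_const /rconst mpolyCB rpolyB.
  by do 2 case: (k == _); rewrite ?rpoly1 ?rpoly0.
have reg y : alg P y -> regular t y by exact: alg_regular.
elim=> [c|i j|i j Pij|y z Py IHy Pz IHz|y z Py IHy Pz IHz].
- rewrite rsubst_const rderiv_const big1 // => k _; rewrite rderiv_const.
  by rewrite -[0 in LHS](rpoly0 F) rsubst_poly psubst0 rpoly0.
- by rewrite rsubst_rz srz.
- have tij := tP i j Pij; rewrite rsubst_rzV // rderivV -srz mulNr mulr_suml -sumrN.
  apply: eq_bigr => k _; rewrite rderivV drz rsubst_const -!exprVn !expr2.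
  set c := (k == i)%:R - _; set z := (rz F i j)^-1.
  have rz' : regular t z by apply: regular_rzV.
  have -> : - rconst m c * (z * z) = rconst m (- c) * (z * z).
    by rewrite mulNr -!scaler_rconst scaleNr.
  rewrite !rsubstM ?rsubst_const ?rsubst_rzV //; [|exact: regular_const|exact: regularM].
  by rewrite -!scaler_rconst scaleNr.
- rewrite rsubstD; [|exact: reg|exact: reg].
  rewrite rderivD IHy IHz -big_split; apply: eq_bigr => k _.
  by rewrite rderivD rsubstD //; apply/reg/alg_rderiv.
- rewrite rsubstM; [|exact: reg|exact: reg].
  rewrite rderivM IHy IHz mulr_suml mulr_sumr -big_split.
  apply: eq_bigr => k _ /=.
  have ry := reg _ Py; have rz := reg _ Pz.
  have rdy := reg _ (alg_rderiv k Py); have rdz := reg _ (alg_rderiv k Pz).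
  by rewrite rderivM rsubstD; [rewrite (rsubstM rdy rz) (rsubstM ry rdz)|exact: regularM|exact: regularM].
Qed.

End AlgebraSubstitution.

(** * Derivatives and substitutions in the algebra O^{*T} *)

Section Ostar.
Variables (F : fieldType).

Lemma OvalP n (f : Ostar F n) : alg (fun i j => (i < j)%N) (Oval f).
Proof. by apply/Ostar_alg; case: f. Qed.

Lemma Oval_mkO n x : x \in @Ostar_pred F n -> Oval (mkO x) = x.
Proof. by move=> Ox; rewrite /mkO val_insubd Ox. Qed.

Lemma Oval_inj n : injective (@Oval F n). Proof. exact: val_inj. Qed.
Lemma OvalD n (f g : Ostar F n) : Oval (f + g) = Oval f + Oval g. Proof. by []. Qed.
Lemma OvalN n (f : Ostar F n) : Oval (- f) = - Oval f. Proof. by []. Qed.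
Lemma OvalM n (f g : Ostar F n) : Oval (f * g) = Oval f * Oval g. Proof. by []. Qed.
Lemma OvalZ n c (f : Ostar F n) : Oval (c *: f) = c *: Oval f. Proof. by []. Qed.
Lemma Oval1 n : Oval (1 : Ostar F n) = 1. Proof. by []. Qed.
Lemma Oval0 n : Oval (0 : Ostar F n) = 0. Proof. by []. Qed.

Lemma Oval_deriv n k (f : Ostar F n) : Oval (Oderiv k f) = rderiv k (Oval f).
Proof. by rewrite Oval_mkO //; apply/Ostar_alg/alg_rderiv/OvalP. Qed.

Lemma Oval_subst m n (t : 'I_m -> 'I_n) (f : Ostar F m) :
  alg (fun i j => t i != t j) (Oval f) -> Oval (Osubst t f) = rsubst t (Oval f).
Proof.
move=> tf; rewrite Oval_mkO //; apply: (@alg_Ostar _ _ (fun i j => i != j)).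
  by move=> i; rewrite eqxx.
by apply: alg_rsubst tf => // i; rewrite eqxx.
Qed.

Lemma OderivD n k (f g : Ostar F n) : Oderiv k (f + g) = Oderiv k f + Oderiv k g.
Proof. by apply: Oval_inj; rewrite OvalD !Oval_deriv OvalD rderivD. Qed.
Lemma OderivM n k (f g : Ostar F n) : Oderiv k (f * g) = Oderiv k f * g + f * Oderiv k g.
Proof. by apply: Oval_inj; rewrite OvalD !OvalM !Oval_deriv OvalM rderivM. Qed.
Lemma OderivZ n k c (f : Ostar F n) : Oderiv k (c *: f) = c *: Oderiv k f.
Proof. by apply: Oval_inj; rewrite OvalZ !Oval_deriv OvalZ rderivZ. Qed.
Lemma OderivC n k l (f : Ostar F n) : Oderiv k (Oderiv l f) = Oderiv l (Oderiv k f).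
Proof. by apply: Oval_inj; rewrite !Oval_deriv rderivC. Qed.
Lemma Oderiv_z n k i j : Oderiv k (Oz F i j) = ((k == i)%:R - (k == j)%:R) :> Ostar F n.
Proof.
by apply: Oval_inj; rewrite Oval_deriv rderiv_rz; do 2 case: (k == _).
Qed.
Lemma Oderiv1 n k : Oderiv k (1 : Ostar F n) = 0.
Proof. by apply: Oval_inj; rewrite Oval_deriv rderiv1. Qed.
Lemma Oderiv0 n k : Oderiv k (0 : Ostar F n) = 0.
Proof. by apply: Oval_inj; rewrite Oval_deriv rderiv0. Qed.
Lemma Oderiv_prod n k (I : eqType) (r : seq I) (f : I -> Ostar F n) : uniq r ->
  Oderiv k (\prod_(i <- r) f i) =
  \sum_(i <- r) Oderiv k (f i) * \prod_(j <- r | j != i) f j.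
Proof.
elim: r => [|i r IH]; first by rewrite !big_nil Oderiv1.
case/andP=> ir ur; rewrite !big_cons OderivM IH // eqxx; congr (_ * _ + _).
  by rewrite big_seq_cond [in RHS]big_seq_cond; apply: eq_bigl => j;
     rewrite andbT; case: (j =P i) ir => [->/negPf->|]; rewrite ?andbT.
rewrite mulr_sumr [LHS]big_seq [RHS]big_seq; apply: eq_bigr => j jr.
rewrite big_cons; case: (i =P j) jr ir => [->->//|_ _ _].
by rewrite mulrCA.
Qed.

(** For the block map this is the absence of inner poles ([no_inner_pole_crossing]), in a form
    visibly stable under sums, products and derivatives. *)
Definition crossing m n (t : 'I_m -> 'I_n) (f : Ostar F m) := alg (fun i j => t i != t j) (Oval f).

Section Crossing.
Variables (m n : nat) (t : 'I_m -> 'I_n).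
Implicit Types f g : Ostar F m.

Lemma crossingD f g : crossing t f -> crossing t g -> crossing t (f + g).
Proof. exact: algD. Qed.
Lemma crossingM f g : crossing t f -> crossing t g -> crossing t (f * g).
Proof. exact: algM. Qed.
Lemma crossingZ c f : crossing t f -> crossing t (c *: f).
Proof. exact: algZ. Qed.
Lemma crossing_z i j : crossing t (Oz F i j). Proof. exact: alg_rz. Qed.
Lemma crossing_zV i j : t i != t j -> crossing t (OzV F i j). Proof. exact: alg_rzV. Qed.
Lemma crossing_deriv k f : crossing t f -> crossing t (Oderiv k f).
Proof. by rewrite /crossing Oval_deriv; apply: alg_rderiv. Qed.

Lemma crossing_inj f : injective t -> crossing t f.
Proof.
by move=> tI; apply: alg_sub (OvalP f) => i j; rewrite (inj_eq tI) neq_ltn => ->.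
Qed.

Let reg f : crossing t f -> regular t (Oval f).
Proof. exact: alg_regular. Qed.

Lemma OsubstD f g : crossing t f -> crossing t g ->
  Osubst t (f + g) = Osubst t f + Osubst t g.
Proof.
move=> tf tg; apply: Oval_inj; rewrite OvalD !Oval_subst ?OvalD ?rsubstD //; try exact: reg.
exact: crossingD.
Qed.
Lemma OsubstM f g : crossing t f -> crossing t g ->
  Osubst t (f * g) = Osubst t f * Osubst t g.
Proof.
move=> tf tg; apply: Oval_inj; rewrite OvalM !Oval_subst ?OvalM ?rsubstM //; try exact: reg.
exact: crossingM.
Qed.
Lemma OsubstZ c f : crossing t f -> Osubst t (c *: f) = c *: Osubst t f.
Proof.
move=> tf; apply: Oval_inj; rewrite OvalZ !Oval_subst ?OvalZ //; last exact: crossingZ.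
by rewrite -[c *: Oval f]/(_ * _) rsubstM ?rsubst_const //; [exact: regular_const|exact: reg].
Qed.
Lemma Osubst_z i j : Osubst t (Oz F i j) = Oz F (t i) (t j).
Proof. by apply: Oval_inj; rewrite Oval_subst ?rsubst_rz //; exact: crossing_z. Qed.
Lemma Osubst_zV i j : t i != t j -> Osubst t (OzV F i j) = OzV F (t i) (t j).
Proof. by move=> tij; apply: Oval_inj; rewrite Oval_subst ?rsubst_rzV //; exact: crossing_zV. Qed.
Lemma Osubst1 : Osubst t (1 : Ostar F m) = 1.
Proof.
apply: Oval_inj; rewrite Oval_subst; last exact: alg1.
by rewrite Oval1 -[1 in LHS](rpoly1 F) rsubst_poly psubst1 rpoly1.
Qed.
Lemma Oderiv_subst l f : crossing t f ->
  Oderiv l (Osubst t f) = \sum_(k | t k == l) Osubst t (Oderiv k f).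
Proof.
move=> tf; apply: Oval_inj; rewrite Oval_deriv Oval_subst //.
rewrite (rderiv_rsubst _ _ tf) //.
rewrite (big_morph _ (@OvalD n) (@Oval0 n)); apply: eq_bigr => k _.
have tdf := crossing_deriv k tf; by rewrite (Oval_subst tdf) Oval_deriv.
Qed.

End Crossing.
End Ostar.

Lemma OalgM (F : fieldType) n (P : rel 'I_n) (f g : Ostar F n) :
  alg P (Oval f) -> alg P (Oval g) -> alg P (Oval (f * g)).
Proof. by move=> Pf Pg; rewrite OvalM; apply: algM. Qed.

Lemma OscaleAl (F : fieldType) n c (f g : Ostar F n) : c *: (f * g) = (c *: f) * g.
Proof. by apply: Oval_inj; rewrite OvalZ !OvalM OvalZ !scaler_rconst mulrA. Qed.

(** Irreflexivity of P excludes the inverse of z_ii = 0, so that every function built along the way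
    lies in O^{*T}. *)
Lemma Oalg_ind (F : fieldType) n (P : rel 'I_n) (S : Ostar F n -> Prop) : irreflexive P ->
  (forall c, S (c *: (1 : Ostar F n))) -> (forall i j, S (Oz F i j)) -> (forall i j, P i j -> S (OzV F i j)) ->
  (forall f g, alg P (Oval f) -> S f -> alg P (Oval g) -> S g -> S (f + g)) ->
  (forall f g, alg P (Oval f) -> S f -> alg P (Oval g) -> S g -> S (f * g)) ->
  forall f, alg P (Oval f) -> S f.
Proof.
move=> irr Sc Sz SzV SD SM f; have [x Ex] : exists x, x = Oval f by exists (Oval f).
rewrite -Ex => Px; elim: Px f Ex => [c|i j|i j ij|y z Py IHy Pz IHz|y z Py IHy Pz IHz] f Ef.
- have -> : f = c *: (1 : Ostar F n) by apply: Oval_inj; rewrite -Ef OvalZ scaler_rconst Oval1 mulr1.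
  exact: Sc.
- have -> : f = Oz F i j by apply: Oval_inj; rewrite -Ef.
  exact: Sz.
- have -> : f = OzV F i j by apply: Oval_inj; rewrite -Ef.
  exact: SzV.
- have Ey := Oval_mkO (alg_Ostar irr Py); have Ez := Oval_mkO (alg_Ostar irr Pz).
  have -> : f = mkO y + mkO z by apply: Oval_inj; rewrite -Ef OvalD Ey Ez.
  by apply: SD; rewrite ?Ey ?Ez //; [apply: IHy|apply: IHz].
- have Ey := Oval_mkO (alg_Ostar irr Py); have Ez := Oval_mkO (alg_Ostar irr Pz).
  have -> : f = mkO y * mkO z by apply: Oval_inj; rewrite -Ef OvalM Ey Ez.
  by apply: SM; rewrite ?Ey ?Ez //; [apply: IHy|apply: IHz].
Qed.

Lemma Ostar_ind (F : fieldType) n (S : Ostar F n -> Prop) :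
  (forall c, S (c *: (1 : Ostar F n))) -> (forall i j, S (Oz F i j)) ->
  (forall i j : 'I_n, (i < j)%N -> S (OzV F i j)) ->
  (forall f g, S f -> S g -> S (f + g)) -> (forall f g, S f -> S g -> S (f * g)) ->
  forall f, S f.
Proof.
move=> Sc Sz SzV SD SM f.
apply: (Oalg_ind (P := fun i j => (i < j)%N) _ Sc Sz SzV) (OvalP f) => [i|g h _ Sg _|g h _ Sg _].
- by rewrite ltnn.
- exact: SD.
- exact: SM.
Qed.

(** * Polynomials in lambda *)

Definition agree_off n (A : 'I_n -> Type) (i : 'I_n) (w w' : forall j : 'I_n, A j) :=
  forall j : 'I_n, j != i -> w j = w' j.

(** * Multilinear evaluation of families of polynomials through commuting operators *)

Section Evaluation.
Variables (F : fieldType) (V W : lmodType F).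

Lemma fsum_mdeg N (H : 'X_{1..N} -> W) D : (forall mu, (D <= mdeg mu)%N -> H mu = 0) ->
  \sum_(mu \in [set: 'X_{1..N}]) H mu = \sum_(mu : 'X_{1..N < D}) H mu.
Proof.
move=> HD.
rewrite (fsbigE [seq bmnm mu | mu <- enum {: 'X_{1..N < D}}]) //=.
- by rewrite big_map big_enum_cond /=; apply: eq_bigl => mu; rewrite in_setT.
- by rewrite map_inj_uniq ?enum_uniq //; apply: val_inj.
move=> mu _; have [/HD //|muD] := leqP D (mdeg mu).
by case/mapP; exists (BMultinom muD); rewrite ?mem_enum.
Qed.

Section OpX.
Variables (N : nat) (T : 'I_N -> W -> W).
Hypothesis T_lin : forall k, linear (T k).
Hypothesis T_comm : forall k l x, T k (T l x) = T l (T k x).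

Lemma linear_op0 k : T k 0 = 0.
Proof. by have := T_lin k (-1) 0 0; rewrite scaler0 addr0 scaleN1r addNr. Qed.

Lemma opX_linear mu : linear (opX T mu).
Proof.
move=> c x y; rewrite /opX; elim: (enum _) => [//|k s /= ->].
elim: (mu k) => [//|r /= ->]; exact: T_lin.
Qed.

Lemma opX0 mu : opX T mu 0 = 0.
Proof. by have := opX_linear mu (-1) 0 0; rewrite scaler0 addr0 scaleN1r addNr. Qed.

Lemma opX_mnm0 x : opX T 0%MM x = x.
Proof. by rewrite /opX; elim: (enum _) => [//|k s /= ->]; rewrite mnm0E. Qed.

(** The extra factor [T k] arises at the place of k in the product over all indices; commutativity
    carries it to the front. *)
Lemma opXU mu k x : opX T (mu + U_(k))%MM x = T k (opX T mu x).
Proof.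
rewrite /opX; have : k \in enum 'I_N by rewrite mem_enum.
have : uniq (enum 'I_N) by exact: enum_uniq.
have iterC r l y : iter r (T l) (T k y) = T k (iter r (T l) y).
  by elim: r => [//|r /= ->]; rewrite T_comm.
have TC r l y : T l (T k y) = T k (T l y) by rewrite T_comm.
elim: (enum _) => [//|l s IH] /= /andP[ls us]; rewrite inE mnmDE mnm1E.
have [kl|kl] /= := eqVneq k l; last by rewrite addn0 => ks; rewrite IH // iterC.
subst l => _; rewrite addn1 /=; congr (T k (iter _ _ _)).
have {us IH TC iterC} : k \notin s by [].
elim: s {ls} => [//|j s IH] /=; rewrite inE negb_or => /andP[kj ks].
by rewrite IH // mnmDE mnm1E (negPf kj) addn0.
Qed.

End OpX.

Section MultiEvaluation.
Variables (N n : nat) (m : 'I_n -> nat) (rank : forall i, 'I_(m i) -> 'I_N).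
Hypothesis rank_inj : forall i a j b, rank (i := i) a = rank (i := j) b ->
  Tagged (fun i => 'I_(m i)) a = Tagged (fun i => 'I_(m i)) b.
Hypothesis rank_surj : forall k, exists i a, k = @rank i a.
Variables (T : 'I_N -> W -> W) (phi : ('I_n -> V) -> W).
Hypothesis T_lin : forall k, linear (T k).
Hypothesis T_comm : forall k l x, T k (T l x) = T l (T k x).
Hypothesis phi_lin : forall v i, linear (fun u => phi [eta v with i |-> u]).

Definition block (mu : 'X_{1..N}) i : 'X_{1..m i} := [multinom mu (rank a) | a < m i].

Local Notation fam := (forall i, VL V (m i)).
Implicit Types w : fam.

Definition evalterm w mu : W := opX T mu (phi (fun i => w i (block mu i))).
(* The expression of the composition formula: one lets the monomials in the values of the
   w_i act through the operators T and applies phi to the coefficients. *)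
Definition eval w : W := \sum_(mu \in [set: 'X_{1..N}]) evalterm w mu.

Lemma mlin_upd (v : 'I_n -> V) i : [eta v with i |-> v i] = v :> ('I_n -> V).
Proof. by apply/funext => j /=; case: eqP => [->|]. Qed.

Lemma multilinear0 v i : v i = 0 -> phi v = 0.
Proof.
move=> vi; rewrite -(mlin_upd v i) vi.
by have := phi_lin v i (-1) 0 0; rewrite scaler0 addr0 scaleN1r addNr.
Qed.

Lemma multilinear_at c v v' v'' i : v'' i = c *: v i + v' i ->
  (forall j, j != i -> v j = v' j) -> (forall j, j != i -> v'' j = v' j) ->
  phi v'' = c *: phi v + phi v'.
Proof.
move=> Ei E E'; rewrite -(mlin_upd v i) -(mlin_upd v' i) -(mlin_upd v'' i) Ei.
have U (u u' : 'I_n -> V) x : (forall j, j != i -> u j = u' j) ->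
    [eta u with i |-> x] = [eta u' with i |-> x] :> ('I_n -> V).
  by move=> uu'; apply/funext => j /=; case: eqP => // /eqP/uu'.
by rewrite (U v v' _ E) (U v'' v' _ E') phi_lin.
Qed.

Lemma mdeg_block mu : mdeg mu = (\sum_i mdeg (block mu i))%N.
Proof.
have /choice[g gK] k : exists s : {i & 'I_(m i)}, k = rank (tagged s).
  by have [i [a ->]] := rank_surj k; exists (Tagged (fun i => 'I_(m i)) a).
rewrite mdegE (reindex (fun s : {i & 'I_(m i)} => rank (tagged s))) /=; last first.
  exists g => [[i a] _|k _]; last by rewrite -gK.
  by have := gK (rank a); case: (g _) => j b /= /rank_inj H; symmetry; exact: H.
rewrite -(sig_big_dep (fun=> true) (fun _ => xpredT) (fun i a => mu (rank a))) /=.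
by apply: eq_bigr => i _; rewrite mdegE; apply: eq_bigr => a _; rewrite mnmE.
Qed.

(** A monomial of large total degree has large degree in some block, where the coefficient of w_i
    vanishes. So the sum in [eval] is finite. *)
Lemma evalterm_bound w : exists D, forall mu, (D <= mdeg mu)%N -> evalterm w mu = 0.
Proof.
have /choice[D HD] : forall i, exists D, forall mu : 'X_{1..m i}, (D <= mdeg mu)%N -> w i mu = 0.
  by move=> i; case: (w i) => f /= /asboolP.
exists (\sum_i D i).+1 => mu Dmu.
have [i Di] : exists i, (D i <= mdeg (block mu i))%N.
  apply/existsP; apply: contraTT Dmu; rewrite negb_exists => /forallP H.
  rewrite -ltnNge ltnS mdeg_block; apply: leq_sum => i _.
  by apply: ltnW; rewrite ltnNge.
by rewrite /evalterm (multilinear0 (i := i)) ?HD // opX0.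
Qed.

Lemma eval_fin w : exists D, forall D', (D <= D')%N ->
  eval w = \sum_(mu : 'X_{1..N < D'}) evalterm w mu.
Proof.
have [D HD] := evalterm_bound w; exists D => D' DD'.
by apply: fsum_mdeg => mu D'mu; apply: HD; apply: leq_trans D'mu.
Qed.

(** Together with [eval_const] and [eval_lam] this is a recursive description of [eval], matched by
    the induction principle [VLfam_ind]. *)
Lemma eval_lin c i w w' w'' : agree_off i w w' -> agree_off i w'' w' ->
  w'' i = c *: w i + w' i -> eval w'' = c *: eval w + eval w'.
Proof.
move=> E E' Ei; have [D HD] := eval_fin w; have [D' HD'] := eval_fin w'.
have [D'' HD''] := eval_fin w''; pose M := (D + (D' + D''))%N.
rewrite (HD M) ?(HD' M) ?(HD'' M) /M; try by lia.
rewrite scaler_sumr -big_split.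
apply: eq_bigr => mu _; rewrite /= -opX_linear //; congr (opX _ _ _).
apply: (multilinear_at (i := i)) => [|j ji|j ji]; first by rewrite Ei.
  by rewrite E.
by rewrite E'.
Qed.

Lemma eval_const v : eval (fun i => vconst (m i) (v i)) = phi v.
Proof.
rewrite /eval -(fsbig_widen [set 0%MM]) //; last first.
  move=> mu [_ /= /eqP mu0].
  have [k mk] : exists k, mu k != 0%N.
    apply/existsP; apply: contraNT mu0; rewrite negb_exists => /forallP H.
    by apply/eqP/mnmP => k; rewrite mnm0E; apply/eqP; have := H k; rewrite negbK.
  have [i [a Ek]] := rank_surj k.
  rewrite /evalterm (multilinear0 (i := i)) ?opX0 //=.
  case: eqP => // /mnmP/(_ a); rewrite mnmE mnm0E -Ek => mk0.
  by rewrite mk0 in mk.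
rewrite fsbig_set1 /evalterm opX_mnm0; congr phi; apply/funext => i /=.
case: eqP => // H; case: H; apply/mnmP => a.
by rewrite mnmE !mnm0E.
Qed.

(** The terms without the variable [rank a] vanish; on the others the shift of the exponents by
    [U_(rank a)] becomes one more factor [T (rank a)]. *)
Lemma eval_lam i a w w' : agree_off i w w' -> w' i = lam a (w i) ->
  eval w' = T (rank a) (eval w).
Proof.
move=> E Ei; rewrite /eval.
rewrite -(fsbig_widen [set mu : 'X_{1..N} | (0 < mu (rank a))%N]) //; last first.
  move=> mu [_ /= /negP mk0]; rewrite /evalterm (multilinear0 (i := i)) ?opX0 //.
  by rewrite Ei /= mnmE (negPf mk0).
rewrite (reindex_fsbig (fun mu => (mu + U_(rank a))%MM) setT); last first.
  split=> [mu _|mu mu' _ _|mu /= mk].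
  - by rewrite /= mnmDE mnm1E eqxx addn1.
  - exact: addIm.
  - by exists (mu - U_(rank a))%MM => //; rewrite submK // lep1mP -lt0n.
have [D HD] := evalterm_bound w.
have TE mu : evalterm w' (mu + U_(rank a))%MM = T (rank a) (evalterm w mu).
  rewrite /evalterm opXU //; congr (T _ (opX _ _ (phi _))); apply/funext => j.
  have [->|ji] := eqVneq j i.
    rewrite Ei /= mnmE mnmDE mnm1E eqxx addn1 /=; congr (w i _); apply/mnmP => b.
    rewrite !mnmE; have [->|ab] := eqVneq a b; first by rewrite eqxx addnK.
    rewrite subn0 (_ : rank a == rank b = false) ?addn0 //.
    by apply: contraNF ab => /eqP/rank_inj/eqP; rewrite -tag_eqE /tag_eq eqxx tagged_asE.
  rewrite -E //; congr (w j _); apply/mnmP => b; rewrite !mnmE.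
  rewrite (_ : rank a == rank b = false) ?addn0 //.
  apply: contraNF ji => /eqP/rank_inj/(congr1 tag) /= ->; exact: eqxx.
rewrite (eq_fsbigr (fun mu => T (rank a) (evalterm w mu))) => [|mu _]; last exact: TE.
rewrite (@fsum_mdeg _ (fun mu => T _ (evalterm w mu)) D) => [|mu /HD ->]; last by rewrite linear_op0.
rewrite (@fsum_mdeg _ (evalterm w) D) //.
rewrite (big_morph (T (rank a)) (id1 := 0) (op1 := +%R)) ?linear_op0 //; last first.
  by move=> x y; have := T_lin (rank a) 1 x y; rewrite !scale1r.
Qed.

End MultiEvaluation.
End Evaluation.

Section VLInduction.
Variables (F : fieldType) (V : lmodType F).

Lemma VL_ind n (S : VL V n -> Prop) :
  (forall v, S (vconst n v)) -> (forall p q, S p -> S q -> S (p + q)) ->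
  (forall a p, S p -> S (lam a p)) -> forall p, S p.
Proof.
move=> Sc SD Sl.
have mono_proof (mu : 'X_{1..n}) (v : V) :
    (fun nu : 'X_{1..n} => if nu == mu then v else 0) \in @bounded_degree F V n.
  apply/asboolP; exists (mdeg mu).+1 => nu; case: eqP => [->|//]; by rewrite ltnn.
pose mono mu v := MkVL (mono_proof mu v).
have S0 : S 0.
  have <- : vconst n (0 : V) = 0 by apply: VLP => nu /=; rewrite if_same.
  exact: Sc.
have Sm mu v : S (mono mu v).
  have [D] := ubnP (mdeg mu); elim: D mu => [//|D IH] mu Dmu.
  have [->|mu0] := eqVneq mu 0%MM.
    have -> : mono 0%MM v = vconst n v by apply: VLP.
    exact: Sc.
  have [k mk] : exists k, (0 < mu k)%N.
    apply/existsP; apply: contraNT mu0; rewrite negb_exists => /forallP H.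
    by apply/eqP/mnmP => k; rewrite mnm0E; apply/eqP; rewrite eqn0Ngt.
  have kmu : (U_(k) <= mu)%MM by rewrite lep1mP -lt0n.
  have -> : mono mu v = lam k (mono (mu - U_(k))%MM v).
    apply: VLP => nu /=; have [nk|nk] := posnP (nu k).
      by case: eqP => // E; rewrite -E nk in mk.
    have knu : (U_(k) <= nu)%MM by rewrite lep1mP -lt0n.
    congr (if _ then _ else _); apply/eqP/eqP => [-> //|E].
    by rewrite -(submK knu) E submK.
  apply/Sl/IH; move: Dmu; rewrite -{1}(submK kmu) mdegD mdeg1 addn1 ltnS.
  exact: leq_trans.
move=> p; have [D HD] : exists D, forall mu, (D <= mdeg mu)%N -> p mu = 0.
  by case: p => f /= /asboolP.
have -> : p = \sum_(mu : 'X_{1..n < D}) mono mu (p mu).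
  apply: VLP => nu.
  rewrite (big_morph (fun q : VL V n => q nu) (id1 := 0) (op1 := +%R)) //.
  have [nuD|nuD] := ltnP (mdeg nu) D; last first.
    rewrite HD // big1 // => mu _ /=; case: eqP => // E.
    by have := bmdeg mu; rewrite -E ltnNge nuD.
  rewrite (bigD1 (BMultinom nuD)) //= eqxx big1 ?addr0 // => mu muD.
  by case: eqP => //= E; case/eqP: muD; apply: val_inj.
by apply: big_ind => //.
Qed.

Lemma VLfam_ind n (m : 'I_n -> nat) (S : (forall i, VL V (m i)) -> Prop) :
  (forall v, S (fun i => vconst (m i) (v i))) ->
  (forall (i : 'I_n) (w w' w'' : forall j : 'I_n, VL V (m j)), agree_off i w w' -> agree_off i w'' w' -> w'' i = w i + w' i ->
    S w -> S w' -> S w'') ->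
  (forall (i : 'I_n) a (w w' : forall j : 'I_n, VL V (m j)), agree_off i w w' -> w' i = lam a (w i) -> S w -> S w') ->
  forall w, S w.
Proof.
move=> Sc SD Sl w.
(* The slots outside [s] are constant; those in [s] are opened one at a time by [VL_ind]. *)
suff H (s : seq 'I_n) : forall w, (forall i, i \notin s -> exists v, w i = vconst (m i) v) -> S w.
 by apply: (H (enum 'I_n)) => i; rewrite mem_enum.
elim: s {w} => [|i s IH] w Hw.
  have /choice[v Ev] : forall i, exists v, w i = vconst (m i) v by move=> i; apply: Hw.
  have -> : w = fun i => vconst (m i) (v i) by apply: functional_extensionality_dep.
  exact: Sc.
have off (p q : VL V (m i)) : agree_off i (dfwith w p) (dfwith w q).
  by move=> j ji; rewrite !dfwith_out // eq_sym.
have -> : w = dfwith w (w i).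
  by apply: functional_extensionality_dep => j; case: dfwithP.
elim/VL_ind: (w i) => [v|p q Sp Sq|a p Sp].
- apply: IH => j js; have [<-|ij] := eqVneq i j; first by exists v; rewrite dfwith_in.
  by rewrite dfwith_out //; apply: Hw; rewrite inE eq_sym (negPf ij).
- by apply: (SD i _ _ _ _ _ _ Sp Sq) => //; rewrite !dfwith_in.
- by apply: (Sl i a _ _ _ _ Sp) => //; rewrite !dfwith_in.
Qed.
End VLInduction.

(** * Operators on polynomials modulo d + lambda_1 + ... + lambda_n *)

Section QuotientOperators.
Variables (F : fieldType) (V : lmodType F) (d : {linear V -> V}).

Lemma cmapD n (A : {linear V -> V}) (p q : VL V n) : cmap A (p + q) = cmap A p + cmap A q.
Proof. exact: linearD. Qed.
Lemma lamD n k (p q : VL V n) : lam k (p + q) = lam k p + lam k q.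
Proof. exact: linearD. Qed.
Lemma lamB n k (p q : VL V n) : lam k (p - q) = lam k p - lam k q.
Proof. exact: linearB. Qed.
Lemma dlamD n k (p q : VL V n) : dlam k (p + q) = dlam k p + dlam k q.
Proof. exact: linearD. Qed.

Lemma cmap_const n (A : {linear V -> V}) v : cmap A (vconst n v) = vconst n (A v).
Proof. by apply: VLP => mu /=; case: ifP => // _; rewrite linear0. Qed.

Lemma dlam_const n k (v : V) : dlam k (vconst n v) = 0.
Proof.
apply: VLP => mu /=; case: eqP => [/mnmP/(_ k)|]; last by rewrite mul0rn.
by rewrite mnmDE mnm1E eqxx mnm0E addn1.
Qed.

Lemma vconst_linear n : linear (@vconst F V n).
Proof.
move=> c u v; apply: VLP => mu; rewrite vcoefP /=.
by case: ifP => // _; rewrite scaler0 addr0.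
Qed.

Section Lsubst.
Variables (m n : nat) (t : 'I_m -> 'I_n).
Implicit Types (p q : VL V n).
Local Notation T := (fun (i : 'I_n) (u : VL V m) => \sum_(k | t k == i) lam k u).

Let T_lin i : linear (T i).
Proof.
move=> c x y /=; rewrite scaler_sumr -big_split; apply: eq_bigr => k _.
exact: linearP.
Qed.
Let T_comm i j x : T i (T j x) = T j (T i x).
Proof.
rewrite /= [RHS](eq_bigr (fun k => \sum_(l | t l == i) lam k (lam l x))) => [|k _].
  rewrite exchange_big; apply: eq_bigr => l _ /=; rewrite linear_sum.
  by apply: eq_bigr => k _; rewrite lamC.
by rewrite linear_sum.
Qed.

(** Substitution of the lambda_i is the evaluation with a single block containing all n
    variables. *)
Let rank (_ : 'I_1) (a : 'I_n) := a.
Let phi (v : 'I_1 -> V) := vconst m (v ord0).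

Let rank_inj i a j b : rank i a = rank j b ->
  existT (fun _ : 'I_1 => 'I_n) i a = existT _ j b.
Proof. by rewrite /rank (ord1 i) (ord1 j) => ->. Qed.
Let rank_surj k : exists i a, k = rank i a.
Proof. by exists ord0, k. Qed.
Let phi_lin v i : linear (fun u => phi [eta v with i |-> u]).
Proof. by move=> c x y; rewrite /phi /= (ord1 i) eqxx vconst_linear. Qed.

Let lsubst_eval (p : VL V n) : lsubst t p = eval (m := fun=> n) rank T phi (fun=> p).
Proof.
apply: eq_fsbigr => mu _; rewrite /evalterm /phi; congr (opX _ _ (vconst _ (p _))).
by apply/mnmP => a; rewrite mnmE.
Qed.

Lemma lsubst_linear : linear (@lsubst F V m n t).
Proof.
move=> c p q; rewrite !lsubst_eval.
by apply: (eval_lin rank_inj rank_surj T_lin phi_lin (i := ord0)) => // j; rewrite (ord1 j).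
Qed.
HB.instance Definition _ := GRing.isLinear.Build F (VL V n) (VL V m) *:%R (@lsubst F V m n t)
  lsubst_linear.

Lemma lsubstD p q : lsubst t (p + q) = lsubst t p + lsubst t q. Proof. exact: linearD. Qed.
Lemma lsubstB p q : lsubst t (p - q) = lsubst t p - lsubst t q. Proof. exact: linearB. Qed.
Lemma lsubstMn p k : lsubst t (p *+ k) = lsubst t p *+ k. Proof. exact: linearMn. Qed.

Lemma lsubst_const (v : V) : lsubst t (vconst n v) = vconst m v.
Proof. by rewrite lsubst_eval (eval_const rank_surj T_lin phi_lin (fun=> v)). Qed.

Lemma lsubst_lam a p : lsubst t (lam a p) = \sum_(k | t k == a) lam k (lsubst t p).
Proof.
rewrite !lsubst_eval.
apply: (eval_lam rank_inj rank_surj T_lin T_comm phi_lin (i := ord0)) => // j.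
by rewrite (ord1 j).
Qed.

Lemma lsubst_cmap (A : {linear V -> V}) p : lsubst t (cmap A p) = cmap A (lsubst t p).
Proof.
elim/VL_ind: p => [v|p q Ep Eq|a p Ep].
- by rewrite cmap_const !lsubst_const cmap_const.
- by rewrite cmapD !lsubstD cmapD Ep Eq.
- rewrite cmap_lam !lsubst_lam linear_sum; apply: eq_bigr => k _.
  by rewrite Ep -cmap_lam.
Qed.

Lemma lsubst_dlamsum p : lsubst t (dlamsum d p) = dlamsum d (lsubst t p).
Proof.
rewrite /dlamsum lsubstD lsubst_cmap; congr (_ + _).
rewrite linear_sum (partition_big t xpredT) //=; apply: eq_bigr => i _.
exact: lsubst_lam.
Qed.

Lemma dlam_lsubst k p : dlam k (lsubst t p) = lsubst t (dlam (t k) p).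
Proof.
elim/VL_ind: p => [v|p q Ep Eq|a p Ep].
- by rewrite lsubst_const !dlam_const linear0.
- by rewrite dlamD !lsubstD dlamD Ep Eq.
rewrite lsubst_lam dlam_lam lsubstD lsubst_lam linear_sum -Ep.
rewrite (eq_bigr (fun l => lam l (dlam k (lsubst t p)) + lsubst t p *+ (k == l))); last first.
  by move=> l _; rewrite -dlam_lam.
rewrite big_split /=; congr (_ + _); rewrite lsubstMn.
have [<-|ka] := eqVneq (t k) a.
  rewrite (bigD1 k) //= eqxx big1 ?addr0 // => l /andP[_ /negPf lk].
  by rewrite eq_sym lk.
by rewrite big1 // => l /eqP tl; case: eqP => // kl; rewrite kl tl eqxx in ka.
Qed.

End Lsubst.

Local Notation Q n := (Q n d).
Implicit Types (n : nat).

Lemma cls_dlamsum n (p : VL V n) : cls (dlamsum d p) = 0 :> Q n.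
Proof.
rewrite -(linear0 (@cls F (VL V n) (@dlam_pred F V n d))).
by apply/cls_eq; rewrite subr0; apply/asboolP; exists p.
Qed.

Lemma Q_ind n (S : Q n -> Prop) : (forall p, S (cls p)) -> forall q, S q.
Proof. by move=> H q; rewrite -(repK q). Qed.

(** Operators given on chosen representatives may be computed on any representative once they
    commute with multiplication by d + lambda_1 + ... + lambda_n. A single d/dlambda_i does not
    commute with it, a difference of two does. *)
Lemma cls_rep_op n (k : nat) (A : VL V n -> VL V k) (p : VL V n) : linear A ->
  (forall q, A (dlamsum d q) = dlamsum d (A q)) ->
  cls (A (rep (cls p : Q n))) = cls (A p) :> Q k.
Proof.
move=> linA Ad; apply/cls_eq.
have AB x y : A (x - y) = A x - A y.
  by rewrite addrC -scaleN1r linA scaleN1r addrC.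
have /asboolP[q Eq] : rep (cls p : Q n) - p \in @dlam_pred F V n d by exact: rep_cls.
rewrite -AB Eq Ad.
by apply/asboolP; exists (A q).
Qed.

Lemma qlamE n k (p : VL V n) : qlam k (cls p : Q n) = cls (lam k p).
Proof.
apply: cls_rep_op => [|q]; first exact: linearP.
rewrite /dlamsum lamD linear_sum cmap_lam; congr (_ + _).
by apply: eq_bigr => l _; rewrite lamC.
Qed.

Lemma qdiffE n i j (p : VL V n) : qdiff i j (cls p : Q n) = cls (dlam i p - dlam j p).
Proof.
apply: (cls_rep_op (A := fun p => dlam i p - dlam j p)) => [c x y|q].
  by rewrite (dlam_linear i c x y) (dlam_linear j c x y) scalerBr opprD addrACA.
by rewrite !dlam_dlamsum linearB opprD addrACA subrr addr0.
Qed.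

Lemma qsubstE m n (t : 'I_m -> 'I_n) (p : VL V n) : qsubst t (cls p : Q n) = cls (lsubst t p).
Proof. by apply: cls_rep_op; [exact: lsubst_linear|exact: lsubst_dlamsum]. Qed.

Lemma qsubst_linear m n (t : 'I_m -> 'I_n) : linear (@qsubst F V d m n t).
Proof.
by move=> c; elim/Q_ind => p; elim/Q_ind => q; rewrite -linearP !qsubstE -linearP -linearP.
Qed.
HB.instance Definition _ m n t := GRing.isLinear.Build F (Q n) (Q m) *:%R (@qsubst F V d m n t)
  (@qsubst_linear m n t).

Lemma qsubst_lam m n (t : 'I_m -> 'I_n) i (q : Q n) :
  qsubst t (qlam i q) = \sum_(k | t k == i) qlam k (qsubst t q).
Proof.
elim/Q_ind: q => p; rewrite qlamE !qsubstE lsubst_lam linear_sum.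
by apply: eq_bigr => k _; rewrite qlamE.
Qed.

Lemma qdiff_subst m n (t : 'I_m -> 'I_n) k l (q : Q n) :
  qdiff k l (qsubst t q) = qsubst t (qdiff (t k) (t l) q).
Proof.
by elim/Q_ind: q => p; rewrite qdiffE !qsubstE qdiffE !dlam_lsubst lsubstB.
Qed.

Lemma qlamD n k (p q : Q n) : qlam k (p + q) = qlam k p + qlam k q. Proof. exact: linearD. Qed.
Lemma qlamB n k (p q : Q n) : qlam k (p - q) = qlam k p - qlam k q. Proof. exact: linearB. Qed.
Lemma qlamP n k c (p q : Q n) : qlam k (c *: p + q) = c *: qlam k p + qlam k q.
Proof. exact: linearP. Qed.
Lemma qlam0 n k : qlam k (0 : Q n) = 0. Proof. exact: linear0. Qed.
Lemma qdiffD n i j (p q : Q n) : qdiff i j (p + q) = qdiff i j p + qdiff i j q.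
Proof. exact: linearD. Qed.
Lemma qdiffB n i j (p q : Q n) : qdiff i j (p - q) = qdiff i j p - qdiff i j q.
Proof. exact: linearB. Qed.

Lemma qlamC n k l (q : Q n) : qlam k (qlam l q) = qlam l (qlam k q).
Proof. by elim/Q_ind: q => p; rewrite !qlamE lamC. Qed.

Lemma qdiffii n i (q : Q n) : qdiff i i q = 0.
Proof. by elim/Q_ind: q => p; rewrite qdiffE subrr linear0. Qed.

Lemma qdiff_lam n i j k (q : Q n) :
  qdiff i j (qlam k q) = qlam k (qdiff i j q) + ((i == k)%:R - (j == k)%:R) *: q.
Proof.
elim/Q_ind: q => p; rewrite qdiffE !qlamE qdiffE !dlam_lam.
rewrite -linearZ -linearD; congr cls; rewrite -!scaler_nat lamB scalerBl.
by rewrite opprD addrACA.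
Qed.

End QuotientOperators.

(** * Pole filtration and graphs *)

Section Filtration.
Variables (F : fieldType) (n : nat).
Implicit Types (x y : ratfun F n) (i j k : 'I_n) (e : 'I_n * 'I_n) (E : {set 'I_n * 'I_n}).

Definition poles E : rel 'I_n := fun i j => (i, j) \in E.

Lemma OfilD r x y : Ofil r x -> Ofil r y -> Ofil r (x + y).
Proof.
move=> [xs Hx ->] [ys Hy ->]; exists (xs ++ ys); last by rewrite big_cat.
by move=> z; rewrite mem_cat => /orP[/Hx|/Hy].
Qed.

Lemma Ofil0 r : @Ofil F n r 0.
Proof. by exists [::] => //; rewrite big_nil. Qed.

Lemma Ofil_sum (r : nat) (I : Type) (s : seq I) (P : pred I) (f : I -> ratfun F n) :
  (forall l, P l -> Ofil r (f l)) -> Ofil r (\sum_(l <- s | P l) f l).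
Proof. by move=> H; apply: big_ind => //; [exact: Ofil0|exact: OfilD]. Qed.

Lemma piece_Ofil r x : Ofil_piece r x -> Ofil r x.
Proof. by move=> rx; exists [:: x] => [y|]; rewrite ?big_seq1 // inE => /eqP ->. Qed.

Definition tadpole_free E := forall i, (i, i) \notin E.

Lemma poles_irr E : tadpole_free E -> irreflexive (poles E).
Proof. by move=> Eirr i; apply/negbTE/Eirr. Qed.

Lemma alg_piece E r x : tadpole_free E -> (#|E| <= r)%N -> alg (poles E) x -> Ofil_piece r x.
Proof.
move=> Eirr Er Ex.
(* The filtration lists polar divisors with i < j; reversing an edge only changes a sign. *)
exists [seq if (e.1 < e.2)%N then e else (e.2, e.1) | e <- enum E].
  by rewrite size_map -cardE.
elim: Ex => [c|i j|i j ij|y z _ Py _ Pz|y z _ Py _ Pz].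
- exact: gen_const.
- have H (a b : 'I_n) s : (a < b)%N -> gen_alg (@Ofil_gen F n s) (rz F a b).
    by move=> ab; apply: gen_in; exists a, b; split=> //; left.
  have [/H //|ji|/val_inj ->] := ltngtP i j; last first.
    by rewrite rzii -rpoly0; apply: (gen_const _ 0).
  rewrite rz_opp -scaleN1r; apply: gen_mul (gen_const _ _) (H _ _ _ ji).
- have [ltij|ltji|/val_inj Eij] := ltngtP i j.
  + apply: gen_in; exists i, j; split=> //; right; split=> //.
    by apply/mapP; exists (i, j); rewrite ?mem_enum //= ltij.
  + rewrite rz_opp invrN -scaleN1r; apply: gen_mul (gen_const _ _) _.
    apply: gen_in; exists j, i; split=> //; right; split=> //.
    by apply/mapP; exists (i, j); rewrite ?mem_enum //= ltnNge ltnW.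
  + by move: ij; rewrite Eij /poles (negPf (Eirr j)).
- exact: gen_add.
- exact: gen_mul.
Qed.

Lemma piece_alg r x : Ofil_piece r x ->
  exists E, [/\ tadpole_free E, (#|E| <= r)%N & alg (poles E) x].
Proof.
move=> [s sr gx]; exists [set e in s | (e.1 < e.2)%N]; split.
- by move=> i; rewrite inE ltnn andbF.
- apply: leq_trans sr; apply: leq_trans (card_size s); apply: subset_leq_card.
  by apply/fintype.subsetP => e; rewrite inE => /andP[].
elim: gx => [y [i [j [ij [->|[sij ->]]]]]|c|y z _ Py _ Pz|y z _ Py _ Pz].
- exact: alg_rz.
- by apply: alg_rzV; rewrite /poles inE sij.
- exact: alg_const.
- exact: algD.
- exact: algM.
Qed.

Lemma piece_Ostar r x : Ofil_piece r x -> x \in @Ostar_pred F n.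
Proof. by case/piece_alg => E [Eirr _]; apply: alg_Ostar; apply: poles_irr. Qed.

Lemma Ofil_ind r (S : Ostar F n -> Prop) : S 0 -> (forall f g, S f -> S g -> S (f + g)) ->
  (forall f, Ofil_piece r (Oval f) -> S f) -> forall f, Ofil r (Oval f) -> S f.
Proof.
move=> S0 SD SP f [xs Hxs Ef].
have -> : f = \sum_(y <- xs) mkO y.
  apply: Oval_inj; rewrite Ef (big_morph _ (@OvalD F n) (@Oval0 F n)).
  by rewrite !big_seq; apply: eq_bigr => y /Hxs/piece_Ostar/Oval_mkO.
rewrite big_seq; apply: big_ind => // y /Hxs ry; apply: SP.
by rewrite Oval_mkO //; apply: piece_Ostar ry.
Qed.

Lemma Ofil_le r r' x : (r <= r')%N -> Ofil r x -> Ofil r' x.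
Proof.
move=> rr' [xs Hxs ->]; exists xs => // y /Hxs [s sr gy]; exists s => //.
exact: leq_trans rr'.
Qed.

Definition mono E (K : 'I_n * 'I_n -> nat) : ratfun F n :=
  \prod_(e in E) (rz F e.1 e.2)^-1 ^+ K e.

Lemma alg_mono E x : tadpole_free E -> alg (poles E) x ->
  exists N a, alg (fun _ _ => false) a /\ x = a * mono E (fun=> N).
Proof.
move=> Eirr Ex; have [N Na] := alg_localize (poles_irr Eirr) Ex.
exists N, (x * denom F (poles E) ^+ N); split=> //.
have -> : mono E (fun=> N) = (denom F (poles E) ^+ N)^-1.
  rewrite /mono /denom -exprVn -prodfV -prodrXl; apply: eq_bigl => -[i j] //.
by rewrite mulfK // expf_neq0 // denom_neq0 //; apply: poles_irr.
Qed.

Lemma alg_monoE E K : alg (poles E) (mono E K).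
Proof. by apply: alg_prod => -[i j] ij; apply/algX/alg_rzV. Qed.

Lemma alg_poly P a : alg (fun _ _ : 'I_n => false) a -> @alg F n P a.
Proof. exact: alg_sub. Qed.

Lemma eq_mono E K K' : {in E, K =1 K'} -> mono E K = mono E K'.
Proof. by move=> KK'; apply: eq_bigr => e /KK' ->. Qed.

Lemma monoS E K e : e \in E ->
  mono E (fun e' => K e' + (e' == e))%N = (rz F e.1 e.2)^-1 * mono E K.
Proof.
move=> eE; rewrite /mono (bigD1 e) //= [in RHS](bigD1 e) //= eqxx addn1 exprS -mulrA.
by congr (_ * (_ * _)); apply: eq_bigr => e' /andP[_ /negPf ->]; rewrite addn0.
Qed.

(* Partial fractions: 1 = \sum_(e != e1) c_e z_e / z_e1 trades the poles other than e1
   for higher poles at e1, until one of them disappears. *)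
Lemma dependent_Ofil E e1 (c : 'I_n * 'I_n -> F) x : tadpole_free E -> e1 \in E ->
  rz F e1.1 e1.2 = \sum_(e in E :\ e1) c e *: rz F e.1 e.2 ->
  alg (poles E) x -> Ofil #|E|.-1 x.
Proof.
move=> Eirr e1E dep /(alg_mono Eirr)[N [a [Pa ->]]].
have z0 e : e \in E -> rz F e.1 e.2 != 0.
  by case: e => i j ij; apply: rz_neq0; apply: contraTneq ij => /= ->; apply: Eirr.
move: (fun=> N) => K {N}.
have [s] := ubnP (\sum_(e in E :\ e1) K e)%N; elim: s K => [//|s IH] K Ks.
have [/exists_inP[e2 Ee2 /eqP K0]|] := boolP [exists e in E :\ e1, K e == 0%N].
  move: Ee2; rewrite !inE => /andP[_ e2E].
  apply/piece_Ofil/(alg_piece (E := E :\ e2)).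
  - by move=> i; rewrite !inE negb_and (negPf (Eirr i)) orbT.
  - by rewrite (cardsD1 e2 E) e2E.
  apply: algM (alg_poly _ Pa) _; rewrite /mono (bigD1 e2) //= K0 expr0 mul1r.
  by apply: alg_prod => -[i j] /andP[ijE ij]; apply/algX/alg_rzV; rewrite /poles !inE ij.
rewrite negb_exists_in => /forall_inP K0.
have -> : a * mono E K = \sum_(e in E :\ e1)
    (c e *: a) * mono E (fun e' => (K e' - (e' == e)) + (e' == e1))%N.
  rewrite -[LHS]mul1r -(divff (z0 _ e1E)) {1}dep -!mulrA mulr_suml; apply: eq_bigr => e Ee.
  have /[!inE]/andP[ee1 eE] := Ee; rewrite monoS //.
  have -> : mono E K = (rz F e.1 e.2)^-1 * mono E (fun e' => K e' - (e' == e))%N.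
    rewrite -monoS //; apply: eq_mono => e' _; rewrite subnK //.
    by case: eqP => // ->; rewrite lt0n K0.
  rewrite !scaler_rconst -!mulrA; congr (_ * _).
  rewrite (mulrCA a (rz F e.1 e.2)^-1) (mulrCA (rz F e1.1 e1.2)^-1) mulVKf ?z0 //.
  by rewrite mulrCA.
apply: Ofil_sum => e Ee; have /[!inE]/andP[ee1 eE] := Ee.
rewrite scaler_rconst -mulrA; case: (IH (fun e' => (K e' - (e' == e)) + (e' == e1))%N).
  apply: leq_trans (_ : (\sum_(e in E :\ e1) K e <= s)%N); last by [].
  rewrite (bigD1 e) //= [in X in (_ < X)%N](bigD1 e) //= eqxx (negPf ee1) addn0.
  rewrite -addSn leq_add //; first by rewrite subn1 prednK // lt0n K0.
  apply: leq_sum => e' /andP[/[!inE]/andP[/negPf -> _] /negPf ->].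
  by rewrite subn0 addn0.
move=> xs Hxs Exs; exists [seq rconst n (c e) * y | y <- xs].
  move=> _ /mapP[y /Hxs[s' s'r gy] ->]; exists s' => //.
  exact: gen_mul (gen_const _ _) gy.
by rewrite big_map -mulr_sumr -Exs.
Qed.

End Filtration.

(** * Paths, components and bridges in graphs *)

Section GraphTheory.
Variable n : nat.
Implicit Types (G : graph n) (i j k : 'I_n) (e : 'I_n * 'I_n).

Lemma graphP G G' : mult G =1 mult G' -> G = G'.
Proof.
case: G G' => [g tg] [g' tg'] /= /ffunP E; subst g'.
by congr Graph; apply: bool_irrelevance.
Qed.

Lemma mult_tadpole G i : mult G (i, i) = 0%N.
Proof. by case: G => g /= /forallP/(_ i)/eqP. Qed.

Lemma mult_mkgraph (f : 'I_n -> 'I_n -> nat) e :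
  mult (mkgraph f) e = if e.1 == e.2 then 0%N else f e.1 e.2.
Proof. by rewrite /mkgraph /= ffunE. Qed.

Lemma mult_remove G e e' : mult (remove_edge G e) e' = (mult G e' - (e' == e))%N.
Proof.
case: e' => i j; rewrite mult_mkgraph /=; case: eqP => // ->.
by rewrite mult_tadpole.
Qed.

Definition esupp G : {set 'I_n * 'I_n} := [set e | (0 < mult G e)%N].

Lemma esupp_tadpole G : tadpole_free (esupp G).
Proof. by move=> i; rewrite inE mult_tadpole. Qed.

Lemma nedgesE G : nedges G = (\sum_(e in esupp G) mult G e)%N.
Proof.
rewrite /nedges (bigID (mem (esupp G))) /= [X in (_ + X)%N]big1 ?addn0 // => e.
by rewrite inE lt0n negbK => /eqP.
Qed.

Lemma card_esupp G : (#|esupp G| <= nedges G)%N.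
Proof. by rewrite nedgesE -sum1_card leq_sum // => e; rewrite inE. Qed.

Lemma card_esupp_lt G e : (1 < mult G e)%N -> (#|esupp G| < nedges G)%N.
Proof.
move=> e1; have eG : e \in esupp G by rewrite inE ltnW.
rewrite nedgesE -sum1_card (bigD1 e) //= [in X in (_ < X)%N](bigD1 e) //= -addSn leq_add //.
by rewrite leq_sum // => e' /andP[]; rewrite inE.
Qed.

Lemma nedges_remove G e : (0 < mult G e)%N -> nedges G = (nedges (remove_edge G e)).+1.
Proof.
move=> e0; rewrite /nedges (bigD1 e) //= [in RHS](bigD1 e) //= mult_remove eqxx.
rewrite -addSn subn1 prednK //; congr (_ + _)%N; apply: eq_bigr => e' /negPf ee'.
by rewrite mult_remove ee' subn0.
Qed.

Definition adj G : rel 'I_n := fun i j => ((i, j) \in esupp G) || ((j, i) \in esupp G).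

Lemma adj_sym G : ssrbool.symmetric (adj G). Proof. by move=> i j; rewrite /adj orbC. Qed.

Lemma walk_connect G s i j : walk i s j -> (forall a : step n, a \in s -> a.1 \in esupp G) ->
  connect (adj G) i j.
Proof.
elim: s i => [i /eqP -> _|a s IH i /= /andP[/eqP <- sj] H]; first exact: connect0.
apply: connect_trans (IH _ sj _); last by move=> b bs; apply: H; rewrite inE bs orbT.
apply: connect1; have := H a (mem_head _ _).
case: a {H sj} => -[x y] [] /=; rewrite /adj /step_src /step_tgt /= => ->; by rewrite ?orbT.
Qed.

Lemma upath_esupp G s i j : upath G i s j -> forall a : step n, a \in s -> a.1 \in esupp G.
Proof.
case/andP=> _ /forallP H a aS; rewrite inE; apply: leq_trans (H a.1).
by rewrite -has_count; apply/hasP; exists a.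
Qed.

(** A path without repeated vertices repeats no edge: its first vertex is an endpoint of the first
    edge and does not occur later. *)
Lemma path_upath G i p : path (adj G) i p -> uniq (i :: p) ->
  exists s, upath G i s (last i p).
Proof.
move=> pp up.
suff [s [sw sH sc]] : exists s, [/\ walk i s (last i p),
    (forall a : step n, a \in s -> [/\ a.1 \in esupp G, a.1.1 \in i :: p & a.1.2 \in i :: p]) &
    forall e, (count (fun a : step n => a.1 == e) s <= 1)%N].
  exists s; rewrite /upath sw; apply/forallP => e.
  have [|] := boolP (has (fun a : step n => a.1 == e) s).
    by case/hasP=> a /sH[+ _ _] /eqP <-; rewrite inE; apply: leq_trans.
  by rewrite has_count -leqNgt leqn0 => /eqP ->.
elim: p i pp up => [i _ _|j p IH i /= /andP[aij pp] /andP[ip up]].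
  by exists [::]; split=> //=.
have [s [sw sH sc]] := IH j pp up.
have [a [aG asrc atgt aends]] : exists a : step n, [/\ a.1 \in esupp G, step_src a = i,
    step_tgt a = j & (a.1 == (i, j)) || (a.1 == (j, i))].
  by case/orP: aij => ij; [exists ((i, j), true)|exists ((j, i), false)];
     split=> //=; rewrite eqxx ?orbT.
have is_ b : b \in s -> a.1 != b.1.
  move=> /sH[_ b1 b2]; apply: contraNneq ip => ab.
  by case/orP: aends; rewrite ab => /eqP Eb; move: b1 b2; rewrite Eb.
exists (a :: s); split=> [|b|e] /=.
- by rewrite asrc atgt eqxx.
- rewrite inE => /orP[/eqP ->|/sH[-> b1 b2]].
    by split=> //; case/orP: aends => /eqP -> /=; rewrite !inE eqxx ?orbT.
  by split=> //; rewrite inE ?b1 ?b2 orbT.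
have [ae|ae] /= := eqVneq a.1 e; last exact: sc.
rewrite (@eq_in_count _ _ pred0) ?count_pred0 // => b bs /=.
by rewrite -ae eq_sym; apply/negbTE/is_.
Qed.

Lemma connectedP G i j : connected G i j <-> connect (adj G) i j.
Proof.
split=> [[s us]|/connectP[p pp ->]].
  by apply: (walk_connect (s := s)); [case/andP: us|exact: upath_esupp us].
by have [p' pp' up' _] := shortenP pp; apply: path_upath.
Qed.

Lemma asbool_connected G i j : `[< connected G i j >] = connect (adj G) i j.
Proof. by apply/asboolP/idP => /connectedP. Qed.

Lemma connectC G i j : connect (adj G) i j = connect (adj G) j i.
Proof. by apply: sym_connect_sym; apply: adj_sym. Qed.

Lemma connect_adj G k i j : adj G i j -> connect (adj G) k i = connect (adj G) k j.
Proof.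
move=> ij; apply/idP/idP => H; apply: connect_trans H _; apply: connect1 => //.
by rewrite adj_sym.
Qed.

Lemma acyclic_mult1 G e : acyclic G -> (0 < mult G e)%N -> mult G e = 1%N.
Proof.
move=> acG e0; apply/eqP; rewrite eqn_leq e0 andbT leqNgt; apply/negP => e1.
(* Two parallel copies of e, run forth and back, form a cycle. *)
suff : [:: (e, true); (e, false)] = [::] :> seq (step n) by [].
apply: (acG e.1); rewrite /upath /= /step_src /step_tgt /= !eqxx /=.
apply/forallP => e'; by have [<-|] := eqVneq e e'.
Qed.

(** Every edge of an acyclic graph is a bridge: a path from its target back to its source in the
    rest of the graph would be closed up by e. *)
Lemma acyclic_remove G e : acyclic G -> (0 < mult G e)%N ->
  ~~ connect (adj (remove_edge G e)) e.1 e.2.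
Proof.
move=> acG e0; apply/negP; rewrite connectC => /connectedP[s /andP[ws /forallP cs]].
suff : (e, true) :: s = [::] by [].
apply: (acG e.1); rewrite /upath /= eqxx ws /=; apply/forallP => e'.
have := cs e'; rewrite mult_remove [e' == e]eq_sym; case: eqP => [<-|_] /=; last by rewrite subn0.
by rewrite add1n => /leq_ltn_trans; apply; rewrite subn1 ltn_predL.
Qed.

End GraphTheory.

(** Here w is the inverse of some z, c the derivative of z and u = w^a: this is the induction step
    for the logarithmic derivative of the powers of w. *)
Lemma log_derivative_step (R : comRingType) (a c u w : R) :
  - c * (w * w) * u + w * (- (a * c * w) * u) = - ((a + 1) * c * w) * (w * u).
Proof. by ring. Qed.

(** * The functions p_Gamma: relations along cycles and derivatives *)

Section GraphFunctions.
Variables (F : fieldType) (n : nat).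
Implicit Types (x y : ratfun F n) (G : graph n) (i j k : 'I_n) (e : 'I_n * 'I_n).
Implicit Types (E : {set 'I_n * 'I_n}) (I : pred 'I_n).

Lemma Oval_pfun G : Oval (pfun F G) = mono F (esupp G) (mult G).
Proof.
rewrite /pfun (big_morph _ (@OvalM F n) (@Oval1 F n)) /mono.
rewrite (bigID (mem (esupp G))) /= [X in _ * X]big1 ?mulr1 => [|e].
  apply: eq_bigr => e _; elim: (mult G e) => [//|k IH].
  by rewrite !exprS OvalM IH.
by rewrite inE lt0n negbK => /eqP ->.
Qed.

Lemma alg_pfun G : alg (poles (esupp G)) (Oval (pfun F G)).
Proof. by rewrite Oval_pfun; apply: alg_monoE. Qed.

Lemma pfun_remove G e : (0 < mult G e)%N ->
  pfun F (remove_edge G e) = Oz F e.1 e.2 * pfun F G.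
Proof.
move=> e0; rewrite /pfun (bigD1 e) //= [in RHS](bigD1 e) //= mult_remove eqxx.
rewrite -(prednK e0) subn1 /= exprS !mulrA; congr (_ * _).
  have -> : Oz F e.1 e.2 * OzV F e.1 e.2 = 1.
    apply: Oval_inj; rewrite OvalM mulfV // rz_neq0 //.
    by case: e e0 => i j; case: eqVneq => // /= ->; rewrite mult_tadpole.
  by rewrite mul1r.
by apply: eq_bigr => e' /negPf ee'; rewrite mult_remove ee' subn0.
Qed.

Lemma alg_Ofil_pred E r x : tadpole_free E -> (#|E| < r)%N -> alg (poles E) x ->
  Ofil_pred r x.
Proof.
by case: r => // r Eirr Er Ex; apply/piece_Ofil/(alg_piece Eirr _ Ex).
Qed.

Lemma pfun_Ofil G r : (nedges G <= r)%N -> Ofil r (Oval (pfun F G)).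
Proof.
move=> Gr; apply/piece_Ofil/(alg_piece (@esupp_tadpole _ G) _ (alg_pfun G)).
exact: leq_trans (card_esupp G) Gr.
Qed.

Definition step_sign (a : step n) : F := if a.2 then 1 else -1.

(** The sum telescopes. On a closed walk it becomes a linear relation between the z_e of the edges
    used. *)
Lemma walk_sum i s j : walk i s j ->
  \sum_(a <- s) step_sign a *: rz F a.1.1 a.1.2 = rz F i j.
Proof.
elim: s i => [i /eqP ->|a s IH i /= /andP[/eqP <- sj]]; first by rewrite big_nil rzii.
rewrite big_cons (IH _ sj) -(rz_add F (step_src a) (step_tgt a) j); congr (_ + _).
case: a {sj} => -[x y] []; rewrite /step_sign /step_src /step_tgt /= ?scale1r //.
by rewrite scaleN1r -rz_opp.
Qed.

(** The relation given by a cycle is solved for its first edge [a.1], which is legitimate because a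
    simple edge is used only once; [dependent_Ofil] then applies. *)
Lemma cyclic_Ofil_pred G x : ~ acyclic G -> alg (poles (esupp G)) x ->
  Ofil_pred (nedges G) x.
Proof.
move=> nacG Gx.
have [i [s [us s0]]] : exists i s, upath G i s i /\ s <> [::].
  apply: contrapT => H; apply: nacG => i s us; apply: contrapT => s0; apply: H.
  by exists i, s.
case: s us s0 => [//|a s] us _; have sE := upath_esupp us.
have aE : a.1 \in esupp G by apply: sE; rewrite mem_head.
(* With a multiple edge there are already fewer polar divisors than edges. *)
have [a1|a1] := ltnP 1 (mult G a.1).
  exact: alg_Ofil_pred (@esupp_tadpole _ G) (card_esupp_lt a1) Gx.
have [/walk_sum + /forallP/(_ a.1)] := andP us.
rewrite rzii /= eqxx add1n => + sa; rewrite big_cons => /eqP; rewrite addr_eq0 => /eqP.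
have sa' b : b \in s -> b.1 \in esupp G :\ a.1.
  move=> bs; rewrite in_setD1 sE ?inE ?bs ?orbT // andbT; apply/negP => ba.
  have : (0 < count (fun b : step n => b.1 == a.1) s)%N.
    by rewrite -has_count; apply/hasP; exists b.
  by rewrite lt0n => /negP; apply; rewrite -leqn0 -ltnS (leq_trans sa).
rewrite big_seq (partition_big (fun b : step n => b.1) (mem (esupp G :\ a.1))) //= => dep.
have : Ofil #|esupp G|.-1 x.
  apply: (dependent_Ofil (c := fun e => - step_sign a *
    \sum_(b <- s | (b \in s) && (b.1 == e)) step_sign b) (@esupp_tadpole _ G) aE _ Gx).
  have sa1 : step_sign a * step_sign a = 1.
    by rewrite /step_sign; case: ifP; rewrite ?mulr1 // mulrNN mulr1.
  rewrite -[LHS]scale1r -sa1 -scalerA dep scalerN -scaleNr scaler_sumr.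
  apply: eq_bigr => e _; rewrite -scalerA scaler_suml; congr (_ *: _).
  by apply: eq_bigr => b /andP[_ /eqP ->].
have G0 : (0 < nedges G)%N by apply: leq_trans (card_esupp G); rewrite (cardsD1 a.1) aE.
have : (#|esupp G|.-1 <= (nedges G).-1)%N.
  by have := card_esupp G; case: #|_| (nedges G) => [|u] [|v].
by case: (nedges G) G0 => //= N _; apply: Ofil_le.
Qed.

Lemma rderiv_mono k E (K : 'I_n * 'I_n -> nat) : rderiv k (mono F E K) =
  (- \sum_(e in E) ((K e)%:R * ((k == e.1)%:R - (k == e.2)%:R)) / rz F e.1 e.2) * mono F E K.
Proof.
rewrite -sumrN /mono.
apply: (big_ind2 (fun x c => rderiv k x = c * x)).
- by rewrite rderiv1 mul0r.
- by move=> x c y c' Ex Ey; rewrite rderivM Ex Ey mulrDl (mulrCA x) -mulrA.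
move=> e _; elim: (K e) => [|r IH]; first by rewrite !mul0r oppr0 mul0r rderiv1.
rewrite exprS rderivM IH rderivV rderiv_rz -natr1 expr2 invfM.
exact: log_derivative_step.
Qed.

(** An edge with both ends in I, or none, contributes 0. If I is a component the sum vanishes; if I
    is one side of a bridge only the bridge survives. *)
Lemma sum_rderiv_mono I E (K : 'I_n * 'I_n -> nat) :
  \sum_(k | I k) rderiv k (mono F E K) =
  (- \sum_(e in E) ((K e)%:R * ((I e.1)%:R - (I e.2)%:R)) / rz F e.1 e.2) * mono F E K.
Proof.
rewrite (eq_bigr _ (fun k _ => rderiv_mono k E K)) -mulr_suml sumrN exchange_big.
congr (- _ * _); apply: eq_bigr => e _ /=; rewrite -mulr_suml -mulr_sumr sumrB.
by rewrite !sumr_pred1.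
Qed.

End GraphFunctions.

(** * From the graded chiral operad to the classical one *)

Section Chiral.
Variables (F : fieldType) (V : superspace F) (d : {linear V -> V}).
Local Notation Q n := (Q n d).
Local Notation Pch n := (Pch d n).
Local Notation O n := (Ostar F n).

Lemma is_chP n (X : Pch n) : is_ch (ch_app X).
Proof. by case: X => X XP; apply/asboolP. Qed.

Lemma mkPchE n (X : chfun d n) : is_ch X -> ch_app (mkPch X) = X.
Proof.
move=> chX; have PX : X \in @ch_pred F V d n by apply/asboolP.
by rewrite /mkPch /ch_app val_insubd PX.
Qed.

Lemma ch_scaleE n c (X : Pch n) v f : (c *: X) v f = c *: X v f. Proof. by []. Qed.
Lemma ch_sumE n (I : Type) (r : seq I) (P : pred I) (X : I -> Pch n) v f :
  (\sum_(i <- r | P i) X i) v f = \sum_(i <- r | P i) X i v f.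
Proof. exact: (big_morph (fun Z : Pch n => Z v f) (id1 := 0) (op1 := +%R)). Qed.

Section OneElement.
Variables (n : nat) (X : Pch n).
Implicit Types (v : 'I_n -> V) (f g : O n) (i j k : 'I_n).

Lemma ch_mlin f : multilinear (X^~ f). Proof. by case: (is_chP X). Qed.
Lemma ch_lin v : linear (X v). Proof. by case: (is_chP X). Qed.
Lemma ch_deriv v i f : X v (Oderiv i f) = X [eta v with i |-> d (v i)] f + qlam i (X v f).
Proof. by case: (is_chP X) => _ _ ->. Qed.
Lemma ch_z v i j f : X v (Oz F i j * f) = qdiff j i (X v f).
Proof. by case: (is_chP X). Qed.

Lemma chD v f g : X v (f + g) = X v f + X v g.
Proof. by have := ch_lin v 1 f g; rewrite !scale1r. Qed.
Lemma ch0 v : X v 0 = 0.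
Proof. by have := ch_lin v (-1) 0 0; rewrite scaler0 addr0 scaleN1r addNr. Qed.
Lemma chZ v c f : X v (c *: f) = c *: X v f.
Proof. by have := ch_lin v c f 0; rewrite ch0 !addr0. Qed.
Lemma chN v f : X v (- f) = - X v f.
Proof. by rewrite -scaleN1r chZ scaleN1r. Qed.
Lemma ch_sum v (I : Type) (r : seq I) (P : pred I) (f : I -> O n) :
  X v (\sum_(i <- r | P i) f i) = \sum_(i <- r | P i) X v (f i).
Proof. by apply: (big_morph (X v)); [exact: chD|exact: ch0]. Qed.

Definition kills f := forall v, X v f = 0.

Lemma kills0 : kills 0. Proof. by move=> v; rewrite ch0. Qed.
Lemma killsD f g : kills f -> kills g -> kills (f + g).
Proof. by move=> kf kg v; rewrite chD kf kg addr0. Qed.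
Lemma killsZ c f : kills f -> kills (c *: f).
Proof. by move=> kf v; rewrite chZ kf scaler0. Qed.
Lemma kills_deriv i f : kills f -> kills (Oderiv i f).
Proof. by move=> kf v; rewrite ch_deriv !kf linear0 addr0. Qed.
Lemma kills_alg (a f : O n) : alg (fun _ _ => false) (Oval a) -> kills f -> kills (a * f).
Proof.
have irr : irreflexive (fun _ _ : 'I_n => false) by [].
move=> Pa; move: a Pa f; apply: (Oalg_ind irr) => [c|i j|//|a b _ Ha _ Hb|a b _ Ha _ Hb] f kf.
- by rewrite -OscaleAl mul1r; apply: killsZ.
- by move=> v; rewrite ch_z kf linear0.
- by rewrite mulrDl; apply: killsD; [apply: Ha|apply: Hb].
- by rewrite -mulrA; apply/Ha/Hb.
Qed.
End OneElement.

(** * Vanishing on the functions p_Gamma and the next step of the filtration *)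

Section Injectivity.
Hypothesis char0 : [pchar F] =i pred0.
Variables (n r : nat) (X : Pch n).
Hypothesis X_fil : ch_fil r X.
Hypothesis X_pfun : forall G : graph n, nedges G = r -> kills X (pfun F G).

Let kills_alg_lt (E : {set 'I_n * 'I_n}) (f : O n) : tadpole_free E -> (#|E| < r)%N ->
  alg (poles E) (Oval f) -> kills X f.
Proof. by move=> Eirr Er Ef v; apply: X_fil; apply: alg_Ofil_pred Eirr Er Ef. Qed.

Let mono_Ostar (E : {set 'I_n * 'I_n}) K : tadpole_free E -> mono F E K \in @Ostar_pred F n.
Proof. by move=> Eirr; apply: alg_Ostar (alg_monoE _ _ _); apply: poles_irr. Qed.

(* In an acyclic graph the derivation along one side of an edge raises the order of the
   pole at that edge only. *)
Let kills_mono (G : graph n) (K : 'I_n * 'I_n -> nat) : acyclic G -> #|esupp G| = r ->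
  (forall e, mult G e <= 1)%N -> kills X (mkO (mono F (esupp G) K)).
Proof.
move=> acG Er G1; have Eirr := @esupp_tadpole _ G.
have EG e : (e \in esupp G) = (0 < mult G e)%N by rewrite inE.
have [E EE] : exists E, E = esupp G by exists (esupp G).
rewrite -EE in Er Eirr EG *.
have [s] := ubnP (\sum_(e in E) K e)%N; elim: s K => [//|s IH] K Ks.
have [/exists_inP[e eE /eqP K0]|] := boolP [exists e in E, K e == 0%N].
  apply: (kills_alg_lt (E := E :\ e)).
  - by move=> i; rewrite !inE negb_and (negPf (Eirr i)) orbT.
  - by rewrite -Er (cardsD1 e E) eE.
  rewrite Oval_mkO ?mono_Ostar // /mono (bigD1 e) //= K0 expr0 mul1r.
  by apply: alg_prod => -[i j] /andP[ijE ij]; apply/algX/alg_rzV; rewrite /poles !inE ij.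
rewrite negb_exists_in => /forall_inP K0.
(* If all poles are simple, the monomial is the function p_Gamma itself. *)
have [/exists_inP[e eE K1]|] := boolP [exists e in E, 1 < K e]%N; last first.
  rewrite negb_exists_in => /forall_inP K1.
  have -> : mkO (mono F E K) = pfun F G.
    apply: Oval_inj; rewrite Oval_mkO ?mono_Ostar // Oval_pfun -EE; apply: eq_mono => e eE.
    have := K0 e eE; have := K1 e eE; have := G1 e; move: eE; rewrite EG.
    by case: (mult G e) (K e) => [|[|?]] [|[|?]].
  apply: X_pfun; rewrite -Er nedgesE -sum1_card -EE; apply: eq_bigr => e eE.
  by apply/eqP; rewrite eqn_leq G1 -EG.
pose K' e' := (K e' - (e' == e))%N.
have KE : mono F E K = (rz F e.1 e.2)^-1 * mono F E K'.
  rewrite -monoS //; apply: eq_mono => e' _; rewrite /K' subnK //.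
  by case: eqP => // ->; apply: ltnW.
have eG : (0 < mult G e)%N by rewrite -EG.
(* The side of the bridge e containing its source: each other edge has both ends on the same
   side. *)
pose I := connect (adj (remove_edge G e)) e.1.
have DK : \sum_(k | I k) Oderiv k (mkO (mono F E K')) = - (K' e)%:R *: mkO (mono F E K).
  apply: Oval_inj; rewrite (big_morph _ (@OvalD F n) (@Oval0 F n)).
  rewrite (eq_bigr (fun k => rderiv k (mono F E K'))) => [|k _]; last first.
    by rewrite Oval_deriv Oval_mkO ?mono_Ostar.
  rewrite sum_rderiv_mono (bigD1 e) //= /I connect0.
  rewrite (negPf (acyclic_remove acG eG)) subr0 mulr1 big1 => [|e' /andP[e'E e'e]].
    rewrite addr0 Oval_mkO ?mono_Ostar // KE scaler_rconst -mulNr -mulrA.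
    by congr (_ * _); rewrite /rconst mpolyCN rpolyN mpolyC_nat /rpoly rmorph_nat.
  have e'G : (0 < mult (remove_edge G e) e')%N.
    by rewrite mult_remove (negPf e'e) subn0 -EG.
  have -> : connect (adj (remove_edge G e)) e.1 e'.1 = connect (adj (remove_edge G e)) e.1 e'.2.
    apply: connect_adj; rewrite /adj inE.
    by case: (e') e'G => i j ->.
  by rewrite subrr mulr0 mul0r.
(* [K' e] is K e - 1, a positive integer because K e > 1, hence invertible in characteristic 0. *)
have K'0 : - (K' e)%:R != 0 :> F.
  rewrite oppr_eq0; have/pcharf0P -> := char0.
  by rewrite /K' eqxx subn1 -lt0n -ltnS prednK // ltnW.
suff : kills X (- (K' e)%:R *: mkO (mono F E K)).
  move=> H; rewrite -(scale1r (mkO _)) -(mulVf K'0) -scalerA; exact: killsZ.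
rewrite -DK; apply: big_ind => [|f g|k _]; [exact: kills0|exact: killsD|].
apply/kills_deriv/IH; apply: leq_trans (_ : (\sum_(e in E) K e <= s)%N); last by [].
rewrite (bigD1 e) //= [in X in (_ < X)%N](bigD1 e) //= -addSn leq_add //.
  by rewrite /K' eqxx subn1 prednK // ltnW.
by apply: leq_sum => e' /andP[_ /negPf e'e]; rewrite /K' e'e subn0.
Qed.

Lemma ch_fil_next : ch_fil r.+1 X.
Proof.
move=> v f /= rf; move: f rf v; apply: Ofil_ind => [|f g|f].
- exact: kills0.
- exact: killsD.
case/piece_alg => E [Eirr Er Ef].
have [Er'|rE] := ltnP #|E| r; first exact: kills_alg_lt Er' Ef.
have {}Er : #|E| = r by apply/eqP; rewrite eqn_leq Er.
pose G := mkgraph (fun i j => ((i, j) \in E) : nat).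
have multG e : mult G e = (e \in E).
  by case: e => i j; rewrite mult_mkgraph /=; case: eqP => // ->; rewrite (negPf (Eirr j)).
have GE : esupp G = E by apply/setP => e; rewrite inE multG lt0b.
have [acG|nacG] := pselect (acyclic G); last first.
  move=> v; apply: X_fil; rewrite -GE in Ef; have := cyclic_Ofil_pred nacG Ef.
  suff -> : nedges G = r by [].
  by rewrite -Er nedgesE -sum1_card GE; apply: eq_bigr => e eE; rewrite multG eE.
have [N [a [Pa Ea]]] := alg_mono Eirr Ef.
have irr : irreflexive (fun _ _ : 'I_n => false) by [].
have Oa := alg_Ostar irr Pa.
have -> : f = mkO a * mkO (mono F E (fun=> N)).
  by apply: Oval_inj; rewrite OvalM !Oval_mkO ?mono_Ostar.
apply: kills_alg; first by rewrite Oval_mkO.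
by rewrite -GE; apply: kills_mono => [//||e]; rewrite ?GE // multG leq_b1.
Qed.
End Injectivity.
End Chiral.

(** * The map on graded components *)

Section GradedToClassical.
Variables (F : fieldType) (V : superspace F) (d : {linear V -> V}).
Local Notation Q n := (Q n d).
Local Notation Pch n := (Pch d n).
Local Notation Pcl n := (Pcl d n).
Local Notation O n := (Ostar F n).

Lemma is_clP n (f : Pcl n) : is_cl (cl_app f).
Proof. by case: f => f fP; apply/asboolP. Qed.

Lemma mkPclE n (f : clfun d n) : is_cl f -> cl_app (mkPcl f) = f.
Proof.
move=> clf; have Pf : f \in @cl_pred F V d n by apply/asboolP.
by rewrite /mkPcl /cl_app val_insubd Pf.
Qed.

Lemma PclP n (f g : Pcl n) : (forall G v, f G v = g G v) -> f = g.
Proof. by move=> fg; apply/val_inj/funext => G; apply/funext => v; apply: fg. Qed.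

Lemma gr_rep_fil r n (x : gr d r n) : ch_fil r (gr_rep x).
Proof. by rewrite /gr_rep; case: (rep x) => X /= /asboolP. Qed.

(** The representative chosen by [gr_rep] differs from X by an element of F^(r+1), which vanishes on
    functions with at most r polar divisors. *)
Lemma gr_clsE r n (X : Pch n) (v : 'I_n -> V) (f : O n) : ch_fil r X -> Ofil r (Oval f) ->
  gr_rep (gr_cls r X) v f = X v f.
Proof.
move=> rX rf; rewrite /gr_rep /gr_cls; set Y := insubd _ X.
have EY : Fch_val Y = X.
  by rewrite /Y val_insubd; have -> : X \in @ch_fil_pred F V d r n by apply/asboolP.
have /asboolP/(_ v f rf) : rep (cls Y : gr d r n) - Y \in @Fch_next F V d r n by apply: rep_cls.
by rewrite -[LHS]/(Fch_val _ v f - Fch_val Y v f) EY => /eqP; rewrite subr_eq0 => /eqP.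
Qed.

Lemma gr_cls_rep r n (x : gr d r n) : gr_cls r (gr_rep x) = x.
Proof.
rewrite /gr_cls /gr_rep -[RHS]repK; congr cls; apply: val_inj.
by rewrite val_insubd; case: (rep x) => X /= ->.
Qed.

Lemma gr_cls_eq0 r n (X : Pch n) : ch_fil r.+1 X -> gr_cls r X = 0.
Proof.
move=> rX; have rX' : ch_fil r X.
  move=> v f; case: r rX => [rX f0|r rX rf]; last exact/rX/(Ofil_le _ rf).
  have -> : f = 0 by apply: Oval_inj; exact: f0.
  exact: ch0.
rewrite /gr_cls -(linear0 (@cls F (FPch d r n) (@Fch_next F V d r n))).
apply/cls_eq; rewrite subr0; apply/asboolP => /=.
by rewrite val_insubd; have -> : X \in @ch_fil_pred F V d r n by apply/asboolP.
Qed.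

Lemma gr_rep_lin r n c (x y : gr d r n) (v : 'I_n -> V) (f : O n) : Ofil r (Oval f) ->
  gr_rep (c *: x + y) v f = c *: gr_rep x v f + gr_rep y v f.
Proof.
move=> rf; rewrite -[in LHS](repK x) -[in LHS](repK y) -linearP /=.
have /asboolP/(_ v f rf) : rep (cls (c *: rep x + rep y) : gr d r n) - (c *: rep x + rep y)
  \in @Fch_next F V d r n by apply: rep_cls.
by move/eqP; rewrite -[X in X == _]/(Fch_val _ v f - (c *: gr_rep x v f + gr_rep y v f)) subr_eq0 => /eqP.
Qed.

Lemma gr_rep0 r n (v : 'I_n -> V) (f : O n) : Ofil r (Oval f) -> gr_rep (0 : gr d r n) v f = 0.
Proof.
move=> rf; have := gr_rep_lin (-1) (0 : gr d r n) 0 v rf.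
by rewrite scaler0 addr0 scaleN1r addNr.
Qed.

Section IsClassical.
Variables (n : nat) (X : nat -> Pch n).
Hypothesis X_fil : forall r, ch_fil r (X r).
(** The family X consists of representatives in all degrees at once: at a graph with r edges only
    the one of degree r is evaluated. *)
Definition graph_values : clfun d n := fun G v => X (nedges G) v (pfun F G).

Let kills_remove (G : graph n) e : (0 < mult G e)%N ->
  kills (X (nedges G)) (Oz F e.1 e.2 * pfun F G).
Proof.
move=> e0 v; rewrite -pfun_remove // X_fil // (nedges_remove e0) /=.
exact: pfun_Ofil.
Qed.

Let OzN i j : Oz F j i = - Oz F i j :> O n.
Proof. by apply: Oval_inj; rewrite OvalN /= rz_opp. Qed.
Let Oz_add i j k : Oz F i j + Oz F j k = Oz F i k :> O n.
Proof. by apply: Oval_inj; rewrite OvalD /= rz_add. Qed.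

(** Along a path from i to j, z_ij p_G is a signed sum of functions p_(G \ e), which have one edge
    less and are killed by F^r. This gives the equality of the d/dlambda_i on a component. *)
Lemma kills_connected (G : graph n) i j : connect (adj G) i j ->
  kills (X (nedges G)) (Oz F i j * pfun F G).
Proof.
case/connectP => p pp ->; elim: p i pp => [i _|k p IH i /= /andP[ik /IH kp]].
  have -> : Oz F i i = 0 :> O n by apply: Oval_inj; rewrite /= rzii.
  by rewrite mul0r; apply: kills0.
rewrite -(Oz_add i k) mulrDl; apply: killsD => //.
case/orP: ik; rewrite inE => /kills_remove //= H.
by rewrite OzN mulNr -scaleN1r; apply: killsZ.
Qed.

Lemma is_cl_graph_values : is_cl graph_values.
Proof.
split=> [G|G v nacG|G c v /and3P[c0 cc /forallP cG]|G i j v /connectedP ij|G i0 v].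
- exact: ch_mlin.
- by rewrite /graph_values X_fil //; apply: cyclic_Ofil_pred (alg_pfun F G).
- have ce e : e \in c -> (0 < mult G e)%N.
    by move=> ec; apply: leq_trans (cG e); rewrite -has_count has_pred1.
  (* The sum of the p_(G \ e) over the cycle is (sum of the z_e) p_G, and the z_e add up to 0. *)
  have sum0 : \sum_(e <- c) Oz F e.1 e.2 = 0 :> O n.
    case: c cc {ce cG c0} => [_|e c /= ec]; first by rewrite big_nil.
    have : forall x s, path (fun e e' : 'I_n * 'I_n => e.2 == e'.1) x s ->
        \sum_(e <- s) Oz F e.1 e.2 = Oz F x.2 (last x s).2 :> O n.
      move=> x s; elim: s x => [x _|y s IH x /= /andP[/eqP xy /IH ys]].
        by rewrite big_nil; apply: Oval_inj; rewrite /= rzii.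
      by rewrite big_cons ys -xy Oz_add.
    move/(_ e _ ec); rewrite last_rcons big_rcons /= => E; rewrite big_cons addrC E.
    by apply: Oval_inj; rewrite /= rzii.
  rewrite big_seq.
  rewrite (eq_bigr (fun e => X (nedges G).-1 v (Oz F e.1 e.2 * pfun F G))) => [|e /ce e0].
    by rewrite -ch_sum -mulr_suml -big_seq sum0 mul0r ch0.
  by rewrite /graph_values pfun_remove // (nedges_remove e0).
- by rewrite -ch_z kills_connected // connectC.
under eq_bigl do rewrite asbool_connected; under [in RHS]eq_bigl do rewrite asbool_connected.
apply/eqP; rewrite -addr_eq0 -big_split /=; apply/eqP.
rewrite (eq_bigr (fun i => X (nedges G) v (Oderiv i (pfun F G)))) => [|i _]; last by rewrite ch_deriv.
rewrite -ch_sum; suff -> : \sum_(i | connect (adj G) i0 i) Oderiv i (pfun F G) = 0 by rewrite ch0.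
apply: Oval_inj; rewrite (big_morph _ (@OvalD F n) (@Oval0 F n)).
rewrite (eq_bigr (fun k => rderiv k (mono F (esupp G) (mult G)))) => [|k _]; last first.
  by rewrite Oval_deriv Oval_pfun.
rewrite sum_rderiv_mono big1 ?oppr0 ?mul0r // => -[i j] ij /=.
by rewrite (@connect_adj _ G i0 i j) ?subrr ?mulr0 ?mul0r // /adj ij.
Qed.

End IsClassical.

Definition gr_to_cl n (x : grPch d n) : Pcl n :=
  mkPcl (graph_values (fun r => gr_rep (ds_val x r))).

Lemma gr_to_clE n (x : grPch d n) G v :
  gr_to_cl x G v = gr_rep (ds_val x (nedges G)) v (pfun F G).
Proof.
by rewrite /gr_to_cl mkPclE //; apply: is_cl_graph_values => r; apply: gr_rep_fil.
Qed.

Lemma gr_to_cl_linear n : linear (@gr_to_cl n).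
Proof.
move=> c x y; apply: PclP => G v.
rewrite -[RHS]/(c *: gr_to_cl x G v + gr_to_cl y G v) !gr_to_clE.
by rewrite -gr_rep_lin //; apply: pfun_Ofil.
Qed.
HB.instance Definition _ n := GRing.isLinear.Build F (grPch d n) (Pcl n) *:%R (@gr_to_cl n)
  (@gr_to_cl_linear n).

Lemma gr_to_cl_inj n : [pchar F] =i pred0 -> injective (@gr_to_cl n).
Proof.
move=> char0 x y /eqP; rewrite -subr_eq0 -linearB => /eqP H.
apply/eqP; rewrite -subr_eq0; apply/eqP; move: (x - y) H => {x y} x H.
apply/val_inj/functional_extensionality_dep => r.
change (ds_val x r = 0).
rewrite -[LHS]gr_cls_rep; apply/gr_cls_eq0/(ch_fil_next char0); first exact: gr_rep_fil.
by move=> G Gr v; have := gr_to_clE x G v; rewrite H Gr => <-.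
Qed.

Lemma mkdsumE (A : nat -> lmodType F) (x : Defs.dprod A) : x \in @fin_supp F A -> ds_val (mkdsum x) = x.
Proof. by move=> fx; rewrite /mkdsum val_insubd fx. Qed.

Lemma gr_in_val n r (x : gr d r n) s : ds_val (gr_in x) s =
  if r =P s is ReflectT e then ecast s (gr d s n) e x else 0.
Proof.
rewrite /gr_in /ds_in mkdsumE //; apply/asboolP; exists r.+1 => t rt.
by case: eqP => // E; rewrite E ltnn in rt.
Qed.

Lemma gr_in_same n r (x : gr d r n) : ds_val (gr_in x) r = x.
Proof. by rewrite gr_in_val; case: eqP => // e; rewrite eq_axiomK. Qed.

Lemma gr_in_other n r (x : gr d r n) s : s != r -> ds_val (gr_in x) s = 0.
Proof. by move=> sr; rewrite gr_in_val; case: eqP => // E; case/eqP: sr; rewrite E. Qed.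

Lemma gr_to_cl_in n r (X : Pch n) G v : ch_fil r X -> nedges G = r ->
  gr_to_cl (gr_in (gr_cls r X)) G v = X v (pfun F G).
Proof.
by move=> rX Gr; subst r; rewrite gr_to_clE gr_in_same gr_clsE //; apply: pfun_Ofil.
Qed.

Lemma gr_to_cl_deg r n (x : grPch d n) : gr_deg r x -> cl_deg r (gr_to_cl x).
Proof.
by move=> rx G v Gr; rewrite gr_to_clE rx // gr_rep0 //; apply: pfun_Ofil.
Qed.

End GradedToClassical.

(** * Symmetric group actions *)

Section Action.
Variables (F : fieldType) (V : superspace F) (d : {linear V -> V}).
Hypothesis d_even : forall b v, d (ss_par V b v) = ss_par V b (d v).
Local Notation Q n := (Q n d).
Local Notation Pch n := (Pch d n).
Local Notation Pcl n := (Pcl d n).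
Local Notation O n := (Ostar F n).
Local Notation par := (ss_par V).

Lemma qparE n b (p : VL V n) : qpar b (cls p : Q n) = cls (cmap (par b) p).
Proof.
apply: cls_rep_op => [|q]; first exact: linearP.
rewrite /dlamsum cmapD linear_sum; congr (_ + _).
  by apply: VLP => mu /=; rewrite d_even.
by apply: eq_bigr => k _; rewrite -cmap_lam.
Qed.

Lemma qpar_linear n b : linear (@qpar F V d n b).
Proof.
by move=> c; elim/Q_ind => p; elim/Q_ind => q; rewrite -linearP !qparE -linearP -linearP.
Qed.
HB.instance Definition _ n b := GRing.isLinear.Build F (Q n) (Q n) *:%R (@qpar F V d n b)
  (@qpar_linear n b).

Lemma qparD n b (x y : Q n) : qpar b (x + y) = qpar b x + qpar b y.
Proof. exact: linearD. Qed.
Lemma qsubstD m n (t : 'I_m -> 'I_n) (x y : Q n) : qsubst t (x + y) = qsubst t x + qsubst t y.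
Proof. exact: linearD. Qed.

Lemma qpar_lam n b k (q : Q n) : qpar b (qlam k q) = qlam k (qpar b q).
Proof. by elim/Q_ind: q => p; rewrite qlamE !qparE qlamE cmap_lam. Qed.

Lemma qpar_diff n b i j (q : Q n) : qpar b (qdiff i j q) = qdiff i j (qpar b q).
Proof.
elim/Q_ind: q => p; rewrite qdiffE !qparE qdiffE !dlam_cmap; congr cls.
exact: linearB.
Qed.

Lemma upd_comp n (A : 'I_n -> V -> V) (v : 'I_n -> V) i u :
  (fun k => A k ([eta v with i |-> u] k)) = [eta (fun k => A k (v k)) with i |-> A i u].
Proof. by apply/funext => k /=; case: eqP => // ->. Qed.

(** Projecting the arguments ([ch_parv]) or the value ([ch_parq]) to given parities preserves P^ch
    because d is even. The signed sums in the action and the composition are combinations of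
    elements obtained in this way. *)
Definition ch_parv n (p : 'I_n -> bool) (X : Pch n) : Pch n :=
  mkPch (fun v f => X (fun k => par (p k) (v k)) f).

Lemma ch_parvE n p (X : Pch n) v f : ch_parv p X v f = X (fun k => par (p k) (v k)) f.
Proof.
rewrite mkPchE //; split=> [g u i c x y|u|u i g|u i j g].
- by rewrite !(upd_comp (fun k => par (p k))) linearP; apply: (ch_mlin X g).
- exact: ch_lin.
- by rewrite ch_deriv (upd_comp (fun k => par (p k))) d_even.
- exact: ch_z.
Qed.

Definition ch_parq n b (X : Pch n) : Pch n := mkPch (fun v f => qpar b (X v f)).

Lemma ch_parqE n b (X : Pch n) v f : ch_parq b X v f = qpar b (X v f).
Proof.
rewrite mkPchE //; split=> [g u i c x y|u c x y|u i g|u i j g].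
- by rewrite (ch_mlin X g u i c x y) linearP.
- by rewrite (ch_lin X u c x y) linearP.
- by rewrite ch_deriv qparD qpar_lam.
- by rewrite ch_z qpar_diff.
Qed.

Section Permutation.
Variables (n : nat) (s : 'S_n).

Let s_inj : injective s. Proof. exact: perm_inj. Qed.
Let crs (f : O n) : crossing s f. Proof. exact: crossing_inj. Qed.

Definition ch_perm (X : Pch n) : Pch n :=
  mkPch (fun v f => qsubst s (X (fun k => v ((s^-1)%g k)) (Osubst s f))).

Let upd_perm (v : 'I_n -> V) i u :
  (fun k => [eta v with i |-> u] ((s^-1)%g k)) = [eta (fun k => v ((s^-1)%g k)) with s i |-> u].
Proof.
apply/funext => k /=; have -> // : ((s^-1)%g k == i) = (k == s i).
by rewrite -(inj_eq s_inj) permKV.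
Qed.

Lemma ch_permE (X : Pch n) v f :
  ch_perm X v f = qsubst s (X (fun k => v ((s^-1)%g k)) (Osubst s f)).
Proof.
rewrite mkPchE //; split=> [g u i c x y|u c x y|u i g|u i j g].
- by rewrite !upd_perm (ch_mlin X _ _ _ c x y) linearP.
- by rewrite OsubstD // OsubstZ // (ch_lin X _ c) linearP.
- have -> : Osubst s (Oderiv i g) = Oderiv (s i) (Osubst s g).
    rewrite (Oderiv_subst _ (crs g)) (big_pred1 i) // => k.
    by rewrite /= (inj_eq s_inj).
  rewrite ch_deriv permK qsubstD qsubst_lam -upd_perm; congr (_ + _).
  by rewrite (big_pred1 i) // => k; rewrite /= (inj_eq s_inj).
- by rewrite OsubstM // Osubst_z ch_z qdiff_subst.
Qed.

Lemma ch_actE (X : Pch n) v f : ch_act s X v f = \sum_(p : {ffun 'I_n -> bool}) perm_sign F s p *: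
    qsubst s (X (fun k => par (p ((s^-1)%g k)) (v ((s^-1)%g k))) (Osubst s f)).
Proof.
rewrite /ch_act; set Y := fun v f => _.
(* Being a combination of elements of P^ch, the formula satisfies the conditions, and [mkPch] does
   not return its default value 0. *)
have EY : Y = \sum_(p : {ffun 'I_n -> bool}) perm_sign F s p *: ch_parv p (ch_perm X).
  apply/funext => u; apply/funext => g; rewrite [RHS]ch_sumE; apply: eq_bigr => p _.
  by rewrite ch_scaleE ch_parvE ch_permE.
rewrite EY mkPchE; last exact: is_chP.
by rewrite -EY.
Qed.

End Permutation.

Lemma alg_poles_subst m n (t : 'I_m -> 'I_n) (E : {set 'I_m * 'I_m}) (E' : {set 'I_n * 'I_n})
  (f : O m) : tadpole_free E' -> (forall e, e \in E -> (t e.1, t e.2) \in E') ->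
  alg (poles E) (Oval f) -> alg (poles E') (Oval (Osubst t f)).
Proof.
move=> E'irr EE' Ef; have crs : crossing t f.
  apply: alg_sub Ef => i j ij; apply/orP; left; apply/eqP => tij.
  by have := EE' _ ij; rewrite /= tij; apply/negP/E'irr.
rewrite Oval_subst //; apply: alg_rsubst (poles_irr E'irr) _ Ef => i j ij.
exact: (EE' (i, j)).
Qed.

Lemma Ofil_inj_subst m n (t : 'I_m -> 'I_n) r (f : O m) : injective t ->
  Ofil r (Oval f) -> Ofil r (Oval (Osubst t f)).
Proof.
move=> tI; move: f; apply: Ofil_ind => [|f g rf rg|f].
- rewrite -(scale0r (0 : O m)) OsubstZ; last exact: crossing_inj.
  by rewrite scale0r; apply: Ofil0.
- by rewrite OsubstD; [apply: OfilD|exact: crossing_inj..].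
case/piece_alg => E [Eirr Er Ef].
have E'irr : tadpole_free [set (t e.1, t e.2) | e in E].
  move=> i; apply/negP => /imsetP[[a b] /= abE [-> /tI ab]].
  by rewrite ab (negPf (Eirr b)) in abE.
apply/piece_Ofil/(alg_piece E'irr (leq_trans (leq_imset_card _ _) Er)).
by apply: alg_poles_subst Ef => // e eE; apply/imsetP; exists e.
Qed.

Lemma ch_act_fil r n (s : 'S_n) (X : Pch n) : ch_fil r X -> ch_fil r (ch_act s X).
Proof.
move=> rX v f rf; rewrite ch_actE big1 // => p _; rewrite rX ?linear0 ?scaler0 //.
case: r rf {rX} => [f0|r]; last exact/Ofil_inj_subst/perm_inj.
have -> : f = 0 by apply: Oval_inj; exact: f0.
rewrite -(scale0r (0 : O n)) OsubstZ ?scale0r //; last exact/crossing_inj/perm_inj.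
Qed.

Lemma mult_relabel n (s : 'S_n) (G : graph n) e :
  mult (relabel s G) e = mult G ((s^-1)%g e.1, (s^-1)%g e.2).
Proof.
rewrite mult_mkgraph; case: eqP => // ->; by rewrite mult_tadpole.
Qed.

Let perm2 n (s : 'S_n) (e : 'I_n * 'I_n) := (s e.1, s e.2).
Let perm2_bij n (s : 'S_n) : bijective (perm2 s).
Proof. by exists (perm2 s^-1%g) => -[i j]; rewrite /perm2 /= ?permK ?permKV. Qed.

Lemma nedges_relabel n (s : 'S_n) (G : graph n) : nedges (relabel s G) = nedges G.
Proof.
rewrite /nedges (reindex (perm2 s)) /=; last exact/onW_bij/perm2_bij.
by apply: eq_bigr => -[i j] _; rewrite mult_relabel /= !permK.
Qed.

Lemma pfun_relabel n (s : 'S_n) (G : graph n) : pfun F (relabel s G) = Osubst s (pfun F G).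
Proof.
have crs (f : O n) : crossing s f by exact/crossing_inj/perm_inj.
rewrite /pfun (reindex (perm2 s)) /=; last exact/onW_bij/perm2_bij.
rewrite [RHS](big_morph _ (fun x y => OsubstM (crs x) (crs y)) (Osubst1 _ _)).
apply: eq_bigr => -[i j] _; rewrite mult_relabel /= !permK.
have [->|ij] := eqVneq i j; first by rewrite mult_tadpole !expr0 Osubst1.
elim: (mult G (i, j)) => [|k IH]; first by rewrite !expr0 Osubst1.
by rewrite !exprS OsubstM // IH Osubst_zV // (inj_eq perm_inj).
Qed.

Lemma gr_act_val n (s : 'S_n) (x : grPch d n) r :
  ds_val (gr_act s x) r = gr_cls r (ch_act s (gr_rep (ds_val x r))).
Proof.
rewrite /gr_act mkdsumE //; case: x => x /= /asboolP[N HN]; apply/asboolP; exists N => t /HN ->.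
by apply/gr_cls_eq0/ch_act_fil => v f tf; apply: gr_rep0.
Qed.

Lemma gr_to_cl_act n (s : 'S_n) (x : grPch d n) :
  gr_to_cl (gr_act s x) = cl_act s (gr_to_cl x).
Proof.
rewrite /cl_act; set f := fun G v => _.
(* That the formula lies in P^cl follows from its equality with an element of the image. *)
suff -> : f = gr_to_cl (gr_act s x).
  by apply: PclP => G v; rewrite mkPclE //; apply: is_clP.
apply/funext => G; apply/funext => v; rewrite gr_to_clE gr_act_val gr_clsE; last 2 first.
- exact/ch_act_fil/gr_rep_fil.
- exact: pfun_Ofil.
rewrite ch_actE; apply: eq_bigr => p _; rewrite gr_to_clE.
by rewrite nedges_relabel pfun_relabel.
Qed.

End Action.

(** * Compositions in the chiral operad *)

Section CompositionValue.
Variables (F : fieldType) (V : superspace F) (d : {linear V -> V}).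
Hypothesis d_even : forall b v, d (ss_par V b v) = ss_par V b (d v).
Local Notation Q n := (Q n d).
Local Notation Pch n := (Pch d n).
Local Notation O n := (Ostar F n).
Variables (n : nat) (m : 'I_n -> nat).
Local Notation M := (\sum_i m i)%N.
Local Notation blk := (@tagnat.sig1 n m).
Local Notation Rk := (@tagnat.Rank n m).
Variable Y : Pch n.

Local Notation W := (O M -> Q M).

Definition comp_op (k : 'I_M) (A : W) : W := fun g => qlam k (A g) - A (Oderiv k g).
Definition comp_base (u : 'I_n -> V) : W := fun g => qsubst blk (Y u (Osubst blk g)).
Definition comp_eval (w : forall i, VL V (m i)) : W := eval Rk comp_op comp_base w.

Lemma Rank_inj i a j b : Rk i a = Rk j b ->
  Tagged (fun i => 'I_(m i)) a = Tagged (fun i => 'I_(m i)) b.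
Proof. exact: tagnat.rank_inj. Qed.

Lemma Rank_surj (k : 'I_M) : exists i a, k = Rk i a.
Proof. by exists (blk k), (tagnat.sig2 k); rewrite tagnat.sig2K. Qed.

Lemma comp_op_linear k : linear (comp_op k).
Proof.
move=> c A B; apply/funext => g.
rewrite /comp_op -[(c *: A + B) g]/(c *: A g + B g).
rewrite -[(c *: A + B) _]/(c *: A _ + B _).
rewrite -[RHS]/(c *: (qlam k (A g) - A (Oderiv k g)) + (qlam k (B g) - B (Oderiv k g))).
by rewrite qlamP scalerBr opprD addrACA.
Qed.

Lemma comp_op_comm k l A : comp_op k (comp_op l A) = comp_op l (comp_op k A).
Proof.
apply/funext => g; rewrite /comp_op !qlamB qlamC (OderivC k l) !opprD.
by rewrite addrACA.
Qed.

Lemma comp_base_linear v i : linear (fun u => comp_base [eta v with i |-> u]).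
Proof.
move=> c x y; apply/funext => g; rewrite /comp_base.
rewrite -[RHS]/(c *: qsubst blk (Y _ _) + qsubst blk (Y _ _)).
by rewrite (ch_mlin Y _ v i c x y) linearP.
Qed.

Lemma comp_eval_lin c i (w w' w'' : forall i, VL V (m i)) :
  agree_off i w w' -> agree_off i w'' w' -> w'' i = c *: w i + w' i ->
  comp_eval w'' = c *: comp_eval w + comp_eval w'.
Proof. exact: (eval_lin Rank_inj Rank_surj comp_op_linear comp_base_linear). Qed.

Lemma comp_eval_lam i a (w w' : forall i, VL V (m i)) : agree_off i w w' ->
  w' i = lam a (w i) -> comp_eval w' = comp_op (Rk i a) (comp_eval w).
Proof. exact: (eval_lam Rank_inj Rank_surj comp_op_linear comp_op_comm comp_base_linear). Qed.

Lemma comp_eval_const v : comp_eval (fun i => vconst (m i) (v i)) = comp_base v.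
Proof. exact: (eval_const Rank_surj comp_op_linear comp_base_linear v). Qed.

(** In the composition formula each term is evaluated at g before summing, whereas [comp_eval] sums
    in the space of functions of g, on which the operators lambda_k - d/dz_k act. *)
Lemma comp_evalE (w : forall i, VL V (m i)) g : \sum_(mu \in [set: 'X_{1..M}])
    opX comp_op mu (comp_base (fun i => w i (block Rk mu i))) g = comp_eval w g.
Proof.
have [D HD] := evalterm_bound Rank_inj Rank_surj comp_op_linear comp_base_linear w.
rewrite /comp_eval /eval (@fsum_mdeg _ _ _ _ D) //.
rewrite (@fsum_mdeg _ _ _ _ D) => [|mu /HD]; last first.
  by rewrite /evalterm => ->.
by rewrite (big_morph (fun A : W => A g) (id1 := 0) (op1 := +%R)).
Qed.

Implicit Types (w : forall i, VL V (m i)) (g h : O M).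

Local Notation cross := (@crossing F M n blk).

Lemma comp_baseZ u c g : cross g -> comp_base u (c *: g) = c *: comp_base u g.
Proof. by move=> cg; rewrite /comp_base OsubstZ // chZ linearZ. Qed.
Lemma comp_baseD u g h : cross g -> cross h ->
  comp_base u (g + h) = comp_base u g + comp_base u h.
Proof. by move=> cg ch; rewrite /comp_base OsubstD // chD qsubstD. Qed.

Lemma comp_eval_fun_lin w c g h : cross g -> cross h ->
  comp_eval w (c *: g + h) = c *: comp_eval w g + comp_eval w h.
Proof.
elim/VLfam_ind: w g h => [v|i w w' w'' E E' Ei IH IH'|i a w w' E Ei IH] g h cg ch.
- by rewrite comp_eval_const comp_baseD ?comp_baseZ //; apply: crossingZ.
- rewrite (comp_eval_lin (c := 1) E E') ?scale1r //.
  rewrite -[LHS]/(comp_eval w _ + comp_eval w' _) IH // IH' //.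
  rewrite -[(_ + _ : W) g]/(comp_eval w g + comp_eval w' g).
  rewrite -[(_ + _ : W) h]/(comp_eval w h + comp_eval w' h).
  by rewrite scalerDr addrACA.
- rewrite (comp_eval_lam E Ei) /comp_op IH // OderivD OderivZ IH; try exact: crossing_deriv.
  by rewrite qlamP scalerBr opprD addrACA.
Qed.

Lemma comp_eval_funD w g h : cross g -> cross h ->
  comp_eval w (g + h) = comp_eval w g + comp_eval w h.
Proof. by move=> cg ch; have := comp_eval_fun_lin w 1 cg ch; rewrite !scale1r. Qed.

Lemma cross0 : cross 0. Proof. exact: alg0. Qed.

Lemma comp_eval_fun0 w : comp_eval w 0 = 0.
Proof.
have := comp_eval_fun_lin w (-1) cross0 cross0.
by rewrite scaler0 addr0 scaleN1r addNr.
Qed.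

Lemma comp_eval_funZ w c g : cross g -> comp_eval w (c *: g) = c *: comp_eval w g.
Proof.
by move=> cg; have := comp_eval_fun_lin w c cg cross0; rewrite comp_eval_fun0 !addr0.
Qed.

Definition delta_diff N (k a b : 'I_N) : F := (k == a)%:R - (k == b)%:R.

Lemma Oderiv_zM k a b (g : O M) :
  Oderiv k (Oz F a b * g) = Oz F a b * Oderiv k g + delta_diff k a b *: g.
Proof.
rewrite OderivM Oderiv_z addrC; congr (_ + _); rewrite /delta_diff.
by do 2 case: (k == _); rewrite ?subrr ?subr0 ?sub0r ?mul1r ?mul0r ?scale1r ?scale0r ?scaleN1r ?mulN1r.
Qed.

Lemma comp_op_z A k a b g : (forall g h, cross g -> cross h -> A (g + h) = A g + A h) ->
  (forall c g, cross g -> A (c *: g) = c *: A g) -> cross g ->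
  comp_op k A (Oz F a b * g) =
  qlam k (A (Oz F a b * g)) - A (Oz F a b * Oderiv k g) - delta_diff k a b *: A g.
Proof.
move=> AD AZ cg; rewrite /comp_op Oderiv_zM AD ?AZ ?opprD ?addrA //; last exact: crossingZ.
by apply: crossingM; [exact: crossing_z|exact: crossing_deriv].
Qed.

(** Passing the operator of lambda_a, both sides acquire the same scalar: one from the commutator of
    d/dlambda_l - d/dlambda_k with lambda_a, the other from the derivative of z_kl. *)
Lemma comp_eval_z w k l g : cross g ->
  comp_eval w (Oz F k l * g) = qdiff l k (comp_eval w g).
Proof.
elim/VLfam_ind: w g => [v|i w w' w'' E E' Ei IH IH'|i a w w' E Ei IH] g cg.
- rewrite comp_eval_const /comp_base OsubstM //; last exact: crossing_z.
  by rewrite Osubst_z ch_z qdiff_subst.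
- rewrite (comp_eval_lin (c := 1) E E') ?scale1r //.
  rewrite -[LHS]/(comp_eval w _ + comp_eval w' _) IH // IH' //.
  by rewrite -[(_ + _ : W) g]/(comp_eval w g + comp_eval w' g) linearD.
rewrite (comp_eval_lam E Ei) comp_op_z //; last 2 first.
- exact: comp_eval_funD.
- exact: comp_eval_funZ.
rewrite !IH //; last exact: crossing_deriv.
rewrite /comp_op qdiffB qdiff_lam addrAC; congr (_ - _); rewrite -scaleNr; congr (_ + _ *: _).
by rewrite /delta_diff opprB ![_ == Rk i a]eq_sym.
Qed.
End CompositionValue.

(** * Moving differences of variables within a block between g and the slots *)

Section CompositionBalance.
Variables (F : fieldType) (V : superspace F) (d : {linear V -> V}).
Local Notation Q n := (Q n d).
Local Notation Pch n := (Pch d n).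
Local Notation O n := (Ostar F n).
Variables (n : nat) (m : 'I_n -> nat).
Local Notation M := (\sum_i m i)%N.
Local Notation blk := (@tagnat.sig1 n m).
Local Notation Rk := (@tagnat.Rank n m).
Variable Y : Pch n.
Local Notation W := (O M -> Q M).
Local Notation cross := (@crossing F M n blk).
Local Notation fam := (forall i : 'I_n, VL V (m i)).
Local Notation ev := (@comp_eval F V d n m Y).
Implicit Types (w u : fam) (g h : O M).

Lemma funDE (A B : W) g : (A + B) g = A g + B g. Proof. by []. Qed.
Lemma funZE c (A : W) g : (c *: A) g = c *: A g. Proof. by []. Qed.

Lemma agree_dfwith w u i : agree_off i u w -> u = dfwith w (u i).
Proof.
move=> uw; apply: functional_extensionality_dep => j; case: dfwithP => // k ik.
by apply: uw; rewrite eq_sym.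
Qed.

Lemma agree_dfwith2 w i (p q : VL V (m i)) : agree_off i (dfwith w p) (dfwith w q).
Proof. by move=> j ji; rewrite !dfwith_out // eq_sym. Qed.

Lemma dfwith_agree w u i (p : VL V (m i)) : agree_off i w u -> dfwith w p = dfwith u p.
Proof.
move=> wu; apply: functional_extensionality_dep => l; case: dfwithP => [|k ik].
  by rewrite dfwith_in.
by rewrite dfwith_out // wu // eq_sym.
Qed.

Lemma ev_dfwithP w i c (p q : VL V (m i)) :
  ev (dfwith w (c *: p + q)) = c *: ev (dfwith w p) + ev (dfwith w q).
Proof.
by apply: (@comp_eval_lin _ _ _ _ _ _ c i); rewrite ?dfwith_in //; apply: agree_dfwith2.
Qed.
Lemma ev_dfwithD w i (p q : VL V (m i)) :
  ev (dfwith w (p + q)) = ev (dfwith w p) + ev (dfwith w q).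
Proof. by have := ev_dfwithP w 1 p q; rewrite !scale1r. Qed.
Lemma ev_dfwith0 w i : ev (dfwith w (0 : VL V (m i))) = 0.
Proof.
have := ev_dfwithP w (-1) (0 : VL V (m i)) 0.
by rewrite scaler0 addr0 scaleN1r addNr.
Qed.
Lemma ev_dfwithZ w i c (p : VL V (m i)) : ev (dfwith w (c *: p)) = c *: ev (dfwith w p).
Proof. by have := ev_dfwithP w c p 0; rewrite ev_dfwith0 !addr0. Qed.
Lemma ev_dfwith_lam w i a (p : VL V (m i)) :
  ev (dfwith w (lam a p)) = comp_op (Rk i a) (ev (dfwith w p)).
Proof.
by apply: (@comp_eval_lam _ _ _ _ _ _ i a); rewrite ?dfwith_in //; apply: agree_dfwith2.
Qed.

(* A derivation D of the polynomials in one slot commutes with the evaluation up to the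
   scalars kap. *)
Section SlotOperator.
Variables (i : 'I_n) (D : VL V (m i) -> VL V (m i)) (kap : 'I_M -> F).
Hypothesis D_add : forall p q, D (p + q) = D p + D q.
Hypothesis D_lam : forall c p, D (lam c p) = lam c (D p) + kap (Rk i c) *: p.
Hypothesis kap_off : forall j c, j != i -> kap (Rk j c) = 0.
Let DS w : fam := dfwith w (D (w i)).

Let DS_agree j w w' : i != j -> agree_off j w w' -> agree_off j (DS w) (DS w').
Proof.
move=> ij E k kj; rewrite /DS; have [ik|ik] := eqVneq i k; last by rewrite !dfwith_out // E.
by subst k; rewrite !dfwith_in E.
Qed.

Lemma slot_add j w w' w'' : agree_off j w w' -> agree_off j w'' w' -> w'' j = w j + w' j ->
  ev (DS w'') = ev (DS w) + ev (DS w').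
Proof.
move=> E E' Ej; have [ij|ij] := eqVneq i j.
  subst j; rewrite /DS Ej D_add.
  by rewrite (dfwith_agree _ E') (dfwith_agree _ E) ev_dfwithD.
rewrite (@comp_eval_lin _ _ _ _ _ Y 1 j _ _ _ (DS_agree ij E) (DS_agree ij E')) ?scale1r //.
by rewrite /DS !dfwith_out // scale1r.
Qed.

Lemma slot_lam j c w w' : agree_off j w w' -> w' j = lam c (w j) ->
  ev (DS w') = comp_op (Rk j c) (ev (DS w)) + kap (Rk j c) *: ev w.
Proof.
move=> E Ej; have [ij|ij] := eqVneq i j.
  subst j; rewrite /DS Ej D_lam ev_dfwithD ev_dfwithZ; congr (_ + _ *: _).
    by rewrite -(dfwith_agree _ E) ev_dfwith_lam.
  by congr ev; symmetry; apply: agree_dfwith.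
rewrite kap_off ?scale0r ?addr0 1?eq_sym //.
apply: (@comp_eval_lam _ _ _ _ _ _ j c); first exact: DS_agree.
by rewrite /DS !dfwith_out.
Qed.

End SlotOperator.

Lemma Rank_eq i (a b : 'I_(m i)) : (Rk i a == Rk i b) = (a == b).
Proof. by have := tagnat.eq_Rank a b; rewrite eqxx. Qed.

Lemma Rank_neq i j a b : j != i -> (Rk j a == Rk i b) = false.
Proof. by move=> ji; apply/negP => /eqP E; have := tagnat.eq_Rank a b; rewrite (negPf ji) E eqxx. Qed.

(** This makes the composition formula independent of the presentation h = g prod f_i, since X_i
    turns a factor z_ab of f_i into the derivation in slot i. On constants the left side vanishes
    because a and b are identified by the substitution, the right side because constants have
    derivative 0; the commutators with lambda_k - d/dz_k agree. *)
Lemma ev_balance i (a b : 'I_(m i)) w g : cross g ->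
  ev w (Oz F (Rk i a) (Rk i b) * g) = ev (dfwith w (dlam b (w i) - dlam a (w i))) g.
Proof.
pose D (p : VL V (m i)) := dlam b p - dlam a p.
pose kap k : F := - delta_diff F k (Rk i a) (Rk i b).
have D_add p q : D (p + q) = D p + D q by rewrite /D !dlamD opprD addrACA.
have D_lam c p : D (lam c p) = lam c (D p) + kap (Rk i c) *: p.
  rewrite /D !dlam_lam lamB opprD addrACA; congr (_ + _).
  rewrite /kap /delta_diff opprB !Rank_eq scalerBl !scaler_nat.
  by rewrite ![_ == c]eq_sym.
have kap_off j c : j != i -> kap (Rk j c) = 0.
  by move=> ji; rewrite /kap /delta_diff !Rank_neq // subrr oppr0.
rewrite -/(D (w i)).
elim/VLfam_ind: w g => [v|j w w' w'' E E' Ej IH IH'|j c w w' E Ej IH] g cg.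
- rewrite comp_eval_z // comp_eval_const /comp_base qdiff_subst !tagnat.Rank1K qdiffii linear0.
  by rewrite /D !dlam_const subrr ev_dfwith0.
- rewrite (slot_add D_add E E' Ej) funDE -IH // -IH' //.
  by rewrite (comp_eval_lin (c := 1) _ E E') ?scale1r.
rewrite (slot_lam D_lam kap_off E Ej) funDE funZE (comp_eval_lam _ E Ej).
rewrite comp_op_z //; [|exact: comp_eval_funD|exact: comp_eval_funZ].
by rewrite !IH //; [rewrite scaleNr|exact: crossing_deriv].
Qed.

Lemma big_block (R : Type) (idx : R) (op : Monoid.com_law idx) i (f : 'I_M -> R) :
  \big[op/idx]_(k | blk k == i) f k = \big[op/idx]_(a < m i) f (Rk i a).
Proof.
rewrite (reindex (@tagnat.rank n m)) /=; last exact/onW_bij/tagnat.rank_bij.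
rewrite (eq_bigl (fun p => tag p == i)) => [|p]; last by rewrite /tagnat.sig1 tagnat.rankK.
rewrite (eq_bigl (fun p : {i & 'I_(m i)} => (tag p == i) && true)) => [|p]; last by rewrite andbT.
rewrite (eq_bigr (fun p => f (Rk (tag p) (tagged p)))) => [|p _]; last by rewrite tagnat.rankE.
rewrite -(sig_big_dep (fun j => j == i) (fun _ => xpredT) (fun j a => f (Rk j a))) /=.
by rewrite big_pred1_eq.
Qed.

Lemma comp_base_translate i v g : cross g ->
  comp_base Y [eta v with i |-> d (v i)] g +
  \sum_(k | blk k == i) comp_op k (comp_base Y v) g = 0.
Proof.
move=> cg; rewrite /comp_op sumrB addrA /comp_base -qsubst_lam -qsubstD -ch_deriv.
by rewrite (Oderiv_subst _ cg) ch_sum linear_sum subrr.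
Qed.

(** Evaluation thus descends to the quotients Q(m_i). Multiplication by d + sum of the lambda
    commutes with each lambda, so [kap] is 0 and the claim reduces to constants, where it is the
    sesquilinearity of Y combined with the chain rule ([comp_base_translate]). *)
Lemma ev_dlamsum i w g : cross g -> ev (dfwith w (dlamsum d (w i))) g = 0.
Proof.
pose kap (k : 'I_M) : F := 0.
have D_add (p q : VL V (m i)) : dlamsum d (p + q) = dlamsum d p + dlamsum d q by exact: linearD.
have D_lam c (p : VL V (m i)) : dlamsum d (lam c p) = lam c (dlamsum d p) + kap (Rk i c) *: p.
  rewrite scale0r addr0 /dlamsum lamD linear_sum cmap_lam; congr (_ + _).
  by apply: eq_bigr => l _; rewrite lamC.
have kap_off j c : j != i -> kap (Rk j c) = 0 by [].
elim/VLfam_ind: w g => [v|j w w' w'' E E' Ej IH IH'|j c w w' E Ej IH] g cg.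
- rewrite /dlamsum cmap_const ev_dfwithD funDE.
  rewrite (big_morph (fun p => ev (dfwith _ p)) (id1 := 0) (op1 := +%R)); last 2 first.
  + exact: ev_dfwithD.
  + exact: ev_dfwith0.
  rewrite (big_morph (fun A : W => A g) (id1 := 0) (op1 := +%R)) //.
  rewrite (eq_bigr (fun a => comp_op (Rk i a) (comp_base Y v) g)) => [|a _]; last first.
    rewrite ev_dfwith_lam -comp_eval_const; congr (comp_op _ (ev _) g).
    by symmetry; apply: agree_dfwith.
  rewrite -(big_block _ i (fun k => comp_op k (comp_base Y v) g)).
  rewrite -[RHS](comp_base_translate i v cg); congr (_ + _); rewrite -comp_eval_const.
  congr (ev _ g); apply: functional_extensionality_dep => j.
  by case: dfwithP => /= [|k ik]; [rewrite eqxx|rewrite eq_sym (negPf ik)].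
- by rewrite (slot_add D_add E E' Ej) funDE IH // IH' // addr0.
rewrite (slot_lam D_lam kap_off E Ej) scale0r addr0 /comp_op.
by rewrite !IH ?qlam0 ?subrr //; apply: crossing_deriv.
Qed.

Lemma ev_cls w w' g : cross g -> (forall i, cls (w i) = cls (w' i) :> Q (m i)) ->
  ev w g = ev w' g.
Proof.
(* The representatives are exchanged one slot at a time. *)
move=> cg ww'; pose hyb (s : seq 'I_n) : fam := fun i => if i \in s then w' i else w i.
suff H s : ev w g = ev (hyb s) g.
  rewrite (H (enum 'I_n)); congr (ev _ g); apply: functional_extensionality_dep => i.
  by rewrite /hyb mem_enum.
elim: s => [|i s ->].
  by congr (ev _ g); apply: functional_extensionality_dep.
have [is_|is_] := boolP (i \in s).
  congr (ev _ g); apply: functional_extensionality_dep => j.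
  by rewrite /hyb inE; case: eqP => [->|//]; rewrite is_.
have off : agree_off i (hyb (i :: s)) (hyb s) by move=> j ji; rewrite /hyb inE (negPf ji).
have [q Eq] : exists q, w' i - w i = dlamsum d q.
  by have /cls_eq/asboolP := esym (ww' i).
rewrite (agree_dfwith off) [in LHS](agree_dfwith (w := hyb s) (u := hyb s) (i := i)) //.
have -> : hyb (i :: s) i = dlamsum d q + hyb s i.
  by rewrite /hyb inE eqxx (negPf is_) /= -Eq subrK.
rewrite ev_dfwithD funDE; set w0 := dfwith (hyb s) q.
have -> : dfwith (hyb s) (dlamsum d q) = dfwith w0 (dlamsum d (w0 i)).
  rewrite /w0 dfwith_in; apply: functional_extensionality_dep => j.
  case: dfwithP => [|k ik]; first by rewrite dfwith_in.
  by rewrite !dfwith_out.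
by rewrite ev_dlamsum // add0r.
Qed.

End CompositionBalance.

(** * Existence of compositions in P^ch *)

Section CompositionExists.
Variables (F : fieldType) (V : superspace F) (d : {linear V -> V}).
Local Notation Q n := (Q n d).
Local Notation Pch n := (Pch d n).
Local Notation O n := (Ostar F n).
Variables (n : nat) (m : 'I_n -> nat).
Local Notation M := (\sum_i m i)%N.
Local Notation blk := (@tagnat.sig1 n m).
Local Notation Rk := (@tagnat.Rank n m).
Variable Y : Pch n.
Local Notation W := (O M -> Q M).
Local Notation cross := (@crossing F M n blk).
Local Notation ev := (@comp_eval F V d n m Y).
Implicit Types (g h : O M) (q : forall i : 'I_n, Q (m i)) (v : 'I_M -> V).

Definition evQ q : W := ev (fun i => rep (q i)).

Lemma evQ_dfwith q i p g : cross g ->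
  evQ (dfwith q (cls p : Q (m i))) g = ev (dfwith (fun i => rep (q i)) p) g.
Proof.
move=> cg; apply: ev_cls => // j; rewrite repK; case: dfwithP => [|k ik].
  by rewrite dfwith_in.
by rewrite dfwith_out // repK.
Qed.

Lemma evQ_P q i c (x y : Q (m i)) g : cross g ->
  evQ (dfwith q (c *: x + y)) g = c *: evQ (dfwith q x) g + evQ (dfwith q y) g.
Proof.
move=> cg; rewrite -(repK x) -(repK y) -cls_linear !evQ_dfwith //.
by rewrite ev_dfwithP funDE funZE.
Qed.
Lemma evQ_D q i (x y : Q (m i)) g : cross g ->
  evQ (dfwith q (x + y)) g = evQ (dfwith q x) g + evQ (dfwith q y) g.
Proof. by move=> cg; have := evQ_P q 1 x y cg; rewrite !scale1r. Qed.
Lemma evQ_0 q i g : cross g -> evQ (dfwith q (0 : Q (m i))) g = 0.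
Proof.
move=> cg; have := evQ_P q (-1) (0 : Q (m i)) 0 cg.
by rewrite scaler0 addr0 scaleN1r addNr.
Qed.
Lemma evQ_Z q i c (x : Q (m i)) g : cross g ->
  evQ (dfwith q (c *: x)) g = c *: evQ (dfwith q x) g.
Proof. by move=> cg; have := evQ_P q c x 0 cg; rewrite evQ_0 // !addr0. Qed.

Lemma evQ_lam q i a (x : Q (m i)) g : cross g ->
  evQ (dfwith q (qlam a x)) g = comp_op (Rk i a) (evQ (dfwith q x)) g.
Proof.
move=> cg; elim/Q_ind: x => p; rewrite qlamE /comp_op !evQ_dfwith //.
  by rewrite ev_dfwith_lam.
exact: crossing_deriv.
Qed.

Lemma dfwith_id (A : 'I_n -> Type) (f : forall i, A i) i : dfwith f (f i) = f.
Proof. by apply: functional_extensionality_dep => j; case: dfwithP. Qed.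

Lemma dfwith_dfwith (A : 'I_n -> Type) (f : forall i, A i) i (x y : A i) :
  dfwith (dfwith f x) y = dfwith f y.
Proof.
apply: functional_extensionality_dep => j.
by have [<-|ij] := eqVneq i j; [rewrite !dfwith_in|rewrite !dfwith_out].
Qed.

Lemma evQ_zero q i g : cross g -> q i = 0 -> evQ q g = 0.
Proof. by move=> cg qi; rewrite -(dfwith_id q i) qi evQ_0. Qed.

Lemma evQ_balance q i a b g : cross g ->
  evQ q (Oz F (Rk i a) (Rk i b) * g) = evQ (dfwith q (qdiff b a (q i))) g.
Proof.
move=> cg; rewrite -(repK (q i)) qdiffE evQ_dfwith // -ev_balance //.
Qed.

Variable X : forall i, Pch (m i).
Definition comp_vals v (f : forall i, O (m i)) (i : 'I_n) : Q (m i) :=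
  X i (fun a => v (Rk i a)) (f i).
Definition comp_val v g f : Q M := evQ (comp_vals v f) g.

Lemma comp_vals_dfwith v f i x :
  comp_vals v (dfwith f x) = dfwith (comp_vals v f) (X i (fun a => v (Rk i a)) x).
Proof.
apply: functional_extensionality_dep => j; rewrite /comp_vals.
by case: (dfwithP _ x) => [|k ik]; [rewrite dfwith_in|rewrite dfwith_out].
Qed.

Lemma comp_vals_upd v f i (a : 'I_(m i)) u : comp_vals [eta v with Rk i a |-> u] f =
  dfwith (comp_vals v f) (X i [eta (fun a => v (Rk i a)) with a |-> u] (f i)).
Proof.
apply: functional_extensionality_dep => j; rewrite /comp_vals.
case: dfwithP => [|k ik]; congr (X _ _ _); apply/funext => b /=.
  by rewrite Rank_eq.
by rewrite Rank_neq // eq_sym.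
Qed.

Lemma comp_val_mlin g f : cross g -> multilinear (fun v => comp_val v g f).
Proof.
move=> cg v k c x y; have [i [a ->]] := Rank_surj k.
rewrite /comp_val !comp_vals_upd -evQ_P //; congr (evQ (dfwith _ _) g).
exact: ch_mlin.
Qed.

Lemma comp_val_dfwithP v g f i c x y : cross g ->
  comp_val v g (dfwith f (c *: x + y : O (m i))) =
  c *: comp_val v g (dfwith f x) + comp_val v g (dfwith f y).
Proof. by move=> cg; rewrite /comp_val !comp_vals_dfwith ch_lin evQ_P. Qed.

Lemma comp_val_funlin v c g h f : cross g -> cross h ->
  comp_val v (c *: g + h) f = c *: comp_val v g f + comp_val v h f.
Proof. exact: comp_eval_fun_lin. Qed.
Lemma comp_val_funD v g h f : cross g -> cross h ->
  comp_val v (g + h) f = comp_val v g f + comp_val v h f.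
Proof. exact: comp_eval_funD. Qed.
Lemma comp_val_funZ v c g f : cross g -> comp_val v (c *: g) f = c *: comp_val v g f.
Proof. exact: comp_eval_funZ. Qed.
Lemma comp_val_z v k l g f : cross g ->
  comp_val v (Oz F k l * g) f = qdiff l k (comp_val v g f).
Proof. exact: comp_eval_z. Qed.

Lemma Rk_inj i : injective (Rk i).
Proof. by move=> a b /eqP; rewrite Rank_eq => /eqP. Qed.
Let crossR i (f : O (m i)) : crossing (Rk i) f. Proof. exact/crossing_inj/Rk_inj. Qed.

Let P0 k := fun _ _ : 'I_k => false.
Let cross_block i (a : O (m i)) : alg (P0 (k := _)) (Oval a) -> cross (Osubst (Rk i) a).
Proof.
move=> Pa; rewrite /crossing Oval_subst; last exact: crossR.
apply: alg_poly; exact: alg_rsubst Pa.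
Qed.

Lemma comp_val_balance v i (a : O (m i)) g f : alg (P0 (k := _)) (Oval a) -> cross g ->
  comp_val v (g * Osubst (Rk i) a) f = comp_val v g (dfwith f (a * f i)).
Proof.
have irr : irreflexive (@P0 (m i)) by [].
move=> Pa; move: a Pa g f; apply: (Oalg_ind irr) => [c|a b|//|a b Pa Ha Pb Hb|a b Pa Ha Pb Hb] g f cg.
- rewrite OsubstZ; last exact: crossR.
  have -> : g * (c *: Osubst (Rk i) 1) = c *: g by rewrite Osubst1 mulrC -OscaleAl mul1r.
  rewrite comp_val_funZ // -OscaleAl mul1r.
  rewrite /comp_val comp_vals_dfwith chZ evQ_Z //; congr (_ *: evQ _ g).
  by rewrite -comp_vals_dfwith dfwith_id.
- rewrite Osubst_z mulrC /comp_val evQ_balance //; congr (evQ _ g).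
  by rewrite comp_vals_dfwith ch_z.
- rewrite OsubstD; [|exact: crossR..]; rewrite mulrDr comp_val_funD; last 2 first.
  + exact/crossingM/cross_block.
  + exact/crossingM/cross_block.
  rewrite Ha // Hb // mulrDl -[a * f i]scale1r comp_val_dfwithP // !scale1r.
  by [].
- rewrite OsubstM; [|exact: crossR..]; rewrite mulrA Hb //; last exact/crossingM/cross_block.
  by rewrite Ha // dfwith_in mulrA dfwith_dfwith.
Qed.

Lemma comp_val_balance_all v (a f : forall i, O (m i)) g :
  (forall i, alg (P0 (k := _)) (Oval (a i))) -> cross g ->
  comp_val v (g * \prod_i Osubst (Rk i) (a i)) f = comp_val v g (fun i => a i * f i).
Proof.
move=> Pa cg; pose hyb (s : seq 'I_n) i := if i \in s then a i * f i else f i.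
suff H s : uniq s -> comp_val v (g * \prod_(i <- s) Osubst (Rk i) (a i)) f = comp_val v g (hyb s).
  rewrite H ?index_enum_uniq //; congr (comp_val _ _ _).
  by apply: functional_extensionality_dep => i; rewrite /hyb mem_index_enum.
elim: s g cg => [|i s IH] g cg /=.
  by rewrite big_nil mulr1 => _; congr (comp_val _ _ _); apply: functional_extensionality_dep.
case/andP=> is_ us; rewrite big_cons mulrA IH //; last exact/crossingM/cross_block.
rewrite comp_val_balance //; congr (comp_val _ _ _).
apply: functional_extensionality_dep => j; rewrite /hyb inE.
case: dfwithP => [|k ik]; first by rewrite eqxx (negPf is_).
by rewrite eq_sym (negPf ik).
Qed.

(* For N large, h * Delta ^+ N has no inner poles, and h is its product with the inverse
   powers of the factors of Delta: the composition at h is thus determined by its formula,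
   and [comp_val_stable] says that the choice of N is irrelevant. *)
Definition delta k : O k := \prod_(e : 'I_k * 'I_k | (e.1 < e.2)%N) Oz F e.1 e.2.
Definition deltaV k : O k := \prod_(e : 'I_k * 'I_k | (e.1 < e.2)%N) OzV F e.1 e.2.
Definition Delta : O M := \prod_i Osubst (Rk i) (delta (m i)).
Definition blockprod (f : forall i, O (m i)) : O M := \prod_i Osubst (Rk i) (f i).

Lemma Oval_delta k : Oval (delta k) = denom F (fun i j : 'I_k => (i < j)%N).
Proof. by rewrite /delta (big_morph _ (@OvalM F k) (@Oval1 F k)). Qed.

Lemma deltaK k : delta k * deltaV k = 1.
Proof.
rewrite /delta /deltaV -big_split big1 // => -[i j] /= ij; apply: Oval_inj.
by rewrite OvalM mulfV // rz_neq0 //; apply: contraTneq ij => ->; rewrite ltnn.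
Qed.

Lemma delta_alg k N : alg (P0 (k := k)) (Oval (delta k ^+ N)).
Proof.
elim: N => [|N IH]; first exact: alg1.
have Pd : alg (P0 (k := k)) (Oval (delta k)) by rewrite Oval_delta; apply: alg_denom.
by rewrite exprS; apply: algM Pd IH.
Qed.

Lemma blockprodM f f' : blockprod (fun i => f i * f' i) = blockprod f * blockprod f'.
Proof. by rewrite /blockprod -big_split; apply: eq_bigr => i _; rewrite OsubstM. Qed.

Lemma blockprod_deltaX N : blockprod (fun i => delta (m i) ^+ N) = Delta ^+ N.
Proof.
elim: N => [|N IH]; first by apply: big1 => i _; apply: Osubst1.
rewrite exprS -IH -blockprodM; congr blockprod; apply: functional_extensionality_dep => i.
exact: exprS.
Qed.

Lemma blockprod1 : blockprod (fun=> 1) = 1.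
Proof. by apply: big1 => i _; apply: Osubst1. Qed.

Lemma blockprod_deltaV N : Delta ^+ N * blockprod (fun i => deltaV (m i) ^+ N) = 1.
Proof.
rewrite -blockprod_deltaX -blockprodM -blockprod1; congr blockprod; apply: functional_extensionality_dep => i.
by rewrite -exprMn deltaK expr1n.
Qed.

Lemma cross_blockprod (S : pred 'I_n) (f : forall i, O (m i)) :
  (forall i, alg (P0 (k := _)) (Oval (f i))) -> cross (\prod_(i | S i) Osubst (Rk i) (f i)).
Proof.
move=> Pf; apply: (big_ind cross) => [|x y|i _]; [exact: alg1|exact: crossingM|].
exact: cross_block.
Qed.

Lemma cross_Delta N : cross (Delta ^+ N).
Proof.
elim: N => [|N IH]; first exact: alg1.
rewrite exprS; apply: crossingM IH; apply: cross_blockprod => i.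
by rewrite -[delta _]expr1; apply: delta_alg.
Qed.

(** Up to sign, z_kl is one of the factors of Delta and cancels the pole. *)
Lemma zV_Delta k l : k != l -> blk k = blk l -> cross (OzV F k l * Delta).
Proof.
have [i [a ->]] := Rank_surj k; have [j [b ->]] := Rank_surj l.
rewrite !tagnat.Rank1K => kl ij; subst j; move: kl; rewrite Rank_eq => ab.
have -> : Delta = Osubst (Rk i) (delta (m i)) * \prod_(j | j != i) Osubst (Rk j) (delta (m j)).
  exact: bigD1.
rewrite mulrA; apply: crossingM; last first.
  by apply: cross_blockprod => j; rewrite -[delta _]expr1; apply: delta_alg.
have zK (x y : 'I_(m i)) : x != y -> Oz F x y * OzV F x y = 1.
  by move=> xy; apply: Oval_inj; rewrite OvalM mulfV // rz_neq0.
have Pprod (S : pred ('I_(m i) * 'I_(m i))) :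
    alg (P0 (k := _)) (Oval (\prod_(e | S e) Oz F e.1 e.2)).
  rewrite (big_morph _ (@OvalM F _) (@Oval1 F _)).
  by apply: alg_prod => e _; apply: alg_rz.
have OzN (x y : 'I_(m i)) : Oz F x y = - Oz F y x by apply: Oval_inj; rewrite OvalN /= -rz_opp.
have [c Pc Ec] : exists2 c, alg (P0 (k := _)) (Oval c) & delta (m i) = Oz F a b * c.
  have := ab; rewrite neq_ltn => /orP[ltab|ltba].
    by rewrite /delta (bigD1 (a, b)) //=; eexists; last reflexivity; apply: Pprod.
  rewrite /delta (bigD1 (b, a)) //= OzN mulNr -mulrN; eexists; last reflexivity.
  by rewrite OvalN; apply/algN/Pprod.
rewrite Ec OsubstM // Osubst_z mulrA.
have -> : OzV F (Rk i a) (Rk i b) * Oz F (Rk i a) (Rk i b) = 1.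
  by apply: Oval_inj; rewrite OvalM mulVf // rz_neq0 // Rank_eq.
by rewrite mul1r; apply: cross_block.
Qed.

Lemma cross_localize h : exists N, forall N', (N <= N')%N -> cross (h * Delta ^+ N').
Proof.
have up f N N' : (N <= N')%N -> cross (f * Delta ^+ N) -> cross (f * Delta ^+ N').
  move=> /subnK <-; rewrite addnC exprD mulrA => cf.
  exact: crossingM cf (cross_Delta _).
suff [N HN] : exists N, cross (h * Delta ^+ N) by exists N => N' NN'; apply: up HN.
elim/Ostar_ind: h => [c|i j|i j ij|f g [N Nf] [N' Ng]|f g [N Nf] [N' Ng]].
- by exists 0%N; rewrite mulr1; apply: crossingZ; apply: alg1.
- by exists 0%N; rewrite mulr1; apply: crossing_z.
- have [bij|bij] := eqVneq (blk i) (blk j).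
    by exists 1%N; apply: zV_Delta => //; apply: contraTneq ij => ->; rewrite ltnn.
  by exists 0%N; rewrite mulr1; apply: crossing_zV.
- exists (N + N')%N; rewrite mulrDl; apply: crossingD; first by apply: up Nf; rewrite leq_addr.
  by apply: up Ng; rewrite leq_addl.
- by exists (N + N')%N; rewrite exprD mulrACA; apply: crossingM.
Qed.

Lemma comp_val_stable v h N N' : (N <= N')%N -> cross (h * Delta ^+ N) ->
  comp_val v (h * Delta ^+ N') (fun i => deltaV (m i) ^+ N') =
  comp_val v (h * Delta ^+ N) (fun i => deltaV (m i) ^+ N).
Proof.
move=> /subnK <- ch; rewrite addnC exprD mulrA -(blockprod_deltaX (N' - N)).
rewrite comp_val_balance_all //; last by move=> i; apply: delta_alg.
congr (comp_val v _ _); apply: functional_extensionality_dep => i.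
by rewrite addnC exprD mulrA -exprMn deltaK expr1n mul1r.
Qed.

(** The exponent [N h] is chosen separately for each h; [ZE] allows any sufficient exponent, so that
    identities between several functions are checked with a common one. *)
Lemma comp_exists : exists Z : Pch M, forall v g f, cross g -> Z v (g * blockprod f) = comp_val v g f.
Proof.
have /choice[N HN] := cross_localize.
pose Z : chfun d M := fun v h => comp_val v (h * Delta ^+ N h) (fun i => deltaV (m i) ^+ N h).
have ZE v h K : cross (h * Delta ^+ K) ->
    Z v h = comp_val v (h * Delta ^+ K) (fun i => deltaV (m i) ^+ K).
  move=> cK; have cN := HN h _ (leqnn _).
  by rewrite /Z -(comp_val_stable v (leq_maxl (N h) K)) // (comp_val_stable v (leq_maxr (N h) K)).
have ZP : forall v g (f : forall i, O (m i)), cross g -> Z v (g * blockprod f) = comp_val v g f.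
  move=> v g f cg; have /choice[K HK] i : exists K, forall K', (K <= K')%N ->
      alg (P0 (k := m i)) (Oval (delta (m i) ^+ K' * f i)).
    have irr : irreflexive (fun i0 j : 'I_(m i) => (i0 < j)%N) by move=> x; rewrite ltnn.
    have [K HK] := alg_localize irr (OvalP (f i)); exists K => K' /subnK <-.
    have Pf : alg (P0 (k := m i)) (Oval (delta (m i) ^+ K * f i)).
      have -> // : Oval (delta (m i) ^+ K * f i) =
          Oval (f i) * denom F (fun i0 j : 'I_(m i) => (i0 < j)%N) ^+ K.
      rewrite mulrC OvalM; congr (_ * _); elim: (K) => [//|k IH].
      by rewrite !exprS OvalM IH Oval_delta.
    by rewrite exprD -mulrA; apply: algM (delta_alg _ _) Pf.
  (* With the exponent L every f_i becomes a polynomial in differences, which [comp_val_balance_all]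
     can move between g and the slots. *)
  pose L := (\max_i K i)%N.
  have HL i : alg (P0 (k := m i)) (Oval (delta (m i) ^+ L * f i)).
    by apply: HK; rewrite /L; apply: leq_bigmax.
  have EL : g * blockprod f * Delta ^+ L = g * blockprod (fun i => delta (m i) ^+ L * f i).
    by rewrite blockprodM blockprod_deltaX mulrAC mulrA.
  rewrite (ZE _ _ L) EL ?comp_val_balance_all //; last first.
    by apply: crossingM => //; apply: cross_blockprod.
   congr (comp_val v g _); apply: functional_extensionality_dep => i.
  by rewrite mulrAC -exprMn deltaK expr1n mul1r.
have split h K : h * Delta ^+ K * blockprod (fun i => deltaV (m i) ^+ K) = h.
  by rewrite -mulrA blockprod_deltaV mulr1.
have ZL v : linear (Z v).
  move=> c h h'; pose K := maxn (N h) (N h').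
  have ch : cross (h * Delta ^+ K) by apply: HN; apply: leq_maxl.
  have ch' : cross (h' * Delta ^+ K) by apply: HN; apply: leq_maxr.
  have E : (c *: h + h') * Delta ^+ K = c *: (h * Delta ^+ K) + h' * Delta ^+ K.
    by rewrite mulrDl OscaleAl.
  by rewrite !(ZE _ _ K) ?E ?comp_val_funlin //; apply: crossingD => //; apply: crossingZ.
suff chZ : is_ch Z by exists (mkPch Z) => v1 g1 f1 cg; rewrite mkPchE // ZP.
split=> [h v i c x y|v c h h'|v k h|v k l h].
- exact: (comp_val_mlin _ (HN h _ (leqnn _))).
- exact: ZL.
(* The index k lies in one block i, so d/dz_k hits g or f_i. Sesquilinearity of X_i at f_i yields
   the operator lambda_k - d/dz_k on the value, and its second part cancels the term with the
   derivative of g. *)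
- have ch := HN h _ (leqnn _); pose f i := deltaV (m i) ^+ N h.
  set g := h * Delta ^+ N h in ch; have Eh : h = g * blockprod f by rewrite split.
  have [i [a Ek]] := Rank_surj k.
  have Ed : Oderiv k (blockprod f) = blockprod (dfwith f (Oderiv a (f i))).
    have -> : blockprod (dfwith f (Oderiv a (f i))) =
        Osubst (Rk i) (Oderiv a (f i)) * \prod_(j | j != i) Osubst (Rk j) (f j).
      rewrite /blockprod [LHS](bigD1 i) //= dfwith_in; congr (_ * _).
      by apply: eq_bigr => j ji; rewrite dfwith_out // eq_sym.
    rewrite /blockprod Oderiv_prod ?index_enum_uniq // [LHS](bigD1 i) //=.
    rewrite (Oderiv_subst k (crossR (f i))) (big_pred1 a) => [|b]; last by rewrite /= Ek Rank_eq.
    rewrite [X in _ + X](_ : _ = 0) ?addr0 //; apply: big1 => j ji.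
    rewrite (Oderiv_subst k (crossR (f j))) [X in X * _](_ : _ = 0) ?mul0r //.
    by apply: big_pred0 => b; rewrite Ek Rank_neq.
  have -> : Oderiv k h = Oderiv k g * blockprod f + g * blockprod (dfwith f (Oderiv a (f i))).
    by rewrite {1}Eh OderivM Ed.
  have cd := crossing_deriv k ch.
  have ZD x y : Z v (x + y) = Z v x + Z v y by have := ZL v 1 x y; rewrite !scale1r.
  have ZPu : Z [eta v with k |-> d (v k)] h = comp_val [eta v with k |-> d (v k)] g f.
    by rewrite -ZP // -Eh.
  have ZPh : Z v h = comp_val v g f by rewrite -ZP // -Eh.
  rewrite ZD !ZP // ZPu ZPh Ek /comp_val comp_vals_upd comp_vals_dfwith ch_deriv evQ_D //.
  rewrite addrCA; congr (_ + _); rewrite evQ_lam // /comp_op.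
  have -> : dfwith (comp_vals v f) (X i (fun a => v (Rk i a)) (f i)) = comp_vals v f.
    exact: dfwith_id.
  by rewrite addrC subrK.
- have ch := HN h _ (leqnn _); set g := h * _ in ch.
  by rewrite -{1 2}(split h (N h)) -/g mulrA !ZP ?comp_val_z //; apply: crossingM ch; apply: crossing_z.
Qed.

End CompositionExists.

(** * The composition formula with its signs *)

Section ChiralComposition.
Variables (F : fieldType) (V : superspace F) (d : {linear V -> V}).
Hypothesis d_even : forall b v, d (ss_par V b v) = ss_par V b (d v).
Local Notation Q n := (Q n d).
Local Notation Pch n := (Pch d n).
Local Notation O n := (Ostar F n).
Local Notation par := (ss_par V).
Variables (n : nat) (m : 'I_n -> nat).
Local Notation M := (\sum_i m i)%N.
Local Notation blk := (@tagnat.sig1 n m).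
Local Notation Rk := (@tagnat.Rank n m).
Local Notation cross := (@crossing F M n blk).
Implicit Types (g h : O M) (v : 'I_M -> V).

(** The condition on the left treats each pair separately, with a fraction depending on the pair.
    The poles are therefore removed from one presentation pair after pair, by [alg_no_pole]. *)
Lemma no_inner_pole_crossing g : no_inner_pole g <-> cross g.
Proof.
split=> [np|cg k l kl bkl]; last first.
  (* This substitution only identifies indices of one block, so a function with poles between
     different blocks is regular along it. *)
  pose t i := if i == k then l else i.
  have bt i : blk (t i) = blk i by rewrite /t; case: eqP => // ->.
  have tP i j : blk i != blk j -> t i != t j by apply: contraNneq => tij; rewrite -bt tij bt.
  by have [a [b [b0 E]]] := alg_regular tP cg; exists a, b.
suff H (s : seq ('I_M * 'I_M)) : (forall e, e \in s -> e.1 != e.2 /\ blk e.1 = blk e.2) ->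
    alg (fun i j => [&& i != j, (i, j) \notin s & (j, i) \notin s]) (Oval g).
  have H0 : forall e : 'I_M * 'I_M, e \in enum [set e | (e.1 != e.2) && (blk e.1 == blk e.2)] ->
      e.1 != e.2 /\ blk e.1 = blk e.2.
    by move=> e; rewrite mem_enum inE => /andP[-> /eqP ->].
  apply: alg_sub (H _ H0) => i j /and3P[ij]; rewrite !mem_enum !inE /= ij /= => bij _.
  by rewrite bij.
elim: s => [_|e s IH He].
  by apply: alg_sub (OvalP g) => i j; rewrite neq_ltn => ->.
have [e12 be] := He e (mem_head _ _).
have irr : irreflexive (fun i j => [&& i != j, (i, j) \notin s & (j, i) \notin s]).
  by move=> i; rewrite eqxx.
have Hs : forall e, e \in s -> e.1 != e.2 /\ blk e.1 = blk e.2.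
  by move=> e' e's; apply: He; rewrite inE e's orbT.
apply: alg_sub (alg_no_pole irr e12 (IH Hs) (np _ _ e12 be)) => i j.
case/andP=> /and3P[ij sij sji]; rewrite !inE negb_or => /andP[e1 e2].
apply/orP; left; rewrite ij !negb_or sij sji !andbT /=.
case: e e1 e2 {He e12 be} => k l; rewrite !xpair_eqE /= => -> /=.
by rewrite andbC.
Qed.

Definition parX (p : 'I_M -> bool) (q : 'I_n -> bool) (X : forall i, Pch (m i)) i : Pch (m i) :=
  ch_parq (q i (+) block_par p i) (X i).
Definition parv (p : 'I_M -> bool) v : 'I_M -> V := fun k => par (p k) (v k).

Lemma ch_comp_valE (Y : Pch n) (X : forall i, Pch (m i)) v g f :
  ch_comp_val Y X v g f = \sum_(p : {ffun 'I_M -> bool}) \sum_(q : {ffun 'I_n -> bool})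
    koszul_sign F q p *: comp_val Y (parX p q X) (parv p v) g f.
Proof.
apply: eq_bigr => p _; apply: eq_bigr => q _; congr (_ *: _).
have Ew : (fun i => rep (comp_vals (parX p q X) (parv p v) f i)) = (fun i => rep (qpar
    (q i (+) block_par p i) (X i (fun a => par (p (Rk i a)) (v (Rk i a))) (f i)))).
  by apply: functional_extensionality_dep => i; rewrite /comp_vals /parX ch_parqE.
by rewrite /comp_val /evQ Ew -comp_evalE.
Qed.

Lemma ch_compE (Y : Pch n) (X : forall i, Pch (m i)) v g f : cross g ->
  ch_comp Y X v (g * blockprod f) = ch_comp_val Y X v g f.
Proof.
move=> cg; rewrite /ch_comp; case: xgetP => [Z _ ZP|H].
  exact/ZP/no_inner_pole_crossing.
have /choice[Z ZP] : forall pq : {ffun 'I_M -> bool} * {ffun 'I_n -> bool}, exists Z : Pch M,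
    forall v g f, cross g -> Z v (g * blockprod f) = comp_val Y (parX pq.1 pq.2 X) v g f.
  by move=> pq; apply: comp_exists.
(* The signed sum of the elements given by [comp_exists] for each choice of parities excludes the
   default value. *)
case: (H (\sum_(p : {ffun 'I_M -> bool}) \sum_(q : {ffun 'I_n -> bool})
  koszul_sign F q p *: ch_parv p (Z (p, q)))) => u h f' /no_inner_pole_crossing ch.
rewrite ch_comp_valE ch_sumE; apply: eq_bigr => p _; rewrite ch_sumE; apply: eq_bigr => q _.
by rewrite ch_scaleE ch_parvE // ZP.
Qed.

End ChiralComposition.

(** * Splitting graphs and functions into inner and crossing parts *)

Section BlockDecomposition.
Variables (F : fieldType) (n : nat) (m : 'I_n -> nat).
Local Notation O n := (Ostar F n).
Local Notation M := (\sum_i m i)%N.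
Local Notation blk := (@tagnat.sig1 n m).
Local Notation Rk := (@tagnat.Rank n m).
Local Notation cross := (@crossing F M n blk).
Implicit Types (G : graph M) (e : 'I_M * 'I_M).

Lemma big_inner (R : Type) (idx : R) (op : Monoid.com_law idx) (f : 'I_M * 'I_M -> R) :
  \big[op/idx]_(e | blk e.1 == blk e.2) f e =
  \big[op/idx]_i \big[op/idx]_(ab : 'I_(m i) * 'I_(m i)) f (Rk i ab.1, Rk i ab.2).
Proof.
rewrite (partition_big (fun e => blk e.1) xpredT) //=; apply: eq_bigr => i _.
transitivity (\big[op/idx]_(k | blk k == i) \big[op/idx]_(l | blk l == i) f (k, l)).
  rewrite pair_big /=; apply: eq_big => [[k l]|[k l] _] //=.
  by case: (blk k =P i) => [->|_]; rewrite ?andbT ?andbF //= eq_sym.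
rewrite big_block (eq_bigr _ (fun a _ => big_block op i (fun l => f (Rk i a, l)))).
by rewrite pair_bigA.
Qed.

Lemma mult_inner G i a b : mult (inner_graph G i) (a, b) = mult G (Rk i a, Rk i b).
Proof. by rewrite mult_mkgraph /=; case: eqP => // ->; rewrite mult_tadpole. Qed.

Lemma mult_collapse G ij : mult (collapse G) ij = if ij.1 == ij.2 then 0%N else
  (\sum_(k | blk k == ij.1) \sum_(l | blk l == ij.2) mult G (k, l))%N.
Proof. exact: mult_mkgraph. Qed.

Lemma nedges_block G : nedges G = (nedges (collapse G) + \sum_i nedges (inner_graph G i))%N.
Proof.
rewrite /nedges (bigID (fun e : 'I_M * 'I_M => blk e.1 != blk e.2)) /=; congr (_ + _)%N.
  transitivity (\sum_(ij : 'I_n * 'I_n | ij.1 != ij.2) mult (collapse G) ij)%N; last first.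
    rewrite big_mkcond; apply: eq_bigr => -[i j] _; rewrite mult_collapse /=.
    by case: (i == j).
  rewrite (partition_big (fun e => (blk e.1, blk e.2)) (fun ij => ij.1 != ij.2)) //=.
  apply: eq_bigr => -[i j] /= ij; rewrite mult_collapse /= (negPf ij) pair_big /=.
  apply: eq_big => [[k l]|[k l] _] //=; rewrite xpair_eqE.
  by case: (blk k =P i) => [->|_]; case: (blk l =P j) => [->|_]; rewrite ?andbF ?ij.
rewrite (eq_bigl (fun e => blk e.1 == blk e.2)) => [|e]; last by rewrite negbK.
rewrite big_inner; apply: eq_bigr => i _; apply: eq_bigr => -[a b] _.
by rewrite mult_inner.
Qed.

Definition cross_part G : O M :=
  \prod_(e : 'I_M * 'I_M | blk e.1 != blk e.2) OzV F e.1 e.2 ^+ mult G e.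

Lemma pfun_block G :
  pfun F G = cross_part G * blockprod (fun i => pfun F (inner_graph G i)).
Proof.
rewrite /pfun [LHS](bigID (fun e : 'I_M * 'I_M => blk e.1 != blk e.2)) /=; congr (_ * _).
rewrite (eq_bigl (fun e => blk e.1 == blk e.2)) => [|e]; last by rewrite negbK.
rewrite big_inner; apply: eq_bigr => i _.
have crs (f : O (m i)) : crossing (Rk i) f by exact/crossing_inj/Rk_inj.
rewrite [RHS](big_morph _ (fun x y => OsubstM (crs x) (crs y)) (Osubst1 _ _)).
apply: eq_bigr => -[a b] _ /=; rewrite mult_inner.
have [->|ab] := eqVneq a b; first by rewrite mult_tadpole !expr0; symmetry; apply: Osubst1.
elim: (mult G _) => [|k IH]; first by rewrite !expr0; symmetry; apply: Osubst1.
by rewrite !exprS OsubstM // -IH Osubst_zV // Rank_eq.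
Qed.

Definition cross_edges G : {set 'I_M * 'I_M} := [set e in esupp G | blk e.1 != blk e.2].

Lemma OzV_exp_alg k (P : rel 'I_k) i j N : ((0 < N)%N -> P i j) -> alg P (Oval (OzV F i j ^+ N)).
Proof.
elim: N => [_|N IH PN]; first exact: alg1.
rewrite exprS; apply: OalgM; last by apply: IH => _; apply: PN.
by apply/alg_rzV/PN.
Qed.

Lemma alg_cross_part G : alg (poles (cross_edges G)) (Oval (cross_part G)).
Proof.
rewrite /cross_part (big_morph _ (@OvalM F M) (@Oval1 F M)); apply: alg_prod => -[k l] kl.
by apply: OzV_exp_alg => N0; rewrite /poles inE kl inE N0.
Qed.

Lemma cross_edges_crossing G (f : O M) : alg (poles (cross_edges G)) (Oval f) -> cross f.
Proof.
by apply: alg_sub => i j; rewrite /poles !inE => /andP[_ ->].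
Qed.

Lemma cross_edges_collapse G e : e \in cross_edges G -> (blk e.1, blk e.2) \in esupp (collapse G).
Proof.
rewrite !inE => /andP[Ge be]; rewrite mult_collapse /= (negPf be).
rewrite (bigD1 e.1) //= (bigD1 e.2) //= -surjective_pairing.
by rewrite !addn_gt0 Ge.
Qed.

Lemma alg_collapse G (f : O M) : alg (poles (cross_edges G)) (Oval f) ->
  alg (poles (esupp (collapse G))) (Oval (Osubst blk f)).
Proof.
apply: alg_poles_subst; first exact: esupp_tadpole.
exact: cross_edges_collapse.
Qed.

Definition set_graph k (E : {set 'I_k * 'I_k}) N : graph k := mkgraph (fun i j => ((i, j) \in E) * N)%N.

Lemma mult_set_graph k (E : {set 'I_k * 'I_k}) N (e : 'I_k * 'I_k) : tadpole_free E ->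
  mult (set_graph E N) e = ((e \in E) * N)%N.
Proof.
by move=> Eirr; case: e => i j; rewrite mult_mkgraph /=; case: eqP => // ->; rewrite (negPf (Eirr j)).
Qed.

Lemma pfun_set_graph k (E : {set 'I_k * 'I_k}) N : tadpole_free E ->
  Oval (pfun F (set_graph E N)) = mono F E (fun=> N).
Proof.
move=> Eirr; rewrite /pfun (big_morph _ (@OvalM F k) (@Oval1 F k)) /mono [RHS]big_mkcond /=.
apply: eq_bigr => e _; rewrite mult_set_graph //; case: (e \in E); last by rewrite mul0n.
by rewrite mul1n; elim: N => [//|N IH]; rewrite !exprS OvalM IH.
Qed.

Lemma nedges_set_graph k (E : {set 'I_k * 'I_k}) : tadpole_free E -> nedges (set_graph E 1) = #|E|.
Proof.
move=> Eirr; rewrite /nedges -sum1_card [RHS]big_mkcond /=; apply: eq_bigr => e _.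
by rewrite mult_set_graph // muln1; case: (e \in E).
Qed.

(** Over a common denominator, the inner poles go to the blocks, the crossing poles and the
    polynomial numerator to g. *)
Lemma alg_decompose E (f : O M) : tadpole_free E -> alg (poles E) (Oval f) ->
  exists (g : O M) (fs : forall i, O (m i)), [/\ f = g * blockprod fs,
    alg (poles (cross_edges (set_graph E 1))) (Oval g) &
    forall i, alg (poles (esupp (inner_graph (set_graph E 1) i))) (Oval (fs i))].
Proof.
move=> Eirr Ef; have [N [a [Pa Ea]]] := alg_mono Eirr Ef.
have Oa : a \in @Ostar_pred F M by apply: alg_Ostar Pa.
(* The exponents are N, but the conclusion uses the graph with simple edges: the filtration counts
   polar divisors, not their orders. *)
pose G := set_graph E N; exists (mkO a * cross_part G), (fun i => pfun F (inner_graph G i)).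
have sub e : (0 < mult G e)%N -> (0 < mult (set_graph E 1) e)%N.
  by rewrite !mult_set_graph //; case: (e \in E).
split.
- rewrite -mulrA -pfun_block; apply: Oval_inj.
  by rewrite OvalM Oval_mkO // pfun_set_graph.
- have H1 : alg (poles (cross_edges (set_graph E 1))) (Oval (mkO a)).
    by rewrite Oval_mkO //; apply: alg_poly.
  apply: OalgM H1 _; apply: alg_sub (alg_cross_part G) => i j; rewrite /poles !inE => /andP[ij ->].
  by rewrite andbT sub.
- move=> i; apply: alg_sub (alg_pfun F (inner_graph G i)) => k l; rewrite /poles !inE !mult_inner => kl.
  by rewrite sub.
Qed.

End BlockDecomposition.

(** * Compositions and the filtration *)

Section CompositionFiltration.
Variables (F : fieldType) (V : superspace F) (d : {linear V -> V}).
Hypothesis d_even : forall b v, d (ss_par V b v) = ss_par V b (d v).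
Local Notation Q n := (Q n d).
Local Notation Pch n := (Pch d n).
Local Notation O n := (Ostar F n).
Variables (n : nat) (m : 'I_n -> nat).
Local Notation M := (\sum_i m i)%N.
Local Notation blk := (@tagnat.sig1 n m).
Variables (Y : Pch n) (X : forall i, Pch (m i)) (s : nat) (r : 'I_n -> nat).
Hypotheses (Y_fil : ch_fil s Y) (X_fil : forall i, ch_fil (r i) (X i)).

(** The derivatives of g keep its poles along the crossing edges, and identifying the variables of
    each block places them along the collapsed graph. *)
Lemma comp_eval_vanish (G : graph M) w (g : O M) :
  (forall f, alg (poles (esupp (collapse G))) (Oval f) -> kills Y f) ->
  alg (poles (cross_edges G)) (Oval g) -> comp_eval Y w g = 0.
Proof.
move=> HY; elim/VLfam_ind: w g => [v|i w w' w'' E E' Ei IH IH'|i a w w' E Ei IH] g Gg.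
- by rewrite comp_eval_const /comp_base HY ?linear0 //; apply: alg_collapse.
- by rewrite (comp_eval_lin (c := 1) _ E E') ?scale1r // funDE IH // IH' // addr0.
- rewrite (comp_eval_lam _ E Ei) /comp_op !IH ?qlam0 ?subrr // Oval_deriv.
  exact: alg_rderiv.
Qed.

Lemma ch_comp_val_vanish (G : graph M) v (g : O M) f :
  alg (poles (cross_edges G)) (Oval g) ->
  (forall i, alg (poles (esupp (inner_graph G i))) (Oval (f i))) ->
  [\/ exists i, (nedges (inner_graph G i) < r i)%N, (nedges (collapse G) < s)%N |
      nedges (collapse G) = s /\ ~ acyclic (collapse G)] ->
  ch_comp_val Y X v g f = 0.
Proof.
move=> Gg Gf H; rewrite ch_comp_valE //; apply: big1 => p _; apply: big1 => q _.
suff -> : comp_val Y (parX p q X) (parv p v) g f = 0 by rewrite scaler0.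
case: H => [[i ri]|Gs|[Gs nac]].
- apply: (evQ_zero _ (i := i)); first exact: cross_edges_crossing Gg.
  rewrite /comp_vals /parX ch_parqE // X_fil ?linear0 //.
  exact: alg_Ofil_pred (@esupp_tadpole _ _) (leq_ltn_trans (card_esupp _) ri) (Gf i).
- apply: (comp_eval_vanish (G := G)) => // f' Gf' u; apply: Y_fil.
  exact: alg_Ofil_pred (@esupp_tadpole _ _) (leq_ltn_trans (card_esupp _) Gs) Gf'.
- apply: (comp_eval_vanish (G := G)) => // f' Gf' u; apply: Y_fil; rewrite -Gs.
  exact: cyclic_Ofil_pred.
Qed.

(** With fewer than s + sum r_i divisors, either fewer than s join different blocks or some block i
    contains fewer than r_i. *)
Lemma ch_comp_fil : ch_fil (s + \sum_i r i) (ch_comp Y X).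
Proof.
move=> v f; case E : (s + \sum_i r i)%N => [|t] /= tf.
  have -> : f = 0 by apply: Oval_inj; exact: tf.
  exact: ch0.
move: f tf v; apply: (Ofil_ind (S := kills (ch_comp Y X))).
- exact: kills0.
- exact: killsD.
move=> f /piece_alg[A [Airr At Af]] v.
have [g [fs [-> Gg Gf]]] := alg_decompose Airr Af.
rewrite ch_compE //; last exact: cross_edges_crossing Gg.
apply: ch_comp_val_vanish Gg Gf _.
have := nedges_block (set_graph A 1); rewrite nedges_set_graph // => HA.
have [|Gs] := ltnP (nedges (collapse (set_graph A 1))) s; first by constructor 2.
have [/existsP Hi|] := boolP [exists i, nedges (inner_graph (set_graph A 1) i) < r i]%N.
  by constructor 1.
rewrite negb_exists => /forallP Hi; have : (#|A| < s + \sum_i r i)%N by rewrite E.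
rewrite HA ltnNge leq_add // leq_sum // => i _; by rewrite leqNgt.
Qed.

End CompositionFiltration.

(** * Compositions in the classical operad *)

Section Reached.
Variables (n : nat) (m : 'I_n -> nat).
Local Notation M := (\sum_i m i)%N.
Local Notation blk := (@tagnat.sig1 n m).
Variable G : graph M.
Hypothesis acG : acyclic (collapse G).
Local Notation D := (collapse G).

Lemma walk_cat i (s1 s2 : seq (step n)) j :
  walk i (s1 ++ s2) j = walk i s1 (last i [seq step_tgt a | a <- s1]) &&
                        walk (last i [seq step_tgt a | a <- s1]) s2 j.
Proof.
elim: s1 i => [i|a s1 IH i] /=; first by rewrite eqxx.
by rewrite IH andbA.
Qed.

Lemma upath_cat i (s1 s2 : seq (step n)) j : upath D i (s1 ++ s2) j ->
  exists k, upath D i s1 k /\ upath D k s2 j.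
Proof.
rewrite /upath walk_cat => /andP[/andP[w1 w2] /forallP c12].
exists (last i [seq step_tgt a | a <- s1]); rewrite w1 w2 /=.
by split; apply/forallP => e; apply: leq_trans (c12 e); rewrite count_cat ?leq_addr ?leq_addl.
Qed.

Lemma not_reached_self k : ~ reached_from G k (blk k).
Proof. by case=> e [s [/acG]]. Qed.

Lemma collapse_gt1 (e e' : 'I_M * 'I_M) : e != e' -> (0 < mult G e)%N -> (0 < mult G e')%N ->
  blk e.1 != blk e.2 -> blk e'.1 = blk e.1 -> blk e'.2 = blk e.2 ->
  (1 < mult D (blk e.1, blk e.2))%N.
Proof.
move=> ee' e0 e'0 be b1 b2; rewrite mult_collapse /= (negPf be) pair_big /=.
rewrite (bigD1 e) ?eqxx //= (bigD1 e') /=; last by rewrite b1 b2 !eqxx eq_sym.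
rewrite -!surjective_pairing; apply: leq_trans (leq_add e0 (leqnn _)) => //.
by rewrite add1n ltnS ltn_addr.
Qed.

(* [a] and [b] are the endpoints of an edge of G between two blocks, and [st] is the step
   of the collapsed graph along this edge, from the block of [a] to the block of [b]. *)
Lemma reached_step k a b (st : step n) (e : 'I_M * 'I_M) : e \in cross_edges G ->
  (e = (a, b) /\ st = ((blk a, blk b), true)) \/ (e = (b, a) /\ st = ((blk b, blk a), false)) ->
  b != k -> reached_from G k (blk a) -> reached_from G k (blk b).
Proof.
move=> eG est bk [e0 [s [us fe0]]].
have stG : (0 < mult D st.1)%N.
  have := cross_edges_collapse eG; rewrite inE.
  by case: est => [] [-> ->].
have st1 := acyclic_mult1 acG stG.
have [ssrc stgt] : step_src st = blk a /\ step_tgt st = blk b by case: est => [] [_ ->].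
(* If the path to the block of a does not use this edge, the path is prolonged by it. *)
have [|nst] := boolP (has (fun x : step n => x.1 == st.1) (e0 :: s)); last first.
  exists e0, (rcons s st); split=> //; rewrite -rcons_cons -cats1.
  have /andP[ws /forallP cs] := us.
  rewrite /upath walk_cat; have wl : last (blk k) [seq step_tgt x | x <- e0 :: s] = blk a.
    have : walk (blk k) ((e0 :: s) ++ [::]) (blk a) by rewrite cats0.
    by rewrite walk_cat /= => /andP[_ /eqP].
  rewrite wl ws /= ssrc stgt !eqxx /=; apply/forallP => e'; rewrite count_cat [count _ [:: st]]/= addn0.
  have [<-|_] := eqVneq st.1 e'; last by rewrite addn0; apply: cs.
  move: nst; rewrite has_count -leqNgt leqn0 /= => /eqP n0.
  by rewrite addnA n0; apply: stG.
case/hasP=> x xs /eqP xst; have [p1 [p2 Ep]] : exists p1 p2, e0 :: s = p1 ++ x :: p2.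
  by case/path.splitPr: xs => p1 p2; exists p1, p2.
move: us; rewrite Ep => /upath_cat[c [u1 u2]].
have [csrc u3] : c = step_src x /\ upath D (step_tgt x) p2 (blk a).
  have := u2; rewrite -cat1s => /upath_cat[c' [+ u3]].
  by rewrite {1}/upath /= => /andP[/andP[/eqP -> /eqP ->] _].
have xdir : x = st \/ (step_src x = step_tgt st /\ step_tgt x = step_src st).
  case: x xst {xs Ep u2 csrc u3} => [x1 []]; case: st {est stG st1 ssrc stgt} => [st1 []] /= ->;
    rewrite /step_src /step_tgt /=; by [left|right].
(* In the direction of [st], the edge leaves the block of a, so the rest of the path returns to its
   starting point, against acyclicity. *)
case: xdir => [xE|[xsrc xtgt]].
  by rewrite csrc xE ssrc in u2; have := acG u2.
(* In the opposite direction the edge is the last step, and the path before it ends in the block of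
   b. *)
move: u3; rewrite xtgt ssrc => /acG p20; subst p2.
rewrite csrc xsrc stgt in u1.
case: p1 Ep u1 => [[e0x _] /andP[/= /eqP bkb _]|e0' p1 [e0E _] u1]; last first.
  by subst e0'; exists e0, p1.
(* If nothing precedes it, k lies in the block of b and the first step comes from an edge at k; as k
   differs from b, this is a second edge between the same blocks, impossible in an acyclic collapsed
   graph. *)
exfalso; case: fe0 => l [lt l0].
rewrite e0x xtgt ssrc in lt; rewrite e0x in l0.
have ab : blk a != blk b by move: eG; rewrite inE; case: est => [] [-> _] /andP[_] //; rewrite eq_sym.
case: est => [] [Ee Est]; subst e st.
- have x2 : x.2 = false.
    by apply/negP => x2; move: xsrc; rewrite /step_src xst x2 /step_tgt /= => /eqP; rewrite (negPf ab).
  rewrite x2 in l0; have : (1 < mult D (blk a, blk b))%N.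
    apply: (@collapse_gt1 (a, b) (l, k)) => //=; last 2 first.
    + by rewrite xpair_eqE eq_sym (negPf bk) ?andbF // eq_sym.
    + by move: eG; rewrite !inE => /andP[].
  by rewrite st1.
- have x2 : x.2 = true.
    apply/negPn/negP => /negPf x2; move: xsrc; rewrite /step_src xst x2 /step_tgt /= => /eqP.
    by rewrite (negPf ab).
  rewrite x2 in l0; have : (1 < mult D (blk b, blk a))%N.
    apply: (@collapse_gt1 (b, a) (k, l)) => //=; first by rewrite xpair_eqE (negPf bk).
    + by move: eG; rewrite !inE => /andP[].
    + by rewrite eq_sym.
  by rewrite st1.
Qed.

Lemma asbool_reached_self k : `[< reached_from G k (blk k) >] = false.
Proof. by apply/asboolP; apply: not_reached_self. Qed.

(** If k is one end of the edge, the other block is reached through this edge and its own block is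
    not reached; otherwise both blocks are reached or neither is. This is the equality of
    coefficients behind [Osubst_deriv]. *)
Lemma reached_edge k (a b : 'I_M) : (a, b) \in cross_edges G ->
  ((k == a) + `[< reached_from G k (blk a) >])%N = ((k == b) + `[< reached_from G k (blk b) >])%N.
Proof.
move=> abG; have /[!inE]/andP[ab0 /= bab] := abG.
have abD := cross_edges_collapse abG; rewrite inE /= in abD.
have [ka|ka] := eqVneq k a.
  subst k; rewrite asbool_reached_self; have -> : (a == b) = false by apply: contraNF bab => /eqP ->.
  have -> // : `[< reached_from G a (blk b) >].
  apply/asboolP; exists ((blk a, blk b), true), [::]; split; last first.
    by exists b; rewrite /step_tgt.
  rewrite /upath /= /step_src /step_tgt /= !eqxx /=; apply/forallP => e.
  by rewrite addn0; case: eqP => // <-.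
have [kb|kb] := eqVneq k b.
  subst k; rewrite asbool_reached_self; have -> // : `[< reached_from G b (blk a) >].
  apply/asboolP; exists ((blk a, blk b), false), [::]; split; last first.
    by exists a; rewrite /step_tgt.
  rewrite /upath /= /step_src /step_tgt /= !eqxx /=; apply/forallP => e.
  by rewrite addn0; case: eqP => // <-.
congr (_ + nat_of_bool _)%N; apply/asboolP/asboolP.
  by apply: (reached_step abG); [left; split; reflexivity|rewrite eq_sym].
by apply: (reached_step abG); [right; split; reflexivity|rewrite eq_sym].
Qed.

End Reached.

(** * Comparison of the operators lambda_k - d/dz_k and lambda_k + X(k) *)

Section ClassicalComposition.
Variables (F : fieldType) (V : superspace F) (d : {linear V -> V}).
Local Notation Q n := (Q n d).
Local Notation Pch n := (Pch d n).
Local Notation O n := (Ostar F n).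
Variables (n : nat) (m : 'I_n -> nat).
Local Notation M := (\sum_i m i)%N.
Local Notation blk := (@tagnat.sig1 n m).
Local Notation Rk := (@tagnat.Rank n m).

Lemma opX_rel N (W1 W2 : Type) (R : W1 -> W2 -> Prop) (T1 : 'I_N -> W1 -> W1)
    (T2 : 'I_N -> W2 -> W2) mu x y :
  (forall k x y, R x y -> R (T1 k x) (T2 k y)) -> R x y -> R (opX T1 mu x) (opX T2 mu y).
Proof.
move=> RT Rxy; rewrite /opX; elim: (enum _) => [//|k s IH] /=.
by elim: (mu k) => [//|r IHr] /=; apply: RT.
Qed.

Lemma Osubst_cross_part (G : graph M) : Osubst blk (cross_part F G) = pfun F (collapse G).
Proof.
have H (S : pred ('I_M * 'I_M)) : (forall e, S e -> blk e.1 != blk e.2) ->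
    Osubst blk (\prod_(e | S e) OzV F e.1 e.2 ^+ mult G e) =
      \prod_(e | S e) OzV F (blk e.1) (blk e.2) ^+ mult G e /\
    crossing blk (\prod_(e | S e) OzV F e.1 e.2 ^+ mult G e).
  move=> Sb; apply: (big_ind2 (fun x y => Osubst blk x = y /\ crossing blk x)).
  - by split; [apply: Osubst1|apply: alg1].
  - move=> x1 y1 x2 y2 [E1 c1] [E2 c2]; split; last exact: crossingM.
    by rewrite OsubstM // E1 E2.
  move=> e /Sb be; elim: (mult G e) => [|k [IH ck]]; first by split; [apply: Osubst1|apply: alg1].
  have cz := crossing_zV F be.
  by rewrite !exprS; split; [rewrite OsubstM // IH Osubst_zV|apply: crossingM].
rewrite /cross_part (H _ _).1 // /pfun.
rewrite (partition_big (fun e => (blk e.1, blk e.2)) (fun ij => ij.1 != ij.2)) //=.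
rewrite [RHS](bigID (fun ij : 'I_n * 'I_n => ij.1 != ij.2)) /= [X in _ = _ * X]big1 ?mulr1.
  apply: eq_bigr => -[i j] /= ij; rewrite mult_collapse /= (negPf ij) pair_big /=.
  rewrite -prodrXr; apply: eq_big => [[k l]|[k l] /andP[_ /eqP[-> ->]]] //=.
  rewrite xpair_eqE.
  by case: (blk k =P i) => [->|_]; case: (blk l =P j) => [->|_]; rewrite ?andbF ?ij.
by move=> ij; rewrite negbK => ij0; rewrite mult_collapse ij0.
Qed.

Variable G : graph M.
Hypothesis acG : acyclic (collapse G).

(** Only inverses along crossing edges generate it, since [Osubst_deriv] can fail on other
    functions: on z_ij with k = i for a graph without edges, where no block is reached. It is stable
    under derivatives, which is what the induction on monomials needs. *)
Inductive edge_alg : O M -> Prop :=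
  | edge_alg1 : edge_alg 1
  | edge_algV e of e \in cross_edges G : edge_alg (OzV F e.1 e.2)
  | edge_algZ c f of edge_alg f : edge_alg (c *: f)
  | edge_algD f g of edge_alg f & edge_alg g : edge_alg (f + g)
  | edge_algM f g of edge_alg f & edge_alg g : edge_alg (f * g).

Lemma edge_alg_crossing f : edge_alg f -> crossing blk f.
Proof.
elim=> [|e eG|c g _ IH|g h _ IHg _ IHh|g h _ IHg _ IHh].
- exact: alg1.
- by apply: crossing_zV; move: eG; rewrite inE => /andP[].
- exact: crossingZ.
- exact: crossingD.
- exact: crossingM.
Qed.

Lemma Oderiv_zV N (k i j : 'I_N) : Oderiv k (OzV F i j) = - delta_diff F k i j *: OzV F i j ^+ 2.
Proof.
apply: Oval_inj; rewrite Oval_deriv OvalZ /= rderivV rderiv_rz scaler_rconst /delta_diff.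
rewrite -exprVn; congr (_ * _); rewrite /rconst mpolyCN rpolyN mpolyCB rpolyB.
by do 2 case: (k == _); rewrite ?rpoly0 ?rpoly1.
Qed.

Lemma edge_alg_deriv k f : edge_alg f -> edge_alg (Oderiv k f).
Proof.
elim=> [|e eG|c g _ IH|g h _ IHg _ IHh|g h Eg IHg Eh IHh].
- by rewrite Oderiv1 -(scale0r (1 : O M)); apply/edge_algZ/edge_alg1.
- by rewrite Oderiv_zV expr2; apply: edge_algZ; apply: edge_algM; apply: edge_algV.
- by rewrite OderivZ; apply: edge_algZ.
- by rewrite OderivD; apply: edge_algD.
- by rewrite OderivM; apply: edge_algD; apply: edge_algM.
Qed.

Lemma edge_alg_cross_part : edge_alg (cross_part F G).
Proof.
apply: (big_ind edge_alg) => [|x y|e be]; [exact: edge_alg1|exact: edge_algM|].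
have [->|e0] := posnP (mult G e); first exact: edge_alg1.
have eG : e \in cross_edges G by rewrite !inE e0.
elim: (mult G e) => [|k IH]; first exact: edge_alg1.
by rewrite exprS; apply: edge_algM IH; apply: edge_algV.
Qed.

Local Notation reached k j := `[< reached_from G k j >].

(* On the inverse of z_a - z_b, for an edge from a to b between two blocks, both sides
   compare through [reached_edge]. *)
Lemma Osubst_deriv k f : edge_alg f ->
  Osubst blk (Oderiv k f) = - \sum_(j | reached k j) Oderiv j (Osubst blk f).
Proof.
elim=> [|e eG|c g Eg IH|g h Eg IHg Eh IHh|g h Eg IHg Eh IHh].
- rewrite Oderiv1 Osubst1; have -> : \sum_(j | reached k j) Oderiv j (1 : O n) = 0.
    by apply: big1 => j _; apply: Oderiv1.
  rewrite oppr0.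
  by rewrite -(scale0r (1 : O M)) OsubstZ ?scale0r //; apply: alg1.
- have be : blk e.1 != blk e.2 by move: eG; rewrite inE => /andP[].
  have cz := crossing_zV F be.
  rewrite Oderiv_zV OsubstZ; last exact: crossingM.
  rewrite expr2 OsubstM // -expr2 Osubst_zV //.
  rewrite (eq_bigr _ (fun j _ => Oderiv_zV j _ _)) -scaler_suml -scaleNr; congr (_ *: _).
  rewrite sumrN opprK /delta_diff sumrB !sumr_pred1.
  case: e eG {be cz} => a b eG; have /(congr1 (fun k : nat => k%:R : F)) := reached_edge acG k eG.
  rewrite !natrD => /eqP; rewrite -subr_eq0 => /eqP E.
  have solve (x y z w : F) : x + z - (y + w) = 0 -> - (x - y) = z - w.
    by move=> H; apply/eqP; rewrite -subr_eq0 -oppr_eq0 -H; apply/eqP; ring.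
  exact: solve E.
- have cg := edge_alg_crossing Eg; rewrite OderivZ !OsubstZ //; last exact: crossing_deriv.
  by rewrite IH scalerN scaler_sumr; congr (- _); apply: eq_bigr => j _; rewrite OderivZ.
- have cg := edge_alg_crossing Eg; have ch := edge_alg_crossing Eh.
  rewrite OderivD !OsubstD //; try exact: crossing_deriv.
  by rewrite IHg IHh -opprD -big_split; congr (- _); apply: eq_bigr => j _; rewrite OderivD.
- have cg := edge_alg_crossing Eg; have ch := edge_alg_crossing Eh.
  have cdg := crossing_deriv k cg; have cdh := crossing_deriv k ch.
  rewrite OderivM OsubstD; try exact: crossingM.
  rewrite !OsubstM // IHg IHh mulNr mulrN -opprD mulr_suml mulr_sumr -big_split.
  by congr (- _); apply: eq_bigr => j _; rewrite OderivM.
Qed.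

Local Notation value := (('I_n -> V) -> Q M).

Lemma cl_x_op j k (A B : value) u :
  cl_x j (fun u => qlam k (A u) - B u) u = qlam k (cl_x j A u) - cl_x j B u.
Proof.
rewrite /cl_x qlamD opprD addrACA; congr (_ + _).
rewrite linear_sum -sumrB; apply: eq_bigr => l _.
by rewrite qlamB qlamC.
Qed.

(* The operators lambda_k - d/dz_k acting on functions h of the edges between blocks agree
   with lambda_k + X(k) acting on the arguments u. *)
Definition compatible (B : ('I_n -> V) -> O M -> Q M) := forall u h k, edge_alg h ->
  - B u (Oderiv k h) = \sum_(j | reached k j) cl_x j (fun u => B u h) u.

(** By [Osubst_deriv] the derivative becomes minus a sum of derivatives of the substituted function,
    and sesquilinearity of Y turns each of them into Lambda_j + d_j. *)
Lemma compatible_base (Y : Pch n) : compatible (comp_base Y).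
Proof.
move=> u h k Eh; rewrite /comp_base Osubst_deriv // chN linearN opprK ch_sum linear_sum.
apply: eq_bigr => j _; rewrite ch_deriv linearD /= addrC /cl_x; congr (_ + _).
by rewrite qsubst_lam.
Qed.

Lemma compatible_op B l : compatible B -> compatible (fun u => comp_op l (B u)).
Proof.
move=> cB u h k Eh; rewrite /comp_op; set A := fun u => B u h; set A' := fun u => B u (Oderiv l h).
rewrite (eq_bigr _ (fun j _ => cl_x_op j l A A' u)) sumrB -linear_sum -!cB //; last first.
  exact: edge_alg_deriv.
by rewrite linearN opprD (OderivC k l).
Qed.

Lemma opX_compatible (Y : Pch n) mu u h : edge_alg h ->
  opX (@comp_op F V d n m) mu (comp_base Y u) h =
  opX (cl_lam G) mu (fun u => comp_base Y u h) u.
Proof.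
(* One side acts on functions of h with u fixed, the other on functions of u with h fixed; they are
   compared on functions of both. *)
move=> Eh; pose T1 k (B : ('I_n -> V) -> O M -> Q M) := fun u => comp_op k (B u).
have E1 : opX T1 mu (comp_base Y) u = opX (@comp_op F V d n m) mu (comp_base Y u).
  by apply: (opX_rel (R := fun B A => B u = A)) => // k B A <-.
rewrite -E1; set C := opX T1 mu _; set A := opX _ mu _.
suff [_ ->] : compatible C /\ A = fun u => C u h by [].
apply: (opX_rel (R := fun B A => compatible B /\ A = fun u => B u h)).
  move=> k B _ [cB ->]; split; first exact: compatible_op.
  by apply/funext => w; rewrite /cl_lam /T1 /comp_op -cB.
by split=> //; apply: compatible_base.
Qed.

Lemma cl_comp_val_acyclic (Y : Pch n) (X : forall i, Pch (m i)) (f : Pcl d n)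
    (g : forall i, Pcl d (m i)) v :
  (forall u, f (collapse G) u = Y u (pfun F (collapse G))) ->
  (forall i u, g i (inner_graph G i) u = X i u (pfun F (inner_graph G i))) ->
  cl_comp_val f g G v =
  ch_comp_val Y X v (cross_part F G) (fun i => pfun F (inner_graph G i)).
Proof.
move=> fY gX; rewrite /cl_comp_val asboolT //; apply: eq_bigr => p _; apply: eq_bigr => q _.
congr (_ *: _); pose u i (a : 'I_(m i)) := ss_par V (p (Rk i a)) (v (Rk i a)).
pose val (z : forall i, Q (m i)) : Q M := \sum_(mu \in [set: 'X_{1..M}])
  opX (cl_lam G) mu (fun u => qsubst blk (f (collapse G) u))
    (fun i => rep (qpar (q i (+) block_par p i) (z i)) (mblock mu i)).
have Ez : (fun i => g i (inner_graph G i) (u i)) = (fun i => X i (u i) (pfun F (inner_graph G i))).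
  by apply: functional_extensionality_dep => i; rewrite gX.
transitivity (val (fun i => g i (inner_graph G i) (u i))); first by [].
rewrite Ez /val; apply: eq_fsbigr => mu _.
have -> : (fun u => qsubst blk (f (collapse G) u)) = (fun u => comp_base Y u (cross_part F G)).
  by apply/funext => z; rewrite fY /comp_base Osubst_cross_part.
by rewrite -opX_compatible //; apply: edge_alg_cross_part.
Qed.

End ClassicalComposition.

(** * Compositions of graded elements *)

Section GradedComposition.
Variables (F : fieldType) (V : superspace F) (d : {linear V -> V}).
Hypothesis d_even : forall b v, d (ss_par V b v) = ss_par V b (d v).
Local Notation Q n := (Q n d).
Local Notation Pch n := (Pch d n).
Local Notation O n := (Ostar F n).
Variables (n : nat) (m : 'I_n -> nat).
Local Notation M := (\sum_i m i)%N.
Variables (y : grPch d n) (x : forall i, grPch d (m i)).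

Let Y s := gr_rep (ds_val y s).
Let X (r : 'I_n -> nat) i := gr_rep (ds_val (x i) (r i)).

Let comp_fil s (r : 'I_n -> nat) : ch_fil (s + \sum_i r i) (ch_comp (Y s) (X r)).
Proof. by apply: ch_comp_fil => // [|i]; apply: gr_rep_fil. Qed.

(** The chosen representative of the zero class need not be zero, but it lies one step deeper in the
    filtration. *)
Lemma ch_fil_gr_rep0 k r : ch_fil r.+1 (gr_rep (0 : gr d r k)).
Proof. by move=> v f rf; apply: gr_rep0. Qed.

(** [mkdsum] asks for finite support: in large total degree some component of y or of an x_i is
    zero, its representative lies one step deeper, and so does the composition. *)
Lemma gr_comp_val t : ds_val (gr_comp y x) t = \sum_(s < t.+1)
    \sum_(r : {ffun 'I_n -> 'I_t.+1} | (s + \sum_i r i == t)%N)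
      gr_cls t (ch_comp (Y s) (X (fun i => r i))).
Proof.
rewrite /gr_comp mkdsumE //; apply/asboolP.
have [Ny HNy] : exists N, forall s, (N <= s)%N -> ds_val y s = 0 by case: y => z /= /asboolP.
have /choice[N HN] i : exists N, forall s, (N <= s)%N -> ds_val (x i) s = 0.
  by case: (x i) => z /= /asboolP.
exists (Ny + \sum_i N i)%N => t' Nt; apply: big1 => s _; apply: big1 => r /eqP Er.
suff H : ch_fil (s + \sum_i r i).+1 (ch_comp (Y s) (X (fun i => r i))).
  by apply: gr_cls_eq0; move: H; rewrite Er.
rewrite -{}Er in Nt.
have [Ns|sN] := leqP Ny s.
  rewrite -addSn; apply: ch_comp_fil => // [|i]; last exact: gr_rep_fil.
  by rewrite /Y HNy //; apply: ch_fil_gr_rep0.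
have [i Ni] : exists i, (N i <= r i)%N.
  apply/existsP; apply: contraTT Nt; rewrite negb_exists => /forallP H.
  rewrite -ltnNge -addSn leq_add //; apply: leq_sum => i _.
  by apply: ltnW; rewrite ltnNge.
(* The additional degree is credited to the i-th factor. *)
have -> : (s + \sum_i r i).+1 = (s + \sum_j (r j + (j == i)))%N.
  rewrite big_split /= -addnS; congr (_ + _)%N; rewrite -addn1; congr (_ + _)%N.
  by rewrite (bigD1 i) //= eqxx big1 // => j /negPf ->.
apply: ch_comp_fil => // [|j]; first exact: gr_rep_fil.
case: eqP => [->|_]; last by rewrite addn0; apply: gr_rep_fil.
by rewrite addn1 /X HN //; apply: ch_fil_gr_rep0.
Qed.

Lemma gr_rep_sum r k (I : Type) (s : seq I) (P : pred I) (f : I -> gr d r k) v (g : O k) :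
  Ofil r (Oval g) -> gr_rep (\sum_(i <- s | P i) f i) v g = \sum_(i <- s | P i) gr_rep (f i) v g.
Proof.
move=> rg; apply: (big_morph (fun z : gr d r k => gr_rep z v g)); last exact: gr_rep0.
by move=> a b; have := gr_rep_lin 1 a b v rg; rewrite !scale1r.
Qed.

(** At a given graph only the degrees equal to the edge numbers of the collapsed and of the inner
    graphs contribute: for other degrees with the same sum, one factor has a degree exceeding its
    number of edges and vanishes there. *)
Lemma gr_to_cl_comp :
  gr_to_cl (gr_comp y x) = cl_comp (gr_to_cl y) (fun i => gr_to_cl (x i)).
Proof.
rewrite /cl_comp; set f := cl_comp_val _ _.
suff -> : f = gr_to_cl (gr_comp y x).
  by apply: PclP => G v; rewrite mkPclE //; apply: is_clP.
apply/funext => G; apply/funext => v; rewrite gr_to_clE; set t := nedges G.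
have tG : Ofil t (Oval (pfun F G)) by apply: pfun_Ofil.
rewrite gr_comp_val gr_rep_sum //.
pose s0 := nedges (collapse G); pose r0 i := nedges (inner_graph G i).
have Et : t = (s0 + \sum_i r0 i)%N by apply: nedges_block.
pose val s (r : 'I_n -> nat) := ch_comp_val (Y s) (X r) v (cross_part F G)
  (fun i => pfun F (inner_graph G i)).
have term s (r : 'I_n -> nat) : (s + \sum_i r i)%N = t ->
    gr_rep (gr_cls t (ch_comp (Y s) (X r))) v (pfun F G) = val s r.
  move=> st; rewrite gr_clsE -?st //; last by rewrite st.
  rewrite pfun_block ch_compE //.
  exact: cross_edges_crossing (alg_cross_part F G).
have vanish s (r : 'I_n -> nat) : (s + \sum_i r i)%N = t -> (s != s0) || [exists i, r i != r0 i] ->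
    val s r = 0.
  move=> st ne; have HX i : ch_fil (r i) (X r i) by apply: gr_rep_fil.
  apply: (ch_comp_val_vanish d_even (gr_rep_fil (ds_val y s)) HX _ (alg_cross_part F G)) => [i|].
    exact: alg_pfun.
  have [s0s|] := ltnP s0 s; first by constructor 2.
  have [/existsP Hi|] := boolP [exists i, r0 i < r i]%N; first by constructor 1.
  rewrite negb_exists => /forallP Hr ss0; exfalso.
  have {}Hr i : (r i <= r0 i)%N by rewrite leqNgt.
  have Hs : (\sum_i r i <= \sum_i r0 i)%N by apply: leq_sum => i _.
  have [es er] : s = s0 /\ (\sum_i r i = \sum_i r0 i)%N by move: st; rewrite Et; lia.
  case/orP: ne => [|/existsP[i]]; first by rewrite es eqxx.
  apply/negP; rewrite negbK; have /leqif_sum : forall i, true -> (r i <= r0 i ?= iff (r i == r0 i))%N.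
    by move=> j _; split.
  by case=> _; rewrite er eqxx => /esym/forall_inP/(_ i isT).
have st0 : (s0 < t.+1)%N by rewrite ltnS Et leq_addr.
have rt0 i : (r0 i < t.+1)%N.
  by rewrite ltnS Et (bigD1 i) //= addnCA leq_addr.
pose s1 := Ordinal st0; pose r1 := [ffun i => Ordinal (rt0 i)].
have Er1 i : r1 i = r0 i :> nat by rewrite ffunE.
have st1 : (s1 + \sum_i r1 i == t)%N.
  have -> : (\sum_i r1 i = \sum_i r0 i)%N by apply: eq_bigr => i _; apply: Er1.
  by apply/eqP; symmetry.
rewrite (bigD1 s1) //= [X in _ + X]big1 ?addr0; last first.
  move=> s ss1; rewrite gr_rep_sum //; apply: big1 => r /eqP st.
  rewrite (term s (fun i => r i)) // vanish //.
  by apply/orP; left; apply: contraNneq ss1 => /= e; apply/eqP/val_inj.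
rewrite gr_rep_sum // (bigD1 r1) //= [X in _ + X]big1 ?addr0; last first.
  move=> r /andP[/eqP st rr1]; rewrite (term s1 (fun i => r i)) // vanish //; apply/orP; right.
  apply: contraNT rr1; rewrite negb_exists => /forallP H; apply/eqP/ffunP => i.
  apply: val_inj; apply: etrans (esym (Er1 i)); apply/eqP; rewrite -[_ == _]negbK; exact: H.
rewrite (term s1 (fun i => r1 i)); last exact/eqP.
have -> : val s1 (fun i => r1 i) = val s0 r0.
  have EX : X (fun i => r1 i) = X r0.
    by apply: functional_extensionality_dep => i; rewrite /X Er1.
  by rewrite /val EX.
(* If the collapsed graph has a cycle, the classical composition is 0 by definition and the chiral
   one by [cyclic_Ofil_pred]. *)
have [acG|nacG] := pselect (acyclic (collapse G)).
  apply: (cl_comp_val_acyclic acG) => [u|i u]; rewrite gr_to_clE //.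
rewrite /f /cl_comp_val asboolF //; symmetry.
have HX i : ch_fil (r0 i) (X r0 i) by apply: gr_rep_fil.
apply: (ch_comp_val_vanish d_even (gr_rep_fil (ds_val y s0)) HX _ (alg_cross_part F G)) => [i|].
  exact: alg_pfun.
by constructor 3.
Qed.

End GradedComposition.

(** * Surjectivity for at most two inputs *)

Section SmallArity.
Variables (F : fieldType) (V : superspace F) (d : {linear V -> V}).
Local Notation Q n := (Q n d).
Local Notation Pch n := (Pch d n).
Local Notation Pcl n := (Pcl d n).
Local Notation O n := (Ostar F n).

(** If A is the value on a function f, this is the value forced on its i-th derivative. *)
Definition sesqui_defect n (i : 'I_n) (A : ('I_n -> V) -> Q n) : ('I_n -> V) -> Q n :=
  fun v => A [eta v with i |-> d (v i)] + qlam i (A v).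

Lemma ord_eq n (i j : 'I_n) : (n <= 1)%N -> i = j.
Proof. by move=> n1; apply/val_inj; case: i j => i /= ? [j /= ?]; lia. Qed.

Lemma rconst_inj n : injective (@rconst F n).
Proof.
move=> a b /rpoly_inj /eqP; by rewrite mpolyC_eq => /eqP.
Qed.

Lemma OscaleI n : injective (fun c : F => c *: (1 : O n)).
Proof.
move=> a b /(congr1 (@Oval F n)); rewrite !OvalZ !scaler_rconst !mulr1.
exact: rconst_inj.
Qed.

Lemma Ostar_small n (f : O n) : (n <= 1)%N -> exists c, f = c *: (1 : O n).
Proof.
move=> n1; elim/Ostar_ind: f => [c|i j|i j|f g [a ->] [b ->]|f g [a ->] [b ->]].
- by exists c.
- by exists 0; rewrite scale0r (ord_eq i j n1); apply: Oval_inj; rewrite /= rzii.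
- by rewrite (ord_eq i j n1) ltnn.
- by exists (a + b); rewrite scalerDl.
- by exists (a * b); rewrite -OscaleAl mul1r scalerA.
Qed.

Lemma ch_small n (A : ('I_n -> V) -> Q n) : (n <= 1)%N -> multilinear A ->
  (forall i v, sesqui_defect i A v = 0) -> exists X : Pch n, forall v, X v 1 = A v.
Proof.
move=> n1 linA dA; have /choice[c Hc] := fun f : O n => Ostar_small f n1.
have cE f a : f = a *: (1 : O n) -> c f = a.
  by move=> fa; apply: (@OscaleI n); rewrite /= -Hc.
have Oz0 i j : Oz F i j = 0 :> O n.
  by rewrite (ord_eq i j n1); apply: Oval_inj; rewrite /= rzii.
pose X : chfun d n := fun v f => c f *: A v.
suff chX : is_ch X.
  exists (mkPch X) => v; rewrite mkPchE // /X (cE 1 1) ?scale1r //.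
split=> [f v i a x y|v a f g|v i f|v i j f]; rewrite /X.
- by rewrite linA scalerDr !scalerA mulrC.
- rewrite (cE (a *: f + g) (a * c f + c g)) ?scalerDl ?scalerA //.
  by rewrite -scalerA -!Hc.
- rewrite (cE (Oderiv i f) 0) ?scale0r; last by rewrite (Hc f) OderivZ Oderiv1 scaler0.
  have -> : qlam i (c f *: A v) = c f *: qlam i (A v) by exact: linearZ.
  by rewrite -scalerDr -/(sesqui_defect i A v) dA scaler0.
- by rewrite Oz0 mul0r (cE 0 0) ?scale0r // (ord_eq i j n1) qdiffii.
Qed.

Lemma graph_small n (G : graph n) : (n <= 1)%N -> forall e, mult G e = 0%N.
Proof. by move=> n1 [i j]; rewrite (ord_eq i j n1) mult_tadpole. Qed.

Lemma nedges0 n (G : graph n) : (forall e, mult G e = 0%N) -> nedges G = 0%N.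
Proof. by move=> G0; apply: big1. Qed.

Lemma pfun0 n (G : graph n) : (forall e, mult G e = 0%N) -> pfun F G = 1.
Proof. by move=> G0; apply: big1 => e _; rewrite G0. Qed.

Lemma ch_fil0 n (X : Pch n) : ch_fil 0 X.
Proof.
move=> v f f0; have -> : f = 0 by apply: Oval_inj; exact: f0.
exact: ch0.
Qed.

Lemma ch_unitE v : (ch_unit d : Pch 1) v 1 = qconst d 1 (v ord0).
Proof.
rewrite /ch_unit; case: xgetP => [X _ XP|H]; first exact: XP.
have [|v0 i c x y|i v0|X XP] := @ch_small 1 (fun v => qconst d 1 (v ord0)).
- by [].
- by rewrite /qconst /= (ord1 i) eqxx vconst_linear linearP.
(* For the identity in arity 1 the defect is the class of (d + lambda_1) v, which is 0. *)
- rewrite /sesqui_defect /qconst /= (ord1 i) eqxx qlamE -linearD -[RHS](cls_dlamsum d (vconst 1 (v0 ord0))).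
  by rewrite /dlamsum cmap_const big_ord1.
by case: (H X).
Qed.

Lemma gr_to_cl_unit : gr_to_cl (gr_unit d) = cl_unit d.
Proof.
have U (G : graph 1) v : gr_to_cl (gr_unit d) G v = qconst d 1 (v ord0).
  have G0 := graph_small G (leqnn 1).
  by rewrite gr_to_cl_in ?nedges0 ?pfun0 ?ch_unitE //; apply: ch_fil0.
rewrite /cl_unit; case: xgetP => [f _ fP|H]; last by case: (H (gr_to_cl (gr_unit d))).
by apply: PclP => G v; rewrite U fP.
Qed.

Lemma graph_eq0 n (G G' : graph n) : (forall e, mult G e = 0%N) -> (forall e, mult G' e = 0%N) ->
  G = G'.
Proof. by move=> G0 G'0; apply: graphP => e; rewrite G0 G'0. Qed.

Definition empty_graph n : graph n := mkgraph (fun _ _ => 0%N).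
Lemma mult_empty n (e : 'I_n * 'I_n) : mult (empty_graph n) e = 0%N.
Proof. by rewrite mult_mkgraph if_same. Qed.

Lemma cl_empty n (f : Pcl n) i v : sesqui_defect i (f (empty_graph n)) v = 0.
Proof.
have [_ _ _ _ /(_ (empty_graph n) i v)] := is_clP f.
have E j : `[< connected (empty_graph n) i j >] = (j == i).
  rewrite asbool_connected; apply/idP/eqP => [/connectP[[|k p] /=]|->]; last exact: connect0.
    by move=> _ ->.
  by rewrite /adj !inE !mult_empty.
rewrite (eq_bigl (fun j => j == i)) // [in RHS](eq_bigl (fun j => j == i)) //.
by rewrite !big_pred1_eq => H; apply/eqP; rewrite /sesqui_defect addr_eq0 H.
Qed.

Lemma gr_to_cl_surj_small n (f : Pcl n) : (n <= 1)%N -> exists x, gr_to_cl x = f.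
Proof.
move=> n1; have [f1 _ _ _ _] := is_clP f.
have [X XP] := ch_small n1 (f1 (empty_graph n)) (fun i v => cl_empty f i v).
exists (gr_in (gr_cls 0 X)); apply: PclP => G v; have G0 := graph_small G n1.
rewrite gr_to_cl_in ?nedges0 ?pfun0 ?XP //; last exact: ch_fil0.
by rewrite (graph_eq0 G0 (@mult_empty n)).
Qed.

End SmallArity.

Section PolynomialSums.
Variables (F : fieldType) (U : lmodType F) (L : nat -> U).
Implicit Types p q : {poly F}.

(** The linear map on polynomials sending 'X^i to [L i]; it serves both for the powers of z_12 and
    for the values assigned to them. *)
Definition psum p : U := \sum_(i < size p) p`_i *: L i.

Lemma psum_widen p K : (size p <= K)%N -> psum p = \sum_(i < K) p`_i *: L i.
Proof.
move=> pK; rewrite /psum (big_ord_widen K (fun i => p`_i *: L i)) // big_mkcond.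
by apply: eq_bigr => i _; case: ltnP => // /(nth_default 0) ->; rewrite scale0r.
Qed.

Lemma psum_linear : linear psum.
Proof.
move=> c p q; pose K := maxn (size (c *: p + q)) (maxn (size p) (size q)).
rewrite !(@psum_widen _ K) ?leq_max ?leqnn ?orbT // scaler_sumr -big_split.
by apply: eq_bigr => i _; rewrite coefD coefZ scalerDl scalerA.
Qed.

Lemma psumC c : psum c%:P = c *: L 0.
Proof. by rewrite (@psum_widen _ 1) ?size_polyC_leq1 // big_ord1 coefC. Qed.

Lemma psumMX p : psum (p * 'X) = \sum_(i < size p) p`_i *: L i.+1.
Proof.
rewrite (@psum_widen _ (size p).+1); last first.
  by apply: leq_trans (size_polyMleq _ _) _; rewrite size_polyX addn2.
rewrite big_ord_recl coefMX eqxx scale0r add0r; apply: eq_bigr => i _.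
by rewrite coefMX.
Qed.

End PolynomialSums.

(** * Values on Laurent polynomials in z_12 *)

Section TwoPointFunctions.
Variables (F : fieldType) (V : superspace F) (d : {linear V -> V}).
Hypothesis char0 : [pchar F] =i pred0.
Local Notation Q n := (Q n d).
Local Notation Pch n := (Pch d n).
Local Notation O n := (Ostar F n).
Local Notation i0 := (ord0 : 'I_2).
Local Notation i1 := (ord_max : 'I_2).
Local Notation W := (('I_2 -> V) -> Q 2).
Local Notation D := (@sesqui_defect F V d 2).

Implicit Types (B : W) (v : 'I_2 -> V) (p : {poly F}).

Lemma ord2P (i : 'I_2) : i = i0 \/ i = i1.
Proof. by case: i => [[|[|//]]] ?; [left|right]; apply: val_inj. Qed.

Lemma natr_neq0 k : k.+1%:R != 0 :> F.
Proof. by have/pcharf0P -> := char0. Qed.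

(** The effect on values of multiplying the function by z_12. *)
Definition del (B : W) : W := fun v => qdiff i1 i0 (B v).

Lemma qdiffC n i j (q : Q n) : qdiff i j q = - qdiff j i q.
Proof. by elim/Q_ind: q => p; rewrite !qdiffE -[dlam i p - _]opprB linearN. Qed.

Lemma del_sesqui i B v :
  del (D i B) v = D i (del B) v + ((i1 == i)%:R - (i0 == i)%:R) *: B v.
Proof. by rewrite /del /sesqui_defect qdiffD qdiff_lam addrA. Qed.

Lemma sesqui_comm B v : D i0 (D i1 B) v = D i1 (D i0 B) v.
Proof.
rewrite /sesqui_defect !qlamD qlamC -!addrA; congr (_ + _); last by rewrite !addrA; congr (_ + _); rewrite addrC.
by congr B; apply/funext => j /=; do 2 case: eqP => // ->.
Qed.

Lemma sesquiZ i c B v : D i (fun v => c *: B v) v = c *: D i B v.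
Proof.
rewrite /sesqui_defect scalerDr; congr (_ + _); exact: linearZ.
Qed.

Lemma mlin_del B : multilinear B -> multilinear (del B).
Proof. by move=> mB v i c x y; rewrite /del mB linearP. Qed.

Lemma mlinZ c B : multilinear B -> multilinear (fun v => c *: B v).
Proof. by move=> mB v i a x y; rewrite mB scalerDr !scalerA mulrC. Qed.

Lemma mlin_sesqui i B : multilinear B -> multilinear (D i B).
Proof.
move=> mB v j c x y; rewrite /sesqui_defect.
have E u : [eta [eta v with j |-> u] with i |-> d ([eta v with j |-> u] i)] =
    [eta [eta v with i |-> d (v i)] with j |-> if i == j then d u else u] :> ('I_2 -> V).
  apply/funext => k /=; have [ij|ij] := eqVneq i j; first by subst j; case: eqP.
  by have [ki|//] := eqVneq k i; subst k; rewrite (negPf ij).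
rewrite !E; have -> : (if i == j then d (c *: x + y) else c *: x + y) =
    c *: (if i == j then d x else x) + (if i == j then d y else y).
  by case: eqP => // _; rewrite linearP.
rewrite (mB _ j c (if i == j then d x else x) (if i == j then d y else y)).
by rewrite (mB v j c x y) qlamP scalerDr addrACA.
Qed.

Section Laurent.
Variable A : W.
Hypothesis A_mlin : multilinear A.
Hypothesis A_trans : forall v, D i0 A v + D i1 A v = 0.
Hypothesis A_del : forall v, D i0 (del A) v = 0.

(* [posl j] will be the value on z_12 ^ (j - 1) and [negl r] the value on z_12 ^ (-1 - r). *)
Definition posl j : W := iter j del A.
Definition negl r : W := fun v => ((-1) ^+ r / (r`!)%:R) *: iter r (D i0) A v.

Lemma negl0 : negl 0 = A.
Proof. by apply/funext => v; rewrite /negl expr0 fact0 divr1 scale1r. Qed.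

(** The coefficients of [negl] reflect that z^(-1-r) is (-1)^r / r! times the r-th derivative of
    z^(-1). *)
Lemma coefS r : (-1) ^+ r / (r`!)%:R = - r.+1%:R * ((-1) ^+ r.+1 / (r.+1`!)%:R) :> F.
Proof.
by rewrite factS natrM exprS invfM mulN1r !mulNr mulrN opprK mulrCA mulVKf ?natr_neq0.
Qed.

(** The case r = 0 rests on [A_del]: multiplication by z takes z^(-1) to 1, whose derivative is
    0. *)
Lemma del_iter r v : del (iter r.+1 (D i0) A) v = - r.+1%:R *: iter r (D i0) A v.
Proof.
elim: r v => [|r IH] v.
  by rewrite /= del_sesqui A_del add0r /= sub0r.
rewrite [iter r.+2 _ _]iterS del_sesqui /=.
have -> : D i0 (del (D i0 (iter r (D i0) A))) v = - r.+1%:R *: D i0 (iter r (D i0) A) v.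
  by rewrite -sesquiZ; congr (D i0 _ v); apply/funext => u; apply: IH.
by rewrite -scalerDl sub0r -opprD natr1.
Qed.

Lemma del_negl r v : del (negl r.+1) v = negl r v.
Proof.
have -> : del (negl r.+1) v = ((-1) ^+ r.+1 / (r.+1`!)%:R) *: del (iter r.+1 (D i0) A) v.
  exact: linearZ.
by rewrite del_iter scalerA /negl [in RHS]coefS mulrC.
Qed.

Lemma sesqui_negl r v : D i0 (negl r) v = - r.+1%:R *: negl r.+1 v.
Proof. by rewrite sesquiZ [in LHS]coefS /negl scalerA. Qed.

Lemma sesqui_posl j v : D i0 (posl j.+1) v = j%:R *: posl j v.
Proof.
elim: j v => [|j IH] v; first by rewrite scale0r A_del.
have := del_sesqui i0 (posl j.+1) v; have -> : del (D i0 (posl j.+1)) v = j%:R *: posl j.+1 v.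
  have -> : D i0 (posl j.+1) = fun v => j%:R *: posl j v by apply/funext.
  exact: linearZ.
rewrite /= sub0r scaleN1r => /eqP; rewrite eq_sym subr_eq => /eqP ->.
by rewrite -natr1 scalerDl scale1r.
Qed.

Lemma trans_del B : (forall v, D i0 B v + D i1 B v = 0) -> forall v, D i0 (del B) v + D i1 (del B) v = 0.
Proof.
move=> HB v; have := del_sesqui i0 B v; have := del_sesqui i1 B v => /= E1 E0.
have : del (D i0 B) v + del (D i1 B) v = 0 by rewrite /del -qdiffD HB linear0.
rewrite E0 E1 addrACA -scalerDl subr0 sub0r addNr scale0r addr0.
by [].
Qed.

Lemma trans_sesqui B : (forall v, D i0 B v + D i1 B v = 0) ->
  forall v, D i0 (D i0 B) v + D i1 (D i0 B) v = 0.
Proof.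
move=> HB v; rewrite -sesqui_comm /sesqui_defect addrACA -qlamD.
by rewrite -/(D i1 B _) -/(D i1 B _) -!/(D i0 B _) !HB add0r qlam0.
Qed.

Lemma trans_posl j v : D i1 (posl j) v = - D i0 (posl j) v.
Proof.
apply/eqP; rewrite -addr_eq0 addrC; apply/eqP.
by elim: j v => [|j IH] //=; apply: trans_del.
Qed.

Lemma trans_negl r v : D i1 (negl r) v = - D i0 (negl r) v.
Proof.
rewrite !sesquiZ -scalerN; congr (_ *: _); apply/eqP; rewrite -addr_eq0 addrC; apply/eqP.
by elim: r v => [|r IH] //=; apply: trans_sesqui.
Qed.

(* The value on z_12 ^ (i - N). *)
Definition laurent i N : W := if (N <= i.+1)%N then posl (i.+1 - N) else negl (N - i.+1).

Lemma laurentS i N : laurent i.+1 N.+1 = laurent i N.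
Proof. by rewrite /laurent ltnS !subSS. Qed.

Lemma laurent_del i N v : del (laurent i N) v = laurent i.+1 N v.
Proof.
rewrite /laurent; have [Ni|iN] := leqP N i.+1.
  by rewrite (leq_trans Ni) // (subSn Ni).
have [|Ni] := leqP N i.+2; last first.
  by rewrite -(subnSK (ltnW Ni)) del_negl.
(* The boundary between the two families: [del] takes [negl 1] to [negl 0], which is [posl 0]. *)
move=> Ni; have {Ni iN} -> : N = i.+2 by apply/eqP; rewrite eqn_leq Ni.
by rewrite subnn subSnn del_negl negl0.
Qed.

Lemma laurent_sesqui i N v : D i0 (laurent i N) v = (i%:R - N%:R) *: laurent i N.+1 v.
Proof.
rewrite /laurent ltnS; have [Ni|iN] := leqP N i.
  by rewrite (leq_trans Ni) // (subSn Ni) sesqui_posl subSS natrB.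
rewrite subSS; have [Ni|Ni] := leqP N i.+1.
  have -> : N = i.+1 by apply/eqP; rewrite eqn_leq Ni.
  rewrite subnn subSnn -[posl 0]/A -negl0 sesqui_negl; congr (_ *: _).
  by rewrite -[i.+1]addn1 natrD opprD addrA subrr sub0r.
rewrite sesqui_negl; congr (_ *: negl _ v); last by rewrite subnSK.
by rewrite subnSK // natrB ?opprB // ltnW.
Qed.

Lemma laurent_trans i N v : D i1 (laurent i N) v = - D i0 (laurent i N) v.
Proof. by rewrite /laurent; case: ifP => _; [apply: trans_posl|apply: trans_negl]. Qed.

Lemma mlin_laurent i N : multilinear (laurent i N).
Proof.
rewrite /laurent; case: ifP => _.
  by rewrite /posl; elim: (_ - _)%N => [//|j IH]; apply: mlin_del.
by apply: mlinZ; elim: (_ - _)%N => [//|j IH]; apply: mlin_sesqui.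
Qed.

(** The value on the fraction p(z) / z^N; [lvalMX] is its invariance under expanding the fraction by
    z. *)
Definition lval N p : W := fun v => psum (fun i => laurent i N v) p.

Lemma lval_lin N c p (q : {poly F}) v : lval N (c *: p + q) v = c *: lval N p v + lval N q v.
Proof. exact: psum_linear. Qed.

Lemma lvalMX N p v : lval N.+1 (p * 'X) v = lval N p v.
Proof. by rewrite /lval psumMX; apply: eq_bigr => i _; rewrite laurentS. Qed.

Lemma lvalMXn N p k v : lval (N + k) (p * 'X^k) v = lval N p v.
Proof.
by elim: k => [|k IH]; rewrite ?addn0 ?mulr1 // addnS exprSr mulrA lvalMX.
Qed.

Lemma lval_del N p v : del (lval N p) v = lval N (p * 'X) v.
Proof.
rewrite /lval psumMX /del linear_sum; apply: eq_bigr => i _.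
by rewrite -laurent_del linearZ.
Qed.

Lemma sesqui_lval j N p v :
  D j (lval N p) v = \sum_(i < size p) p`_i *: D j (laurent i N) v.
Proof.
rewrite /sesqui_defect /lval linear_sum -big_split; apply: eq_bigr => i _ /=.
by rewrite scalerDr linearZ.
Qed.

(** The quotient rule: the derivative of p / z^N is (p' z - N p) / z^(N+1). *)
Lemma lval_sesqui N p v : D i0 (lval N p) v = lval N.+1 (p^`() * 'X - N%:R *: p) v.
Proof.
have sz : (size (p^`() * 'X - N%:R *: p)%R <= size p)%N.
  rewrite (leq_trans (size_polyD _ _)) // geq_max size_polyN size_scale_leq andbT.
  apply/leq_sizeP => i pi; rewrite coefMX; case: eqP => // /eqP i0'.
  by rewrite coef_deriv prednK ?lt0n // nth_default ?mul0rn.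
rewrite /lval (psum_widen _ sz) sesqui_lval; apply: eq_bigr => i _.
rewrite laurent_sesqui scalerA coefB coefZ coefMX; congr (_ *: _).
rewrite mulrBr [N%:R * _]mulrC; congr (_ - _).
case: (i : nat) => [|k] /=; first by rewrite mulr0.
by rewrite coef_deriv mulr_natr.
Qed.

Lemma lval_trans N p v : D i1 (lval N p) v = - D i0 (lval N p) v.
Proof.
rewrite !sesqui_lval -sumrN; apply: eq_bigr => i _.
by rewrite laurent_trans scalerN.
Qed.

Lemma mlin_lval N p : multilinear (lval N p).
Proof.
move=> v j c x y; rewrite /lval scaler_sumr -big_split; apply: eq_bigr => i _ /=.
by rewrite (mlin_laurent i N v j c x y) scalerDr !scalerA mulrC.
Qed.

End Laurent.
End TwoPointFunctions.

(** * Elements of P^ch(2) with a prescribed value on the inverse of z_12 *)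

Section TwoPointPch.
Variables (F : fieldType) (V : superspace F) (d : {linear V -> V}).
Hypothesis char0 : [pchar F] =i pred0.
Local Notation Q n := (Q n d).
Local Notation Pch n := (Pch d n).
Local Notation O n := (Ostar F n).
Local Notation i0 := (ord0 : 'I_2).
Local Notation i1 := (ord_max : 'I_2).
Local Notation z := (Oz F i0 i1).
Local Notation zV := (OzV F i0 i1).
Implicit Types (p q : {poly F}) (f g : O 2).

Lemma zVz : zV * z = 1.
Proof. by apply: Oval_inj; rewrite OvalM mulVf //; apply: rz_neq0. Qed.

Lemma Oz10 : Oz F i1 i0 = - z.
Proof. by apply: Oval_inj; rewrite OvalN /= rz_opp. Qed.

Lemma OzV10 : OzV F i1 i0 = - zV.
Proof. by apply: Oval_inj; rewrite OvalN /= -invrN rz_opp. Qed.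

Lemma Ozii i : Oz F i i = 0 :> O 2.
Proof. by apply: Oval_inj; rewrite /= rzii. Qed.

Definition pz p : O 2 := psum (fun i => z ^+ i) p.

HB.instance Definition _ := GRing.isLinear.Build F {poly F} (O 2) *:%R pz (psum_linear _).

Lemma pzMX p : pz (p * 'X) = pz p * z.
Proof.
by rewrite /pz psumMX mulr_suml; apply: eq_bigr => i _; rewrite -OscaleAl -exprSr.
Qed.

Lemma pzMXn p k : pz (p * 'X^k) = pz p * z ^+ k.
Proof. by elim: k => [|k IH]; rewrite ?mulr1 // !exprSr !mulrA pzMX IH. Qed.

Lemma pzC c : pz c%:P = c *: (1 : O 2).
Proof. exact: psumC. Qed.

Lemma pzM p q : pz (p * q) = pz p * pz q.
Proof.
elim/poly_ind: p q => [|p c IH] q; first by rewrite mul0r linear0 mul0r.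
rewrite mulrDl -mulrA ['X * q]mulrC mul_polyC !linearD linearZ /= IH !pzMX pzC.
by rewrite mulrDl -OscaleAl mul1r mulrA mulrAC.
Qed.

Lemma Oderiv_pz p : Oderiv i0 (pz p) = pz p^`().
Proof.
elim/poly_ind: p => [|p c IH]; first by rewrite deriv0 linear0 Oderiv0.
rewrite derivD derivC addr0 derivM derivX mulr1 !linearD /= !pzMX pzC.
by rewrite OderivD OderivM IH OderivZ Oderiv1 scaler0 addr0 Oderiv_z eqxx subr0 mulr1.
Qed.

(** A polynomial vanishing at z_12 has a derivative of smaller degree that vanishes there too; by
    induction the derivative is 0, so the polynomial is constant in characteristic 0. *)
Lemma pz_inj : injective pz.
Proof.
suff H p : pz p = 0 -> p = 0.
  by move=> p q pq; apply/eqP; rewrite -subr_eq0; apply/eqP/H; rewrite linearB /= pq subrr.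
have [K pK] := ubnP (size p); elim: K => // K IH in p pK *.
move=> p0; have p'0 : p^`() = 0.
  have [->|pn0] := eqVneq p 0; first by rewrite deriv0.
  apply: IH; last by rewrite -Oderiv_pz p0 Oderiv0.
  by move: pK; rewrite ltnS; apply: leq_trans (lt_size_deriv pn0).
have pC : p = (p`_0)%:P.
  apply/polyP => -[|i]; rewrite coefC //=.
  have := congr1 (fun r : {poly F} => r`_i) p'0; rewrite /= coef_deriv coef0 -mulr_natr.
  by move/eqP; rewrite mulf_eq0 (negPf (natr_neq0 char0 i)) orbF => /eqP.
have p00 : p`_0 = 0 by apply: (@OscaleI F 2); rewrite /= scale0r -pzC -pC.
by rewrite pC p00.
Qed.

Lemma pz_repr f : exists Np : nat * {poly F}, f * z ^+ Np.1 = pz Np.2.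
Proof.
elim/Ostar_ind: f => [c|i j|i j|f g [[N p] /= fp] [[M q] /= gq]|f g [[N p] /= fp] [[M q] /= gq]].
- by exists (0%N, c%:P); rewrite mulr1 pzC.
- have zX : pz 'X = z by rewrite -['X]mul1r pzMX pzC scale1r mul1r.
  case: (ord2P i) => ->; case: (ord2P j) => ->.
  + by exists (0%N, 0); rewrite Ozii mul0r linear0.
  + by exists (0%N, 'X); rewrite mulr1 zX.
  + by exists (0%N, - 'X); rewrite mulr1 linearN /= zX Oz10.
  + by exists (0%N, 0); rewrite Ozii mul0r linear0.
- case: (ord2P i) => ->; case: (ord2P j) => -> // _.
  by exists (1%N, 1%:P); rewrite expr1 zVz pzC scale1r.
- exists ((N + M)%N, p * 'X^M + q * 'X^N) => /=.
  by rewrite linearD /= !pzMXn -fp -gq mulrDl -!mulrA -!exprD [(M + N)%N]addnC.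
- exists ((N + M)%N, p * q) => /=.
  by rewrite pzM -fp -gq exprD mulrACA.
Qed.

Lemma Oderiv_trans f : Oderiv i1 f = - Oderiv i0 f.
Proof.
have Dz : Oderiv i1 z = - Oderiv i0 z by rewrite !Oderiv_z /= sub0r subr0.
elim/Ostar_ind: f => [c|i j|i j|f g Hf Hg|f g Hf Hg].
- by rewrite !OderivZ !Oderiv1 scaler0 oppr0.
- by rewrite !Oderiv_z; case: (ord2P i) => ->; case: (ord2P j) => ->; rewrite /= ?subrr ?sub0r ?subr0 ?subrr ?opprK ?oppr0.
- case: (ord2P i) => ->; case: (ord2P j) => -> // _.
  have := congr1 (Oderiv i1) zVz; have := congr1 (Oderiv i0) zVz.
  rewrite !OderivM !Oderiv1 Dz => /eqP; rewrite addr_eq0 => /eqP E0 /eqP.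
  rewrite addr_eq0 mulrN opprK => /eqP E1.
  have zI x : x = x * z * zV by rewrite -mulrA [z * _]mulrC zVz mulr1.
  by rewrite (zI (Oderiv i1 _)) E1 (zI (Oderiv i0 zV)) E0 mulNr opprK.
- by rewrite !OderivD Hf Hg opprD.
- by rewrite !OderivM Hf Hg mulNr mulrN opprD.
Qed.

Lemma Oderiv_repr N p f : f * z ^+ N = pz p ->
  Oderiv i0 f * z ^+ N.+1 = pz (p^`() * 'X - N%:R *: p).
Proof.
move=> fp; have := congr1 (Oderiv i0) fp; rewrite OderivM Oderiv_pz => E.
have DzN M : Oderiv i0 (z ^+ M) * z = M%:R * z ^+ M.
  elim: M => [|M IH]; first by rewrite expr0 Oderiv1 !mul0r.
  rewrite exprSr OderivM Oderiv_z eqxx subr0 mulr1 mulrDl IH -[M.+1]addn1 natrD.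
  by rewrite -mulrA -exprSr mulrDl mul1r exprSr.
rewrite linearB linearZ /= pzMX -E mulrDl -!mulrA -exprSr DzN -fp.
by rewrite [f * (_ * _)]mulrCA mulr_natl scaler_nat addrK.
Qed.

Section LaurentPch.
Variable A : ('I_2 -> V) -> Q 2.
Hypothesis A_mlin : multilinear A.
Hypothesis A_trans : forall v, sesqui_defect i0 A v + sesqui_defect i1 A v = 0.
Hypothesis A_del : forall v, sesqui_defect i0 (del A) v = 0.

Lemma ch_laurent : exists X : Pch 2, forall v, X v 1 = del A v /\ X v zV = A v.
Proof.
have /choice[r rP] := pz_repr.
pose X : chfun d 2 := fun v f => lval A (r f).1 (r f).2 v.
(* The value does not depend on the fraction representing f: by [pz_inj], two fractions have equal
   cross products. *)
have XE N p f v : f * z ^+ N = pz p -> X v f = lval A N p v.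
  move=> fp; rewrite /X -(lvalMXn A (r f).1 (r f).2 N) -(lvalMXn A N p (r f).1) addnC.
  congr (lval A _ _ v); apply: pz_inj.
  by rewrite !pzMXn -rP -fp -!mulrA [z ^+ N * _]mulrC.
have Xlin v : linear (X v).
  move=> c f g; rewrite (XE ((r f).1 + (r g).1)%N (c *: ((r f).2 * 'X^((r g).1)) + (r g).2 * 'X^((r f).1))).
    by rewrite lval_lin lvalMXn addnC lvalMXn.
  rewrite linearP /= !pzMXn -!rP mulrDl -OscaleAl -!mulrA -!exprD.
  by rewrite [((r g).1 + _)%N]addnC.
have X0 v : X v 0 = 0.
  by rewrite (XE 0%N 0) ?mul0r ?linear0 // /lval /psum size_poly0 big_ord0.
have XN v f : X v (- f) = - X v f.
  by have := Xlin v (-1) f 0; rewrite !addr0 X0 addr0 !scaleN1r.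
have Xz v f : X v (z * f) = qdiff i1 i0 (X v f).
  rewrite (XE (r f).1 ((r f).2 * 'X)) -?lval_del //.
  by rewrite -mulrA rP mulrC pzMX.
suff chX : is_ch X.
  exists (mkPch X) => v; rewrite mkPchE //; split.
    by rewrite (XE 0%N 1%:P) ?mulr1 ?pzC ?scale1r // /lval psumC scale1r.
  by rewrite (XE 1%N 1%:P) ?expr1 ?zVz ?pzC ?scale1r // /lval psumC scale1r.
split=> [f v i c x y|//|v i f|v i j f].
- exact: (mlin_lval A_mlin).
- have E0 : sesqui_defect i0 (lval A (r f).1 (r f).2) v = X v (Oderiv i0 f).
    by rewrite (lval_sesqui char0 A_del) -(XE _ _ _ _ (Oderiv_repr (rP f))).
  case: (ord2P i) => ->; first exact: E0.
  rewrite Oderiv_trans XN -E0; exact: (lval_trans A_trans).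
- case: (ord2P i) => ->; case: (ord2P j) => ->; rewrite ?Ozii ?mul0r ?qdiffii.
  + exact: X0.
  + exact: Xz.
  + by rewrite Oz10 mulNr XN Xz [in RHS]qdiffC.
  + exact: X0.
Qed.
End LaurentPch.
End TwoPointPch.

Lemma iter_linear (F : pzRingType) (U : lmodType F) (A : {linear U -> U}) r : linear (iter r A).
Proof. by move=> c x y; elim: r => //= r ->; rewrite linearP. Qed.

(** * Primitives for d/dlambda_2 - d/dlambda_1 *)

Section LambdaIntegral.
Variables (F : fieldType) (V : superspace F) (d : {linear V -> V}).
Hypothesis char0 : [pchar F] =i pred0.
Local Notation Q := (Q 2 d).
Local Notation i0 := (ord0 : 'I_2).
Local Notation i1 := (ord_max : 'I_2).
Implicit Types q : Q.

Definition dq : Q -> Q := qdiff i1 i0.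
HB.instance Definition _ := GRing.Linear.on dq.

(** Constants are killed, and multiplication by a lambda raises the order of nilpotency by at most
    one. *)
Lemma dq_nilpotent q : exists N, iter N dq q = 0.
Proof.
have iter0 r K : (r <= K)%N -> forall q, iter r dq q = 0 -> iter K dq q = 0.
  move=> rK q' E; rewrite -(subnK rK) iterD E.
  by elim: (_ - _)%N => //= s ->; rewrite linear0.
elim/Q_ind: q => p; elim/VL_ind: p => [v|p q [N HN] [M HM]|a p [N HN]].
- by exists 1%N; rewrite /= /dq qdiffE !dlam_const subrr linear0.
- exists (maxn N M); rewrite clsD -[cls p]scale1r iter_linear.
  by rewrite (iter0 N) ?leq_maxl // (iter0 M) ?leq_maxr // scaler0 addr0.
- have E r : exists c, iter r.+1 dq (cls (lam a p)) = qlam a (iter r.+1 dq (cls p)) + c *: iter r dq (cls p).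
    elim: r => [|r [c IH]].
      by exists ((i1 == a)%:R - (i0 == a)%:R); rewrite /= /dq -qlamE qdiff_lam.
    exists (((i1 == a)%:R - (i0 == a)%:R) + c).
    by rewrite iterS IH [LHS]linearD linearZ /= {1}/dq qdiff_lam -addrA -scalerDl.
  have [c Ec] := E N; exists N.+1.
  by rewrite Ec iterS HN linear0 scaler0 addr0 qlam0.
Qed.

(* Taylor's formula for a primitive vanishing at lambda_2 = 0, along the direction of
   [dq] = d/dlambda_2 - d/dlambda_1. *)
Definition lam_intN N q : Q :=
  \sum_(r < N) ((-1) ^+ r / (r.+1`!)%:R) *: iter r.+1 (qlam i1) (iter r dq q).

Lemma lam_intN_widen N K q : (N <= K)%N -> iter N dq q = 0 -> lam_intN K q = lam_intN N q.
Proof.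
move=> NK E; rewrite -(subnK NK); elim: (_ - _)%N => [|k IH]; first by rewrite add0n.
rewrite addSn /lam_intN big_ord_recr /= -/(lam_intN _ q) IH [iter _ dq q]iterD E.
have -> : iter k dq 0 = 0 by elim: k {IH} => //= k ->; rewrite linear0.
have -> : iter (k + N) (qlam i1) 0 = 0 :> Q by elim: (k + N)%N => //= s ->; rewrite linear0.
by rewrite linear0 scaler0 addr0.
Qed.

Lemma lam_intN_linear N : linear (lam_intN N).
Proof.
move=> c x y; rewrite /lam_intN scaler_sumr -big_split; apply: eq_bigr => r _.
rewrite (iter_linear dq) (iter_linear (qlam i1)) scalerDr.
by rewrite !scalerA [c * _]mulrC.
Qed.

Lemma dq_iter_lam r q :
  dq (iter r.+1 (qlam i1) q) = iter r.+1 (qlam i1) (dq q) + r.+1%:R *: iter r (qlam i1) q.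
Proof.
elim: r => [|r IH]; first by rewrite /= /dq qdiff_lam subr0.
rewrite [iter r.+2 _ q]iterS {1}/dq qdiff_lam -/(dq _) IH linearD linearZ /= subr0 -addrA.
by rewrite -[r.+2]addn1 natrD scalerDl.
Qed.

(** The sum telescopes; the remainder vanishes once N reaches the order of nilpotency of q. *)
Lemma dq_lam_intN N q :
  dq (lam_intN N q) = q - ((-1) ^+ N / (N`!)%:R) *: iter N (qlam i1) (iter N dq q).
Proof.
elim: N => [|N IH].
  by rewrite /lam_intN big_ord0 linear0 expr0 fact0 divr1 scale1r subrr.
have dqD x y : dq (x + y) = dq x + dq y by exact: linearD.
have dqZ c x : dq (c *: x) = c *: dq x by exact: linearZ.
have cE : (-1) ^+ N / (N.+1`!)%:R = - ((-1) ^+ N.+1 / (N.+1`!)%:R) :> F.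
  by rewrite exprS mulN1r mulNr opprK.
rewrite /lam_intN big_ord_recr -/(lam_intN N q) dqD IH dqZ dq_iter_lam scalerDr scalerA.
rewrite (coefS char0) cE -[iter N.+1 dq q]/(dq _) mulNr [- _ * _]mulrC mulrN !scaleNr opprK.
by rewrite [- _ + - _]addrC addrA addrK.
Qed.

(** The order of truncation depends on q, and identities are checked at a common order. Commutation
    with lambda_1 + lambda_2, which [dq] treats as a constant, makes the primitive of a translation
    covariant map translation covariant. *)
Lemma lam_integral : exists I : Q -> Q,
  [/\ linear I, forall q, dq (I q) = q &
      forall q, I (qlam i0 q + qlam i1 q) = qlam i0 (I q) + qlam i1 (I q)].
Proof.
have /choice[N HN] := dq_nilpotent; pose I q := lam_intN (N q) q.
have IE q K : (N q <= K)%N -> I q = lam_intN K q.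
  by move=> NK; rewrite (lam_intN_widen NK).
exists I; split=> [c x y|q|q].
- pose K := maxn (N (c *: x + y)) (maxn (N x) (N y)).
  by rewrite !(IE _ K) ?leq_max ?leqnn ?orbT // lam_intN_linear.
- rewrite dq_lam_intN HN (_ : iter _ _ 0 = 0) ?scaler0 ?subr0 //.
  by elim: (N q) => //= s ->; rewrite linear0.
- set L := fun x : Q => qlam i0 x + qlam i1 x; rewrite -/(L q) -/(L (I q)).
  pose K := maxn (N q) (N (L q)); rewrite !(IE _ K) ?leq_maxl ?leq_maxr //.
  have LdC x : dq (L x) = L (dq x).
    rewrite /dq /L qdiffD !qdiff_lam addrACA -scalerDl /= subr0 sub0r addNr scale0r.
    by rewrite addr0.
  have LlC x : qlam i1 (L x) = L (qlam i1 x) by rewrite /L qlamD [qlam i1 (qlam i0 _)]qlamC.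
  have iterL (A : Q -> Q) r x : (forall x, A (L x) = L (A x)) -> iter r A (L x) = L (iter r A x).
    by move=> AL; elim: r => //= r ->.
  have Llin c x y : L (c *: x + y) = c *: L x + L y.
    by rewrite /L !qlamP scalerDr addrACA.
  have L0 : L 0 = 0 by rewrite /L !qlam0 addr0.
  rewrite /lam_intN; elim/big_rec2: _ => [|r x y _ ->]; first by rewrite L0.
  by rewrite Llin iterL // iterL.
Qed.
End LambdaIntegral.

(** * Surjectivity in arity 2 *)

Section BinarySurjectivity.
Variables (F : fieldType) (V : superspace F) (d : {linear V -> V}).
Hypothesis char0 : [pchar F] =i pred0.
Local Notation Q n := (Q n d).
Local Notation Pch n := (Pch d n).
Local Notation Pcl n := (Pcl d n).
Local Notation O n := (Ostar F n).
Local Notation i0 := (ord0 : 'I_2).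
Local Notation i1 := (ord_max : 'I_2).
Local Notation z := (Oz F i0 i1).
Local Notation zV := (OzV F i0 i1).

Definition graph2 (a b : nat) : graph 2 := mkgraph (fun i _ => if i == i0 then a else b).

Lemma mult_graph2 a b : (mult (graph2 a b) (i0, i1) = a) * (mult (graph2 a b) (i1, i0) = b).
Proof. by rewrite !mult_mkgraph. Qed.

Lemma graph2E (G : graph 2) : G = graph2 (mult G (i0, i1)) (mult G (i1, i0)).
Proof.
apply: graphP => -[i j].
by case: (ord2P i) => ->; case: (ord2P j) => ->; rewrite ?mult_tadpole // mult_graph2.
Qed.

Lemma big_pair2 (R : Type) (idx : R) (op : Monoid.com_law idx) (X : 'I_2 * 'I_2 -> R) :
  X (i0, i0) = idx -> X (i1, i1) = idx -> \big[op/idx]_e X e = op (X (i0, i1)) (X (i1, i0)).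
Proof.
move=> X0 X1; have -> : \big[op/idx]_e X e = \big[op/idx]_i \big[op/idx]_j X (i, j).
  by rewrite pair_bigA; apply: eq_bigr => -[].
have E (Y : 'I_2 -> R) : \big[op/idx]_i Y i = op (Y i0) (Y i1).
  rewrite !big_ord_recl big_ord0 Monoid.mulm1; congr (op _ (Y _)); exact: val_inj.
by rewrite !E X0 X1 Monoid.mul1m Monoid.mulm1.
Qed.

Lemma nedges_graph2 a b : nedges (graph2 a b) = (a + b)%N.
Proof. by rewrite /nedges big_pair2 ?mult_tadpole // !mult_graph2. Qed.

Lemma pfun_graph2 a b : pfun F (graph2 a b) = zV ^+ a * (- zV) ^+ b.
Proof. by rewrite /pfun big_pair2 ?mult_tadpole // !mult_graph2 /= OzV10. Qed.

Lemma acyclic_graph2 a b : acyclic (graph2 a b) -> (a + b <= 1)%N.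
Proof.
move=> acG; have a1 := @acyclic_mult1 _ _ (i0, i1) acG; have b1 := @acyclic_mult1 _ _ (i1, i0) acG.
rewrite !mult_graph2 in a1 b1.
case: a b acG a1 b1 => [|a] [|b] // acG; [by move=> _ ->|by move=> ->; rewrite ?addn0|].
suff : [:: ((i0, i1), true); ((i1, i0), true)] = [::] :> seq (step 2) by [].
apply: (acG i0); rewrite /upath /= /step_src /step_tgt /= ?eqxx /=.
apply/forallP => -[i j]; case: (ord2P i) => ->; case: (ord2P j) => -> //=; by rewrite mult_graph2.
Qed.

(** The functions without poles are the multiples of 1 by elements of O^T, and the functions killed
    by X are stable under such multiplications. *)
Lemma ch_fil1 (X : Pch 2) : (forall v, X v 1 = 0) -> ch_fil 1 X.
Proof.
move=> X1 v f f0; suff : kills X f by apply.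
move: f f0 {v}; apply: Ofil_ind => [|f g|f]; first exact: kills0.
  exact: killsD.
case/piece_alg => E [_]; rewrite leqn0 cards_eq0 => /eqP -> fP.
rewrite -[f]mulr1; apply: kills_alg => //.
have {1}-> // : (fun _ _ : 'I_2 => false) = poles (n := 2) finset.set0.
by apply/funext => i; apply/funext => j; rewrite /poles !inE.
Qed.

Lemma gr_to_cl_surj2 (f : Pcl 2) : exists x, gr_to_cl x = f.
Proof.
have [f1 f2 f3 f4 f5] := is_clP f.
have [I [Ilin dI IL]] := @lam_integral F V d char0.
have I0 : I 0 = 0 by have := Ilin (-1) 0 0; rewrite scaler0 addr0 scaleN1r addNr.
have ID x y : I (x + y) = I x + I y by have := Ilin 1 x y; rewrite !scale1r.
pose G0 := empty_graph 2; pose G1 := graph2 1 0.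
(* Degree 0: the value at 1 = z_12 z_12^(-1) is the derivative of the primitive, that is [f G0]. *)
have [|v|v|X HX] := @ch_laurent F V d char0 (fun v => I (f G0 v)).
- by move=> v i c x y; rewrite (f1 G0 v i c x y) Ilin.
- rewrite /sesqui_defect addrACA -IL -!ID addrACA.
  by rewrite -/(sesqui_defect i0 (f G0) v) -/(sesqui_defect i1 (f G0) v) !cl_empty addr0 I0.
- have -> : del (fun v => I (f G0 v)) = f G0 by apply/funext => u; apply: dI.
  exact: cl_empty.
have c1 i j : connect (adj G1) i j.
  have c01 : connect (adj G1) i0 i1 by apply: connect1; rewrite /adj !inE !mult_graph2.
  case: (ord2P i) => ->; case: (ord2P j) => ->; rewrite ?connect0 //.
  by rewrite connectC.
have del1 v : del (f G1) v = 0 by apply: f4; apply/connectedP.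
(* Degree 1: as the graph 1 -> 2 is connected, [del (f G1)] is 0, so X' kills 1 and lies in F^1. *)
have [|v|v|X' HX'] := @ch_laurent F V d char0 (f G1).
- exact: f1.
- have E (T : 'I_2 -> Q 2) : \sum_(i | `[< connected G1 i0 i >]) T i = T i0 + T i1.
    rewrite (eq_bigl xpredT) => [|i]; last by rewrite asbool_connected c1.
    by rewrite !big_ord_recl big_ord0 addr0 (_ : lift ord0 ord0 = i1) //; apply: val_inj.
  by rewrite /sesqui_defect addrACA -(E (fun i => f G1 [eta v with i |-> d (v i)])) f5 E addNr.
- have -> : del (f G1) = fun=> 0 by apply/funext.
  by rewrite /sesqui_defect qlam0 addr0.
have X'1 : ch_fil 1 X' by apply: ch_fil1 => v; have [-> _] := HX' v; apply: del1.
exists (gr_in (gr_cls 0 X) + gr_in (gr_cls 1 X')); apply: PclP => G v.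
have phi r (Y : gr d r 2) H u : nedges H != r -> gr_to_cl (gr_in Y) H u = 0.
  by move=> Hr; apply: (@gr_to_cl_deg F V d r) => // s; apply: gr_in_other.
have -> : gr_to_cl (gr_in (gr_cls 0 X) + gr_in (gr_cls 1 X')) G v =
    gr_to_cl (gr_in (gr_cls 0 X)) G v + gr_to_cl (gr_in (gr_cls 1 X')) G v by rewrite linearD.
rewrite (graph2E G); move: (mult G _) (mult G _) => b a {G}.
(* Two edges on two vertices form a cycle, where f vanishes; the constructed element has no
   component in these degrees. *)
have [ab|ab] := leqP 2 (a + b).
  have nG r : (r < 2)%N -> nedges (graph2 a b) != r.
    by rewrite nedges_graph2 eq_sym => r2; rewrite ltn_eqF // (leq_trans r2).
  rewrite !phi ?nG // addr0.
  by rewrite f2 // => /acyclic_graph2; rewrite leqNgt ab.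
case: a b ab => [|[|//]] [|[|//]] // _.
- rewrite gr_to_cl_in ?nedges_graph2 //; last exact: ch_fil0.
  rewrite phi ?nedges_graph2 // addr0 pfun_graph2 mulr1; have [-> _] := HX v.
  rewrite [LHS](dI (f G0 v)); congr (cl_app f _ v); apply: graphP => -[i j].
  by case: (ord2P i) => ->; case: (ord2P j) => ->; rewrite ?mult_tadpole // mult_graph2 mult_empty.
- rewrite phi ?nedges_graph2 // add0r gr_to_cl_in ?nedges_graph2 // pfun_graph2 mul1r expr1.
  rewrite chN; have [_ ->] := HX' v.
  (* The relation for the oriented 2-cycle determines the value at 2 -> 1 as the opposite of the
     value at 1 -> 2, in accordance with the sign of z_21. *)
  have := f3 (graph2 1 1) [:: (i0, i1); (i1, i0)] v.
  rewrite !big_cons big_nil addr0.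
  have -> : remove_edge (graph2 1 1) (i0, i1) = graph2 0 1.
    by rewrite [LHS]graph2E !mult_remove !mult_graph2.
  have -> : remove_edge (graph2 1 1) (i1, i0) = graph2 1 0.
    by rewrite [LHS]graph2E !mult_remove !mult_graph2.
  move=> E; apply/eqP; rewrite eq_sym -addr_eq0 E //.
  rewrite /oriented_cycle /= ?eqxx /=; apply/forallP => -[i j].
  by case: (ord2P i) => ->; case: (ord2P j) => -> //=; rewrite mult_graph2.
- rewrite phi ?nedges_graph2 // add0r gr_to_cl_in ?nedges_graph2 // pfun_graph2 mulr1 expr1.
  by have [_ ->] := HX' v.
Qed.

Lemma gr_to_cl_bij n : (n <= 2)%N -> bijective (@gr_to_cl F V d n).
Proof.
move=> n2; have surj (f : Pcl n) : exists x, gr_to_cl x = f.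
  move: n2 f; rewrite leq_eqVlt => /orP[/eqP ->|n1 f]; first exact: gr_to_cl_surj2.
  exact: gr_to_cl_surj_small.
have /choice[g gK] := surj; exists g => // x.
by apply: (gr_to_cl_inj char0); rewrite gK.
Qed.

End BinarySurjectivity.

Theorem theorem10p10 (F : fieldType) (char0 : [pchar F] =i pred0)
    (V : superspace F) (d : {linear V -> V})
    (d_even : forall b v, d (ss_par V b v) = ss_par V b (d v)) :
  exists phi : forall n, {linear op_car (gr_Pch d) n -> op_car (Pcl_operad d) n},
    [/\ graded_operad_morphism phi,
        forall n r (X : Pch d n), ch_fil r X ->
          forall (G : graph n) v, nedges G = r ->
            (phi n (gr_in (gr_cls r X)) : Pcl d n) G v = X v (pfun F G),
        forall n, injective (phi n) &
        forall n, (n <= 2)%N -> bijective (phi n)].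
Proof.
exists (fun n => @gr_to_cl F V d n : {linear grPch d n -> Pcl d n}).
split; [split|..] => [n s x|n m x y||r n x|n r X rX G v|n|n].
- exact: gr_to_cl_act.
- exact: gr_to_cl_comp.
- exact: gr_to_cl_unit.
- exact: gr_to_cl_deg.
- exact: gr_to_cl_in.
- exact: gr_to_cl_inj.
- exact: gr_to_cl_bij.
Qed.
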